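(* Consider the problem: given $M_1,\dots,M_n\in\mathbb{R}^{2\times2}$ that are simultaneously triangularizable and vectors $\bm w,\bm y\in\mathbb{R}^2$, find a permutation $\sigma$ of $[n]$ minimizing $\bm w^\top M_{\sigma(n)}M_{\sigma(n-1)}\cdots M_{\sigma(1)}\bm y$. (i) If all $M_i$ have nonnegative determinants, an optimal permutation can be computed in $O(n\log n)$ time. (ii) If some $M_i$ has a negative determinant, an optimal permutation can be computed in $O(k2^kn^6)$ time, where $k$ is the number of matrices $M_i$ with negative determinant.
   Context: Matrices $M_1,\dots,M_n\in\mathbb{R}^{m\times m}$ are simultaneously triangularizable if there is an invertible $P\in\mathbb{R}^{m\times m}$ with $P^{-1}M_iP$ upper triangular for every $i$. Running time is measured in a model where arithmetic operations and comparisons on reals cost unit time. *)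

(* Defs.v *)
From HB Require Import structures.
From mathcomp Require Import all_boot all_order all_algebra all_fingroup.
From mathcomp Require Import Rstruct.
Set Implicit Arguments. Unset Strict Implicit. Unset Printing Implicit Defensive.
Import Order.TTheory GRing.Theory Num.Theory.
Local Open Scope ring_scope.

Notation R := Rdefinitions.R.

Definition upper_triangular (m : nat) (A : 'M[R]_m) : Prop :=
  forall i j : 'I_m, (j < i)%N -> A i j = 0.

Definition simult_triangularizable (m n : nat) (Ms : 'I_n -> 'M[R]_m) : Prop :=
  exists P : 'M[R]_m, P \in unitmx /\
    forall i, upper_triangular (invmx P *m Ms i *m P).

Definition perm_product (n : nat) (Ms : 'I_n -> 'M[R]_2) (s : 'S_n) : 'M[R]_2 :=
  \big[mulmx/1%:M]_(i < n) Ms (s (rev_ord i)).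

Definition objective (n : nat) (Ms : 'I_n -> 'M[R]_2) (w y : 'cV[R]_2)
  (s : 'S_n) : R :=
  (w^T *m perm_product Ms s *m y) 0 0.

Definition optimal_perm (n : nat) (Ms : 'I_n -> 'M[R]_2) (w y : 'cV[R]_2)
  (s : 'S_n) : Prop :=
  forall t : 'S_n, objective Ms w y s <= objective Ms w y t.

Definition num_neg_det (n : nat) (Ms : 'I_n -> 'M[R]_2) : nat :=
  #|[set i | \det (Ms i) < 0]|.

(* Two unbounded memories: integer (nat) registers NM and real registers RM.
   Real registers are addressed indirectly through integer registers
   (RM[NM d]).  Every instruction costs one unit of time; real arithmetic
   (+,-,*,/) and real comparisons are unit cost, as in the paper.
   Integer operations are restricted to constants, +, truncated -,
   comparison and indirect load/store (no integer multiplication, so the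
   model cannot cheat by word-packing). *)

Inductive instr : Type :=
| RZero of nat
| ROne  of nat
| RCopy of nat & nat
| RAdd of nat & nat & nat
| RSub of nat & nat & nat
| RMul of nat & nat & nat
| RDiv of nat & nat & nat         (* x / 0 = 0 (MathComp convention) *)
| RLt of nat & nat & nat
| NConst of nat & nat
| NAdd of nat & nat & nat
| NSub of nat & nat & nat
| NLoad of nat & nat
| NStore of nat & nat
| NLt of nat & nat & nat
| Jmp of nat
| Halt.

Definition program := seq instr.

Record mstate := MState { pc : nat; nmem : nat -> nat; rmem : nat -> R }.

Definition upd {T : Type} (f : nat -> T) (d : nat) (v : T) : nat -> T :=
  fun j => if j == d then v else f j.

(* one step; None means the machine has halted (Halt or pc out of range) *)
Definition step (P : program) (s : mstate) : option mstate :=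
  let N := nmem s in let M := rmem s in let p := pc s in
  let rset d v := Some (MState p.+1 N (upd M (N d) v)) in
  let nset d v := Some (MState p.+1 (upd N d v) M) in
  match nth Halt P p with
  | RZero d => rset d 0
  | ROne d => rset d 1
  | RCopy d a => rset d (M (N a))
  | RAdd d a b => rset d (M (N a) + M (N b))
  | RSub d a b => rset d (M (N a) - M (N b))
  | RMul d a b => rset d (M (N a) * M (N b))
  | RDiv d a b => rset d (M (N a) / M (N b))
  | RLt a b l => Some (MState (if M (N a) < M (N b) then l else p.+1) N M)
  | NConst d c => nset d c
  | NAdd d a b => nset d (N a + N b)%N
  | NSub d a b => nset d (N a - N b)%N
  | NLoad d a => nset d (N (N a))
  | NStore a s' => Some (MState p.+1 (upd N (N a) (N s')) M)
  | NLt a b l => Some (MState (if (N a < N b)%N then l else p.+1) N M)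
  | Jmp l => Some (MState l N M)
  | Halt => None
  end.

Fixpoint run (P : program) (t : nat) (s : mstate) : option mstate :=
  match step P s with
  | None => Some s
  | Some s' => if t is t'.+1 then run P t' s' else None
  end.

Definition entry4 (A : 'M[R]_2) (r : nat) : R :=
  A (inord (r %/ 2)) (inord (r %% 2)).

(* Input encoding: NM[0] = n, all other integer registers 0;
   RM[4i..4i+3] = entries of M_(i+1) (row-major), RM[4n],RM[4n+1] = w,
   RM[4n+2],RM[4n+3] = y, all other real registers 0; pc = 0. *)
Definition input_state (n : nat) (Ms : 'I_n -> 'M[R]_2) (w y : 'cV[R]_2)
  : mstate :=
  MState 0 (fun j => if j == 0%N then n else 0%N)
    (fun a => match @insub nat (fun i => (i < n)%N) _ (a %/ 4)%N with
              | Some i => entry4 (Ms i) (a %% 4)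
              | None =>
                  if a == (4 * n)%N then w 0 0
                  else if a == (4 * n).+1 then w 1 0
                  else if a == (4 * n).+2 then y 0 0
                  else if a == (4 * n).+3 then y 1 0
                  else 0
              end).

(* P, started on the encoding of (M_1..M_n, w, y), halts within t steps and
   its output -- the 0-based indices sigma(1),...,sigma(n) stored in integer
   registers NM[1..n] -- is an optimal permutation. *)
Definition solves_within (P : program) (t : nat) (n : nat)
  (Ms : 'I_n -> 'M[R]_2) (w y : 'cV[R]_2) : Prop :=
  exists s', run P t (input_state Ms w y) = Some s' /\
    exists sigma : 'S_n,
      (forall i : 'I_n, nmem s' i.+1 = sigma i) /\ optimal_perm Ms w y sigma.

(* Main.v *)
(** Simultaneously triangularizable 2x2 matrices have a common eigenvector v.  In
    the orthogonal basis made of v and its rotation by a quarter turn they become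
    upper triangular matrices (a b; 0 d), and the objective is, up to a
    term that does not depend on the order, a fixed multiple of the upper right
    entry of the product.  Changing signs one may assume d >= 0, and that this
    entry is to be minimized.  (If the matrices pairwise commute every order is
    optimal; a nonzero column of a nonzero commutator is a common eigenvector.)

    Exchanging the adjacent blocks A and B of a product L B A R changes the entry
    by ta L * td R times the cross product of (a_A - d_A, b_A) and
    (a_B - d_B, b_B).  Comparing three blocks of an optimal order in this way shows
    that the matrices with positive determinant are met in the angular order of
    the vectors (a - d, b): those met so far always form an arc of this circular
    order, which grows at one end or the other according to the sign of the rest
    of the product.  Zero or parallel data are handled by an infinitesimal
    perturbation, as the number of orders is finite.  Without negative
    determinants the order is therefore one of the n rotations of the sorted
    list; otherwise one minimizes and maximizes over (set of the negative matrices
    used, arc), by dynamic programming.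

    The angle of (x, y) is replaced by a rational function of x and y, its
    position on the circle |x| + |y| = 1.  Programs of the machine are obtained by
    compiling a small imperative language with a cost semantics. *)

(* To every cut of an order, with R the product already applied and L the product to come, belongs
   the plane point [vert R L]. Passing a matrix moves it along a line with normal (a - d, b).
   Exchanging blocks shows that in an optimal order all cut points lie on one side of the line of
   each positive matrix. For three such lines the cyclic order of the normals then forces the
   orientation of three cut points on them, while the exchange formula yields the same orientation
   with the sign of the rest of the product. If the two disagree, all these orientations vanish,
   which makes the three normals parallel and contradicts their cyclic order.

   The search for the eigenvector stays linear because one nonscalar pivot suffices: matrices
   commuting with it commute with each other, so n commutators decide.

   The rest is shaped by the machine. It has no integer product or shift, so strides and powers of
   two are tabulated by additions and bits are scanned by comparison and subtraction. It has no
   square root, so the basis is not normalized; this multiplies every order by the same power of the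
   squared length of v. *)
Require Import Defs.
From HB Require Import structures.
From mathcomp Require Import all_boot all_order all_algebra all_fingroup.
From mathcomp Require Import Rstruct.
From mathcomp Require Import ring lra zify.
Set Implicit Arguments. Unset Strict Implicit. Unset Printing Implicit Defensive.
Import Order.TTheory GRing.Theory Num.Theory.
Local Open Scope ring_scope.

(** * Products of triangular matrices *)

Section Triangular.
Variable F : realFieldType.

Record tri := Tri { ta : F; tb : F; td : F }.
Definition tmul M N :=
  Tri (ta M * ta N) (ta M * tb N + tb M * td N) (td M * td N).
Definition tone := Tri 1 0 1.

Lemma tmulA : associative tmul.
Proof. by move=> [a b d] [a' b' d'] [a2 b2 d2]; rewrite /tmul /=; congr Tri; ring. Qed.
Lemma tmul1 : left_id tone tmul.
Proof. by move=> [a b d]; rewrite /tmul /=; congr Tri; ring. Qed.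
Lemma tmulr1 : right_id tone tmul.
Proof. by move=> [a b d]; rewrite /tmul /=; congr Tri; ring. Qed.

Definition tx M := ta M - td M.
(** The upper right entry of the commutator of M and N, the only one that can be nonzero. *)
Definition cr M N := tx M * tb N - tb M * tx N.
(** Counterclockwise cyclic order of three normals. Two positive cross products are asked for, not
    three, since one of the gaps may be half a turn or more. *)
Definition ccw A B C :=
  [|| (0 < cr A B) && (0 < cr B C), (0 < cr B C) && (0 < cr C A)
    | (0 < cr C A) && (0 < cr A B)].

Lemma ccw_rot A B C : ccw A B C = ccw B C A.
Proof. by rewrite /ccw; do 3!case: (0 < _). Qed.

(** Twice the signed area of the triangle PQS. *)
Definition orient (P Q S : F * F) :=
  (Q.1 - P.1) * (S.2 - Q.2) - (Q.2 - P.2) * (S.1 - Q.1).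
(** Height of Q over the line through P with normal [(tx M, tb M)], up to the length of the
    normal. *)
Definition sup M (P Q : F * F) := tx M * (Q.1 - P.1) + tb M * (Q.2 - P.2).

Lemma orient_rot P Q S : orient P Q S = orient Q S P.
Proof. by rewrite /orient; ring. Qed.

(** Two identities express the area, times [cr A B] or [cr B C], through the heights. In each of
    them only the difference of the heights of P and S over the line of B can have a bad sign; it
    enters with opposite signs, so one identity always applies. *)
Lemma orient_ge0_aux A B C P Q S :
  0 <= sup A P Q -> 0 <= sup A P S -> 0 <= sup B Q P -> 0 <= sup B Q S ->
  0 <= sup C S P -> 0 <= sup C S Q ->
  0 < cr A B -> 0 < cr B C -> 0 <= orient P Q S.
Proof.
move=> s12 s13 s21 s23 s31 s32 c12 c23.
have e1 : orient P Q S * cr A B =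
    sup A P S * sup B Q P + sup A P Q * (sup B Q S - sup B Q P).
  by rewrite /orient /cr /sup; ring.
have e2 : orient P Q S * cr B C =
    sup C S P * sup B Q S + sup C S Q * (sup B Q P - sup B Q S).
  by rewrite /orient /cr /sup; ring.
case: (lerP (sup B Q P) (sup B Q S)) => h.
- by rewrite -(pmulr_lge0 _ c12) e1 addr_ge0 ?mulr_ge0 ?subr_ge0.
- by rewrite -(pmulr_lge0 _ c23) e2 addr_ge0 ?mulr_ge0 ?subr_ge0 // ltW.
Qed.

(* If the half-planes [sup A P _ >= 0], ... with inner normals A, B, C in
   counterclockwise order all contain P, Q, S, which lie on their respective
   boundaries, then P, Q, S are in counterclockwise order as well. *)
Lemma orient_ge0 A B C P Q S :
  0 <= sup A P Q -> 0 <= sup A P S -> 0 <= sup B Q P -> 0 <= sup B Q S ->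
  0 <= sup C S P -> 0 <= sup C S Q ->
  ccw A B C -> 0 <= orient P Q S.
Proof.
move=> s12 s13 s21 s23 s31 s32 /or3P[] /andP[h1 h2].
- exact: (orient_ge0_aux s12 s13 s21 s23 s31 s32).
- by rewrite orient_rot; exact: (orient_ge0_aux s23 s21 s32 s31 s12 s13).
- by rewrite -orient_rot; exact: (orient_ge0_aux s31 s32 s13 s12 s23 s21).
Qed.

(** The second column of R scaled by [ta L]. The cuts of one order thus give a path in the plane,
    and by [sup_edge] the edge of M is orthogonal to [(tx M, tb M)]. *)
Definition vert (R L : tri) : F * F := (ta L * tb R, ta L * td R).

(* Optimality against swapping the adjacent blocks A and B of L B A R. *)
Definition star L B A R := 0 <= ta L * td R * cr A B.

(** The height of a later cut over the line of M is the exchange term of M and B weighted by [td M];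
    for an earlier cut, in [sup_before], the weight is [ta M]. With [ta M < 0] the two would fall on
    opposite sides, so only positive matrices give supporting lines. *)
Lemma sup_after L B M R :
  sup M (vert R (tmul (tmul L B) M)) (vert (tmul B (tmul M R)) L) =
  td M * (ta L * td R * cr M B).
Proof. by rewrite /sup /vert /cr /tx /=; ring. Qed.

Lemma sup_before L M B R :
  sup M (vert (tmul M (tmul B R)) L) (vert R (tmul (tmul L M) B)) =
  ta M * (ta L * td R * cr B M).
Proof. by rewrite /sup /vert /cr /tx /=; ring. Qed.

Lemma sup_edge L M R : sup M (vert R (tmul L M)) (vert (tmul M R) L) = 0.
Proof. by rewrite /sup /vert /tx /=; ring. Qed.

Lemma sup_trans M P Q S : sup M P Q = 0 -> sup M P S = sup M Q S.
Proof. by rewrite /sup => h; apply/eqP; rewrite -subr_eq0; apply/eqP; rewrite -h; ring. Qed.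

(** The turn of the path at three cuts is the exchange term again, up to a square, the positive [td]
    factors and the sign of what follows the middle cut. *)
Lemma orient_vert L B A R :
  ta (tmul L B) * orient (vert R (tmul (tmul L B) A)) (vert (tmul A R) (tmul L B))
    (vert (tmul B (tmul A R)) L) =
  (ta L * td R * cr A B) * (ta L * ta B) ^+ 2 * (td A * td R).
Proof. by rewrite /orient /vert /cr /tx /=; ring. Qed.

End Triangular.

Section Ordering.
Variables (F : realFieldType) (I : eqType) (f : I -> tri F).

(** The head of the list is applied first, hence is the rightmost factor. *)
Definition tprod (s : seq I) : tri F :=
  foldl (fun M x => tmul (f x) M) (tone F) s.

Lemma tprod0 : tprod [::] = tone F. Proof. by []. Qed.

Lemma tprod_rcons s x : tprod (rcons s x) = tmul (f x) (tprod s).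
Proof. by rewrite /tprod foldl_rcons. Qed.

Lemma tprod_cat s1 s2 : tprod (s1 ++ s2) = tmul (tprod s2) (tprod s1).
Proof.
elim/last_ind: s2 => [|s2 x IH]; first by rewrite cats0 tmul1.
by rewrite -rcons_cat !tprod_rcons IH tmulA.
Qed.

Lemma tprod1 x : tprod [:: x] = f x.
Proof. by rewrite /tprod /= tmulr1. Qed.

Lemma tprod_cons x s : tprod (x :: s) = tmul (tprod s) (f x).
Proof. by rewrite -cat1s tprod_cat tprod1. Qed.

Lemma ta_tprod s : ta (tprod s) = \prod_(x <- s) ta (f x).
Proof.
elim: s => [|x s IH]; first by rewrite big_nil.
by rewrite big_cons tprod_cons /= IH mulrC.
Qed.

Lemma td_tprod s : td (tprod s) = \prod_(x <- s) td (f x).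
Proof.
elim: s => [|x s IH]; first by rewrite big_nil.
by rewrite big_cons tprod_cons /= IH mulrC.
Qed.

Definition optimal s := forall s', perm_eq s' s -> tb (tprod s) <= tb (tprod s').

Lemma optimal_star r a b l : optimal (r ++ a ++ b ++ l) ->
  star (tprod l) (tprod b) (tprod a) (tprod r).
Proof.
move=> /(_ (r ++ b ++ a ++ l)); rewrite perm_cat2l perm_catCA => /(_ (perm_refl _)).
rewrite !tprod_cat /star -subr_ge0; congr (0 <= _).
by rewrite /cr /tx /=; ring.
Qed.

Definition regular x := (0 < td (f x)) && (ta (f x) != 0).

Lemma td_gt0 s : all regular s -> 0 < td (tprod s).
Proof.
elim/last_ind: s => [|s x IH]; first by rewrite /= ltr01.
by rewrite all_rcons tprod_rcons /= => /andP[/andP[h _]] /IH; exact: mulr_gt0.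
Qed.

Lemma ta_neq0 s : all regular s -> ta (tprod s) != 0.
Proof.
elim/last_ind: s => [|s x IH]; first by rewrite /= oner_neq0.
by rewrite all_rcons tprod_rcons /= => /andP[/andP[_ h]] /IH; exact: mulf_neq0.
Qed.

(** * Three positive matrices of an optimal order *)

Section Triple.
Variables (s1 s2 s3 s4 : seq I) (x y z : I).
Let s := s1 ++ x :: s2 ++ y :: s3 ++ z :: s4.
Hypothesis (opt : optimal s) (reg : all regular s).
Hypothesis (px : 0 < ta (f x)) (py : 0 < ta (f y)) (pz : 0 < ta (f z)).

(** [Ri] and [Li] are the products before and after six cuts, those just before and just after x, y
    and z. The boolean of [vx], [vy], [vz] chooses the side. *)
Let L5 := tprod s4.
Let L4 := tmul L5 (f z).
Let L3 := tmul L4 (tprod s3).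
Let L2 := tmul L3 (f y).
Let L1 := tmul L2 (tprod s2).
Let L0 := tmul L1 (f x).
Let R0 := tprod s1.
Let R1 := tmul (f x) R0.
Let R2 := tmul (tprod s2) R1.
Let R3 := tmul (f y) R2.
Let R4 := tmul (tprod s3) R3.
Let R5 := tmul (f z) R4.
Let vx (i : bool) := if i then vert R1 L1 else vert R0 L0.
Let vy (i : bool) := if i then vert R3 L3 else vert R2 L2.
Let vz (i : bool) := if i then vert R5 L5 else vert R4 L4.

Let st r a b l : s = r ++ a ++ b ++ l ->
  star (tprod l) (tprod b) (tprod a) (tprod r).
Proof. by move=> e; apply: optimal_star; rewrite -e. Qed.

Let dx : 0 < td (f x).
Proof. by move: reg; rewrite /s all_cat /= => /and3P[_ /andP[]]. Qed.
Let dy : 0 < td (f y).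
Proof.
by move: reg; rewrite /s all_cat /= all_cat /= => /and5P[_ _ _ /andP[]].
Qed.

Let after r m b l : s = r ++ m :: b ++ l -> 0 < td (f m) ->
  0 <= sup (f m) (vert (tprod r) (tmul (tmul (tprod l) (tprod b)) (f m)))
          (vert (tmul (tprod b) (tmul (f m) (tprod r))) (tprod l)).
Proof.
move=> e h; rewrite sup_after mulr_ge0 ?(ltW h) //.
by have := @st r [:: m] b l e; rewrite /star tprod1.
Qed.

Let before r b m l : s = r ++ b ++ m :: l -> 0 < ta (f m) ->
  0 <= sup (f m) (vert (tmul (f m) (tmul (tprod b) (tprod r))) (tprod l))
   (vert (tprod r) (tmul (tmul (tprod l) (f m)) (tprod b))).
Proof.
move=> e h; rewrite sup_before mulr_ge0 ?(ltW h) //.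
by have := @st r b [:: m] l e; rewrite /star tprod1.
Qed.

(** Both ends of the edge of x lie on its line, so either serves as base point. *)
Let sup_x i V : sup (f x) (vx i) V = sup (f x) (vx false) V.
Proof. by case: i => //; apply/esym/sup_trans/sup_edge. Qed.
Let sup_y i V : sup (f y) (vy i) V = sup (f y) (vy false) V.
Proof. by case: i => //; apply/esym/sup_trans/sup_edge. Qed.
Let sup_y' i V : sup (f y) (vy i) V = sup (f y) (vy true) V.
Proof. by rewrite sup_y -(sup_y true). Qed.
Let sup_z i V : sup (f z) (vz i) V = sup (f z) (vz true) V.
Proof. by case: i => //; apply/sup_trans/sup_edge. Qed.

Let norm := (tprod_cat, tprod_cons, tprod0, tmul1, tmulr1, tmulA).

Ltac fin := rewrite /vx /vy /vz /R5 /R4 /R3 /R2 /R1 /R0 /L0 /L1 /L2 /L3 /L4 /L5 !norm.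

Let sxy i j : 0 <= sup (f x) (vx i) (vy j).
Proof.
rewrite sup_x; case: j.
- have := @after s1 x (s2 ++ [:: y]) (s3 ++ z :: s4) _ dx.
  by fin; apply; rewrite /s -?catA /= -?catA /= -?catA.
- by have := @after s1 x s2 (y :: s3 ++ z :: s4) erefl dx; fin.
Qed.

Let sxz i j : 0 <= sup (f x) (vx i) (vz j).
Proof.
rewrite sup_x; case: j.
- have := @after s1 x (s2 ++ y :: s3 ++ [:: z]) s4 _ dx.
  by fin; apply; rewrite /s -?catA /= -?catA /= -?catA.
- have := @after s1 x (s2 ++ y :: s3) (z :: s4) _ dx.
  by fin; apply; rewrite /s -?catA /= -?catA /= -?catA.
Qed.

Let syz i j : 0 <= sup (f y) (vy i) (vz j).
Proof.
rewrite sup_y; case: j.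
- have := @after (s1 ++ x :: s2) y (s3 ++ [:: z]) s4 _ dy.
  by fin; apply; rewrite /s -?catA /= -?catA /= -?catA.
- have := @after (s1 ++ x :: s2) y s3 (z :: s4) _ dy.
  by fin; apply; rewrite /s -?catA /= -?catA /= -?catA.
Qed.

Let syx i j : 0 <= sup (f y) (vy i) (vx j).
Proof.
rewrite sup_y'; case: j.
- have := @before (s1 ++ [:: x]) s2 y (s3 ++ z :: s4) _ py.
  by fin; apply; rewrite /s -?catA /= -?catA /= -?catA.
- have := @before s1 (x :: s2) y (s3 ++ z :: s4) _ py.
  by fin; apply; rewrite /s -?catA /= -?catA /= -?catA.
Qed.

Let szx i j : 0 <= sup (f z) (vz i) (vx j).
Proof.
rewrite sup_z; case: j.
- have := @before (s1 ++ [:: x]) (s2 ++ y :: s3) z s4 _ pz.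
  by fin; apply; rewrite /s -?catA /= -?catA /= -?catA.
- have := @before s1 (x :: s2 ++ y :: s3) z s4 _ pz.
  by fin; apply; rewrite /s -?catA /= -?catA /= -?catA.
Qed.

Let szy i j : 0 <= sup (f z) (vz i) (vy j).
Proof.
rewrite sup_z; case: j.
- have := @before (s1 ++ x :: s2 ++ [:: y]) s3 z s4 _ pz.
  by fin; apply; rewrite /s -?catA /= -?catA /= -?catA.
- have := @before (s1 ++ x :: s2) (y :: s3) z s4 _ pz.
  by fin; apply; rewrite /s -?catA /= -?catA /= -?catA.
Qed.

Let orv r a b l : s = r ++ a ++ b ++ l ->
  0 <= ta (tmul (tprod l) (tprod b)) *
    orient (vert (tprod r) (tmul (tmul (tprod l) (tprod b)) (tprod a)))
      (vert (tmul (tprod a) (tprod r)) (tmul (tprod l) (tprod b)))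
      (vert (tmul (tprod b) (tmul (tprod a) (tprod r))) (tprod l)).
Proof.
move=> e; rewrite orient_vert; apply: mulr_ge0.
  by apply: mulr_ge0; [exact: st e | exact: sqr_ge0].
by apply: mulr_ge0; apply/ltW/td_gt0; move: reg; rewrite e !all_cat => /and4P[].
Qed.

Let orv' i j k : 0 <= ta L3 * orient (vx i) (vy j) (vz k).
Proof.
(* What follows the middle cut is [L3], or [L2] if that cut precedes y; the two have the same sign
   because [ta (f y)] is positive. *)
suff h : 0 <= (if j then ta L3 else ta L2) * orient (vx i) (vy j) (vz k).
  by move: h; case: j => //; rewrite /L2 /= mulrAC pmulr_lge0.
case: i; case: j; case: k.
- have := @orv (s1 ++ [:: x]) (s2 ++ [:: y]) (s3 ++ [:: z]) s4 _.
  by fin; apply; rewrite /s -?catA /= -?catA /= -?catA.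
- have := @orv (s1 ++ [:: x]) (s2 ++ [:: y]) s3 (z :: s4) _.
  by fin; apply; rewrite /s -?catA /= -?catA /= -?catA.
- have := @orv (s1 ++ [:: x]) s2 (y :: s3 ++ [:: z]) s4 _.
  by fin; apply; rewrite /s -?catA /= -?catA /= -?catA.
- have := @orv (s1 ++ [:: x]) s2 (y :: s3) (z :: s4) _.
  by fin; apply; rewrite /s -?catA /= -?catA /= -?catA.
- have := @orv s1 (x :: s2 ++ [:: y]) (s3 ++ [:: z]) s4 _.
  by fin; apply; rewrite /s -?catA /= -?catA /= -?catA.
- have := @orv s1 (x :: s2 ++ [:: y]) s3 (z :: s4) _.
  by fin; apply; rewrite /s -?catA /= -?catA /= -?catA.
- have := @orv s1 (x :: s2) (y :: s3 ++ [:: z]) s4 _.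
  by fin; apply; rewrite /s -?catA /= -?catA /= -?catA.
- have := @orv s1 (x :: s2) (y :: s3) (z :: s4) _.
  by fin; apply; rewrite /s -?catA /= -?catA /= -?catA.
Qed.

Let L3_neq0 : ta L3 != 0.
Proof.
have := @ta_neq0 (s3 ++ z :: s4); rewrite !norm; apply.
by move: reg; rewrite /s all_cat /= all_cat /= => /and5P[_ _ _ _].
Qed.

(* If the three edges were collinear with each other in every choice of their
   endpoints, the second differences of [orient] would make them parallel. *)
Let not_all_collinear :
  (forall i j k, orient (vx i) (vy j) (vz k) = 0) ->
  ~~ [|| 0 < cr (f x) (f y), 0 < cr (f y) (f z), 0 < cr (f z) (f x),
    0 < cr (f y) (f x), 0 < cr (f z) (f y) | 0 < cr (f x) (f z)].
Proof.
move=> h.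
have hR r : (exists l, s = r ++ l) -> td (tprod r) != 0.
  move=> [l e]; apply/lt0r_neq0/td_gt0.
  by move: reg; rewrite e all_cat => /andP[].
have hL l : (exists r, s = r ++ l) -> ta (tprod l) != 0.
  move=> [r e]; apply/ta_neq0.
  by move: reg; rewrite e all_cat => /andP[].
have r0 : td R0 != 0 by apply: hR; exists (x :: s2 ++ y :: s3 ++ z :: s4).
have r2 : td R2 != 0.
  have := hR (s1 ++ x :: s2); fin; apply.
  by exists (y :: s3 ++ z :: s4); rewrite /s -?catA /= -?catA /= -?catA.
have r4 : td R4 != 0.
  have := hR (s1 ++ x :: s2 ++ y :: s3); fin; apply.
  by exists (z :: s4); rewrite /s -?catA /= -?catA /= -?catA.
have l5 : ta L5 != 0.
  apply: hL; exists (s1 ++ x :: s2 ++ y :: s3 ++ [:: z]).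
  by rewrite /s -?catA /= -?catA /= -?catA.
have l1 : ta L1 != 0.
  have := hL (s2 ++ y :: s3 ++ z :: s4); fin; apply.
  by exists (s1 ++ [:: x]); rewrite /s -?catA /= -?catA /= -?catA.
have exy : cr (f x) (f y) * (ta L1 * td R0 * ta L3 * td R2) =
   orient (vx true) (vy true) (vz true) - orient (vx false) (vy true) (vz true)
   - orient (vx true) (vy false) (vz true) + orient (vx false) (vy false) (vz true).
  rewrite /orient /vx /vy /vert; move: (vz true) => P.
  by rewrite /L0 /L2 /R1 /R3 /= /cr /tx; ring.
have eyz : cr (f y) (f z) * (ta L3 * td R2 * ta L5 * td R4) =
   orient (vx true) (vy true) (vz true) - orient (vx true) (vy true) (vz false)
   - orient (vx true) (vy false) (vz true) + orient (vx true) (vy false) (vz false).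
  rewrite /orient /vz /vy /vert; move: (vx true) => P.
  by rewrite /L4 /L2 /R5 /R3 /= /cr /tx; ring.
have exz : cr (f x) (f z) * (ta L1 * td R0 * ta L5 * td R4) =
   - orient (vx true) (vy true) (vz true) + orient (vx false) (vy true) (vz true)
   + orient (vx true) (vy true) (vz false) - orient (vx false) (vy true) (vz false).
  rewrite /orient /vz /vx /vert; move: (vy true) => P.
  by rewrite /L4 /L0 /R5 /R1 /= /cr /tx; ring.
have c0 (c p q r k : F) : p != 0 -> q != 0 -> r != 0 -> k != 0 ->
    c * (p * q * r * k) = 0 -> c = 0.
  move=> p0 q0 r0' k0 /eqP; rewrite !mulf_eq0.
  by rewrite (negPf p0) (negPf q0) (negPf r0') (negPf k0) !orbF => /eqP.
have zxy := c0 _ _ _ _ _ l1 r0 L3_neq0 r2 (etrans exy _).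
have zyz := c0 _ _ _ _ _ L3_neq0 r2 l5 r4 (etrans eyz _).
have zxz := c0 _ _ _ _ _ l1 r0 l5 r4 (etrans exz _).
have {}zxy : cr (f x) (f y) = 0 by apply: zxy; rewrite !h !(subr0, oppr0, addr0).
have {}zyz : cr (f y) (f z) = 0 by apply: zyz; rewrite !h !(subr0, oppr0, addr0).
have {}zxz : cr (f x) (f z) = 0 by apply: zxz; rewrite !h !(subr0, oppr0, addr0).
have crN A B : cr A B = - cr B A :> F by rewrite /cr; ring.
by rewrite zxy zyz zxz crN zxz crN zxy crN zyz oppr0 ltxx.
Qed.

(** With a positive rest, optimality makes all eight orientations nonnegative, and the cyclic order
    x, z, y of the supporting lines makes them nonpositive. So all vanish, against
    [not_all_collinear]. *)
Lemma triple_pos : 0 < ta (tprod (s3 ++ z :: s4)) -> ~~ ccw (f x) (f z) (f y).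
Proof.
rewrite !norm -/L4 -/L3 => hL; apply/negP => hc.
have := not_all_collinear _; rewrite (_ : [|| _, _, _, _, _ | _]) => [h|].
  suff: false by []; apply: h => i j k; apply/eqP; rewrite eq_le.
  have := orv' i j k; rewrite pmulr_rge0 // => ->; rewrite andbT.
  have -> : orient (vx i) (vy j) (vz k) = - orient (vx i) (vz k) (vy j).
    by rewrite /orient; ring.
  rewrite oppr_le0; exact: orient_ge0 (sxz _ _) (sxy _ _) (szx _ _) (szy _ _)
    (syx _ _) (syz _ _) hc.
by case/or3P: hc => /andP[-> ->]; rewrite ?orbT.
Qed.

Lemma triple_neg : ta (tprod (s3 ++ z :: s4)) < 0 -> ~~ ccw (f x) (f y) (f z).
Proof.
rewrite !norm -/L4 -/L3 => hL; apply/negP => hc.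
have := not_all_collinear _; rewrite (_ : [|| _, _, _, _, _ | _]) => [h|].
  suff: false by []; apply: h => i j k; apply/eqP; rewrite eq_le.
  have := orv' i j k; rewrite nmulr_rge0 // => ->; rewrite /=.
  exact: orient_ge0 (sxy _ _) (sxz _ _) (syx _ _) (syz _ _) (szx _ _) (szy _ _) hc.
by case/or3P: hc => /andP[-> ->]; rewrite ?orbT.
Qed.

End Triple.
End Ordering.

(** * Sets of negative matrices as binary numbers *)

Section Bits.
Local Open Scope nat_scope.

Definition bit S j := odd (S %/ 2 ^ j).

Lemma bitD S i j : ~~ bit S j -> bit (S + 2 ^ j) i = (i == j) || bit S i.
Proof.
rewrite /bit => h; have e := divn_eq S (2 ^ j).
case: (ltngtP i j) => [ij|ij|->] /=.
- rewrite -(subnK (ltnW ij)) expnD addnC divnMDl ?expn_gt0 // oddD oddX.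
  by rewrite subn_eq0 leqNgt ij.
- rewrite -(subnKC (ltnW ij)) expnD !divnMA addnC -{1}[2 ^ j]mul1n.
  rewrite divnMDl ?expn_gt0 // -(subnSK ij) expnS !divnMA !divn2.
  by rewrite add1n -uphalfE uphalf_half (negPf h).
- by rewrite addnC -{1}[2 ^ j]mul1n divnMDl ?expn_gt0 // oddD h.
Qed.

Lemma bit_le S j : bit S j -> 2 ^ j <= S.
Proof.
by rewrite /bit => h; rewrite leqNgt; apply/negP => lt; rewrite divn_small in h.
Qed.

Lemma bitB S j : bit S j -> ~~ bit (S - 2 ^ j) j.
Proof.
move=> h; have le := bit_le h; move: h; rewrite -{1}(subnK le) /bit.
by rewrite addnC -{1}[2 ^ j]mul1n divnMDl ?expn_gt0 // oddD.
Qed.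

Lemma bit_sub S i j : bit S j -> bit (S - 2 ^ j) i = (i != j) && bit S i.
Proof.
move=> h; have := bitD i (bitB h); rewrite subnK ?bit_le //.
by case: eqP => [->|_] //= _; rewrite (negPf (bitB h)).
Qed.

Lemma bits_eq0 k S : S < 2 ^ k -> (forall j, j < k -> ~~ bit S j) -> S = 0.
Proof.
elim: k => [|k IH] lt h; first by case: S lt {h}.
apply: IH => [|j jk]; last by apply: h; exact: ltnW.
have lt2 : S %/ 2 ^ k < 2 by rewrite ltn_divLR ?expn_gt0 // -expnS.
have := h k (ltnSn k); rewrite /bit; case e : (S %/ 2 ^ k) lt2 => [|[|]] // _ _.
by rewrite -(ltn_pmul2r (ltn0Sn 0)) !muln1 -[X in _ < X]mul1n -ltn_divLR ?expn_gt0 // e.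
Qed.

Lemma bit_full k j : j < k -> bit (2 ^ k).-1 j.
Proof.
move=> jk; rewrite /bit.
have -> : (2 ^ k).-1 = (2 ^ (k - j)).-1 * 2 ^ j + (2 ^ j).-1.
  rewrite -{1}(subnK (ltnW jk)) expnD.
  have := expn_gt0 2 (k - j); have := expn_gt0 2 j; nia.
rewrite divnMDl ?expn_gt0 // divn_small ?ltn_predL ?expn_gt0 // addn0.
have : ~~ odd (2 ^ (k - j)) by rewrite oddX subn_eq0 leqNgt jk.
have := expn_gt0 2 (k - j); case: (2 ^ (k - j)) => // n _ /=.
by rewrite negbK.
Qed.

End Bits.

Section Grow.
Variables (I : eqType) (idx neg : nat -> I) (k : nat).
Local Open Scope nat_scope.

(* [grow S l len s]: [s] lists the elements [neg j] with [j] a bit of [S] and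
   the elements [idx t] with [l <= t < l + len], in such an order that the set
   of the [t]'s met so far is always an interval. *)
Inductive grow : nat -> nat -> nat -> seq I -> Prop :=
| grow_nil l : grow 0 l 0 [::]
| grow_right S l len s : grow S l len s ->
    grow S l len.+1 (rcons s (idx (l + len)))
| grow_left S l len s : grow S l.+1 len s -> grow S l len.+1 (rcons s (idx l))
| grow_neg S l len s j : j < k -> ~~ bit S j -> grow S l len s ->
    grow (S + 2 ^ j) l len (rcons s (neg j)).

Lemma grow_perm S l len s : grow S l len s ->
  perm_eq s ([seq idx t | t <- iota l len] ++ [seq neg j | j <- iota 0 k & bit S j]).
Proof.
elim=> {S l len s} [l|S l len s _ IH|S l len s _ IH|S l len s j jk hj _ IH].
- suff -> : [seq j <- iota 0 k | bit 0 j] = [::] by [].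
  by rewrite (@eq_filter _ _ pred0) ?filter_pred0 // => j; rewrite /bit div0n.
- rewrite -[len.+1]addn1 iotaD map_cat -catA -cats1 perm_catC perm_sym.
  by rewrite perm_catCA perm_sym /= perm_cons.
- by rewrite -cats1 perm_catC /= perm_cons.
- rewrite -cats1 perm_catC /= perm_sym.
  have -> : [seq i <- iota 0 k | bit (S + 2 ^ j) i] =
            [seq i <- iota 0 k | (i == j) || bit S i].
    by apply: eq_filter => i; rewrite bitD.
  have : perm_eq [seq i <- iota 0 k | (i == j) || bit S i]
                 (j :: [seq i <- iota 0 k | bit S i]).
    apply: uniq_perm.
    - by rewrite filter_uniq ?iota_uniq.
    - by rewrite /= mem_filter (negPf hj) filter_uniq ?iota_uniq.
    - move=> i; rewrite !inE !mem_filter mem_iota /= add0n.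
      by case: eqP => [->|] //=; rewrite jk (negPf hj).
  move=> /(perm_map neg) h; rewrite -(perm_cat2l [seq idx t | t <- iota l len]) in h.
  apply: perm_trans h _; rewrite map_cons -cat1s perm_catCA /= perm_cons.
  by rewrite perm_sym.
Qed.

End Grow.

(** * Arcs, for nonsingular matrices with distinct angles *)

Section Structure.
Variables (F : realFieldType) (I : eqType) (f : I -> tri F) (x0 : I).

Definition ccw_sorted (pos : seq I) := forall i j l : nat, (i < j < l)%N ->
  (l < size pos)%N -> ccw (f (nth x0 pos i)) (f (nth x0 pos j)) (f (nth x0 pos l)).

Lemma ccw_sorted_rot n pos : ccw_sorted pos -> ccw_sorted (rot n pos).
Proof.
move=> h; elim: n => [|n IH]; first by rewrite rot0.
case: (ltnP n (size pos)) => [lt|le]; last first.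
  by rewrite rot_oversize // (leq_trans le).
rewrite -add1n rotD ?add1n //; move: (rot n pos) IH => {h lt pos} [|x pos] h; first by move=> ? ? ?; rewrite ltn0.
rewrite rot1_cons => i j l /andP[ij jl]; rewrite size_rcons ltnS => ls.
rewrite !nth_rcons (ltn_trans ij (leq_trans jl ls)) (leq_trans jl ls).
move: ls; rewrite leq_eqVlt => /predU1P[el|ls].
  rewrite el ltnn eqxx -ccw_rot; apply: (h 0%N i.+1 j.+1); first by rewrite /= ltnS.
  by rewrite /= ltnS -el.
by rewrite ls; apply: (h i.+1 j.+1 l.+1) => //; rewrite !ltnS ij.
Qed.

Variables (pos neg s : seq I).
Hypothesis (pn_uniq : uniq (pos ++ neg)) (s_perm : perm_eq s (pos ++ neg)).
Hypothesis (opt : optimal f s).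
Hypothesis (pos_gt0 : {in pos, forall x, 0 < ta (f x) /\ 0 < td (f x)}).
Hypothesis (neg_lt0 : {in neg, forall x, ta (f x) < 0 /\ 0 < td (f x)}).

Let reg : all (regular f) s.
Proof.
apply/allP => x; rewrite (perm_mem s_perm) mem_cat /regular.
case/orP => [/pos_gt0|/neg_lt0] [h1 ->] //=; first by rewrite gt_eqF.
by rewrite lt_eqF.
Qed.

Section LastPositive.
Hypothesis (pos_ccw : ccw_sorted pos).
(** [pos] is assumed to be rotated so that the positive matrix met last stands at its end. Used as
    the third point of every triple, it turns the cyclic order into a linear one. *)
Let z := nth x0 pos (size pos).-1.
Hypothesis (z_last : forall p x q, s = p ++ x :: q -> x \in pos -> x != z -> z \in q).

Let m := size pos.

Let pos_uniq : uniq pos. Proof. by move: pn_uniq; rewrite cat_uniq => /and3P[]. Qed.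

Let nth_eqz t : (t < m)%N -> (nth x0 pos t == z) = (t == m.-1).
Proof. by move=> tm; rewrite /z nth_uniq // -/m; lia. Qed.

Let ta_suffix p q : s = p ++ q -> ta (tprod f q) != 0.
Proof. by move=> e; apply/ta_neq0; move: reg; rewrite e all_cat => /andP[]. Qed.

Let s_uniq : uniq s. Proof. by rewrite (perm_uniq s_perm). Qed.

Let order_aux p a q t u : s = p ++ a :: q -> a = nth x0 pos t -> (t < m)%N ->
  nth x0 pos u \in p -> (u < m)%N -> (u != m.-1).
Proof.
move=> e ea tm up um; apply/negP => /eqP eu.
have uz : nth x0 pos u = z by rewrite eu.
have ap : a \in pos by rewrite ea mem_nth.
have zp : z \in p by rewrite -uz.
have az : a != z.
  apply/negP => /eqP az; move: s_uniq; rewrite e cat_uniq /= => /and3P[_].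
  by rewrite negb_or az zp.
have zq := z_last e ap az; move: s_uniq; rewrite e cat_uniq /= => /and3P[_].
by rewrite negb_or => /andP[_ /hasPn/(_ z zq)]; rewrite /= zp.
Qed.

(** If the rest were positive, [triple_pos] for u, t, z, the order in which they are met, would
    contradict the angular order t, u, z. *)
Lemma order_right p q t u : s = p ++ nth x0 pos t :: q -> (t < u < m)%N ->
  nth x0 pos u \in p -> ta (tprod f q) < 0.
Proof.
move=> e /andP[tu um] up; have tm := ltn_trans tu um.
have uz := order_aux e erefl tm up um.
have zq : z \in q by apply: (z_last e); rewrite ?mem_nth // nth_eqz //; lia.
rewrite lt_neqAle (@ta_suffix (rcons p (nth x0 pos t))) ?cat_rcons //=.
rewrite leNgt; apply/negP => hpos.
case/splitPr: up e => p1 p2; case/splitPr: zq hpos => q1 q2 hpos e.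
have e' : s = p1 ++ nth x0 pos u :: p2 ++ nth x0 pos t :: q1 ++ z :: q2.
  by rewrite e -catA.
have mz : z \in pos by rewrite mem_nth //; lia.
have mt : nth x0 pos t \in pos by rewrite mem_nth.
have mu : nth x0 pos u \in pos by rewrite mem_nth.
have /negP[] := @triple_pos _ _ f p1 p2 q1 q2 (nth x0 pos u) (nth x0 pos t) z
  (eq_ind _ (optimal f) opt _ e') (eq_ind _ (all (regular f)) reg _ e')
  (pos_gt0 mt).1 (pos_gt0 mz).1 hpos.
rewrite -ccw_rot; apply: pos_ccw; rewrite ?tu /=; last by move: um; clear; lia.
by move: uz um; clear; lia.
Qed.

Lemma order_left p q t u : s = p ++ nth x0 pos t :: q -> (u < t < m.-1)%N ->
  nth x0 pos u \in p -> 0 < ta (tprod f q).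
Proof.
move=> e /andP[ut tm1] up; have tm : (t < m)%N by lia.
have um : (u < m)%N by lia.
have zq : z \in q by apply: (z_last e); rewrite ?mem_nth // nth_eqz //; lia.
rewrite lt_neqAle eq_sym (@ta_suffix (rcons p (nth x0 pos t))) ?cat_rcons //=.
rewrite leNgt; apply/negP => hneg.
case/splitPr: up e => p1 p2; case/splitPr: zq hneg => q1 q2 hneg e.
have e' : s = p1 ++ nth x0 pos u :: p2 ++ nth x0 pos t :: q1 ++ z :: q2.
  by rewrite e -catA.
have mz : z \in pos by rewrite mem_nth //; lia.
have mt : nth x0 pos t \in pos by rewrite mem_nth.
have mu : nth x0 pos u \in pos by rewrite mem_nth.
have /negP[] := @triple_neg _ _ f p1 p2 q1 q2 (nth x0 pos u) (nth x0 pos t) z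
  (eq_ind _ (optimal f) opt _ e') (eq_ind _ (all (regular f)) reg _ e')
  (pos_gt0 mt).1 (pos_gt0 mz).1 hneg.
by apply: pos_ccw; rewrite ?ut /=; move: tm1; rewrite -/m; clear; lia.
Qed.

Let rcons_uniq_notin p x q : s = rcons p x ++ q -> x \notin p.
Proof. by move=> e; move: s_uniq; rewrite e cat_uniq rcons_uniq => /andP[/andP[]]. Qed.

Let mem_s p x q : s = rcons p x ++ q -> x \in pos ++ neg.
Proof. by move=> e; rewrite -(perm_mem s_perm) e mem_cat mem_rcons inE eqxx. Qed.

(** The prefix is taken apart from its end. If the index removed were interior to the interval, both
    ends of the interval would have been met earlier, and [order_right] and [order_left] would give
    the rest both signs. *)
Lemma prefix_grow p q (S l len : nat) : s = p ++ q -> (l + len <= m)%N ->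
  (S < 2 ^ size neg)%N ->
  (forall t, (t < m)%N -> (nth x0 pos t \in p) = (l <= t < l + len)%N) ->
  (forall j, (j < size neg)%N -> (nth x0 neg j \in p) = bit S j) ->
  grow (nth x0 pos) (nth x0 neg) (size neg) S l len p.
Proof.
elim/last_ind: p q S l len => [|p x IH] q S l len e hl hS hp hn.
  have -> : len = 0%N.
    case: len hl hp {e} => // len hl /(_ l); rewrite in_nil.
    by move=> /(_ _); lia.
  rewrite (@bits_eq0 (size neg) S) //; first exact: grow_nil.
  by move=> j /hn <-.
have xp := rcons_uniq_notin e.
have := mem_s e; rewrite mem_cat => /orP[xpos|xneg]; last first.
  have xnp : x \notin pos.
    move: pn_uniq; rewrite cat_uniq => /and3P[_ /hasPn/(_ x xneg)].
    by [].
  have jn : (index x neg < size neg)%N by rewrite index_mem.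
  set j := index x neg in jn; have ex : nth x0 neg j = x by rewrite nth_index.
  have hb : bit S j by rewrite -hn // ex mem_rcons inE eqxx.
  have := @grow_neg _ (nth x0 pos) (nth x0 neg) (size neg) _ l len p j jn (bitB hb).
  rewrite subnK ?bit_le // ex; apply; apply: (IH (x :: q)) => //.
  - by rewrite -cat_rcons.
  - by rewrite (leq_ltn_trans _ hS) // leq_subr.
  - move=> t tm; rewrite -hp // mem_rcons inE.
    by case: eqP => // ep; rewrite -ep mem_nth in xnp.
  - move=> i ilt; rewrite bit_sub // -hn // mem_rcons inE -ex.
    rewrite nth_uniq //; first by case: eqP => [->|] //=; rewrite ex (negPf xp).
    by move: pn_uniq; rewrite cat_uniq => /and3P[].
have tm : (index x pos < m)%N by rewrite index_mem.
set t := index x pos in tm; have ex : nth x0 pos t = x by rewrite nth_index.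
have ht : (l <= t < l + len)%N by rewrite -hp // ex mem_rcons inE eqxx.
have len0 : len = len.-1.+1 by move: ht; clear; lia.
have xnn : x \notin neg.
  apply/negP => xn; move: pn_uniq; rewrite cat_uniq => /and3P[_ /hasPn/(_ x xn)].
  by rewrite /= xpos.
have hn' j : (j < size neg)%N -> (nth x0 neg j \in p) = bit S j.
  move=> jn; rewrite -hn // mem_rcons inE.
  by case: eqP => // ep; rewrite -ep mem_nth in xnn.
have hp' u : (u < m)%N -> (nth x0 pos u \in p) = (u != t) && (l <= u < l + len)%N.
  move=> um; rewrite -hp // mem_rcons inE -ex nth_uniq //.
  by case: eqP => [->|] //=; rewrite ex (negPf xp).
have e' : s = p ++ nth x0 pos t :: q by rewrite ex -cat_rcons.
case: (ltngtP t (l + len).-1) => [lt1|gt1|eq1]; last 2 first.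
- by exfalso; move: ht gt1; clear; lia.
- rewrite len0 -ex (_ : t = l + len.-1)%N; last by move: eq1 len0; clear; lia.
  apply: grow_right; apply: (IH (x :: q)) => //; first by rewrite -cat_rcons.
    by move: hl len0; clear; lia.
  by move=> u um; rewrite hp' // eq1; move: ht; clear; lia.
case: (ltngtP l t) => [lt2|gt2|eq2]; last 2 first.
- by exfalso; move: ht gt2; clear; lia.
- rewrite len0 -ex -eq2.
  apply: grow_left; apply: (IH (x :: q)) => //; first by rewrite -cat_rcons.
    by move: hl len0; clear; lia.
  by move=> u um; rewrite hp' // -eq2; move: ht; clear; lia.
have [a1 a2 a3 a4] : [/\ (l < m)%N, ((l + len).-1 < m)%N,
    (t < (l + len).-1 < m)%N & (l < t < m.-1)%N].
  by move: ht lt1 lt2 tm hl; clear; move=> *; split; lia.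
have h1 : nth x0 pos l \in p by rewrite hp' //; move: lt1 lt2; clear; lia.
have h2 : nth x0 pos (l + len).-1 \in p by rewrite hp' //; move: lt1 lt2; clear; lia.
by move: (lt_trans (order_right e' a3 h2) (order_left e' a4 h1)); rewrite ltxx.
Qed.

(** Without negative matrices the rest is always positive, which excludes the situation of
    [order_right]: the arc only grows to the right. *)
Lemma prefix_take p q len : neg = [::] -> s = p ++ q -> (len <= m)%N ->
  (forall t, (t < m)%N -> (nth x0 pos t \in p) = (t < len)%N) ->
  p = take len pos.
Proof.
move=> neg0; elim/last_ind: p q len => [|p x IH] q len e hl hp.
  case: len hl hp => [|len] hl hp; first by rewrite take0.
  by have := hp 0%N; rewrite in_nil ltn0Sn => /(_ (leq_ltn_trans (leq0n _) hl)).
have xp := rcons_uniq_notin e.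
have xpos : x \in pos by have := mem_s e; rewrite neg0 cats0.
have tm : (index x pos < m)%N by rewrite index_mem.
set t := index x pos in tm; have ex : nth x0 pos t = x by rewrite nth_index.
have ht : (t < len)%N by rewrite -hp // ex mem_rcons inE eqxx.
have hp' u : (u < m)%N -> (nth x0 pos u \in p) = (u != t) && (u < len)%N.
  move=> um; rewrite -hp // mem_rcons inE -ex nth_uniq //.
  by case: eqP => [->|] //=; rewrite ex (negPf xp).
have e' : s = p ++ nth x0 pos t :: q by rewrite ex -cat_rcons.
have q0 : all (fun y => 0 < ta (f y)) q.
  apply/allP => y yq; have : y \in s by rewrite e mem_cat yq orbT.
  by rewrite (perm_mem s_perm) neg0 cats0 => /pos_gt0[].
have qpos : 0 < ta (tprod f q).
  elim/last_ind: q q0 {e e'} => [|q y IHq]; first by rewrite /= ltr01.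
  by rewrite all_rcons tprod_rcons /= => /andP[h] /IHq; exact: mulr_gt0.
case: (ltnP t len.-1) => [lt1|ge1].
  have a1 : (t < len.-1 < m)%N by move: hl lt1; clear; lia.
  have h2 : nth x0 pos len.-1 \in p.
    by rewrite hp'; move: hl lt1; clear; lia.
  by move: (lt_trans (order_right e' a1 h2) qpos); rewrite ltxx.
have et : t = len.-1 by move: ge1 ht; clear; lia.
have -> : len = t.+1 by move: et ht; clear; lia.
rewrite (take_nth x0) // ex; congr rcons.
apply: (IH (x :: q)); [by rewrite -cat_rcons | exact: ltnW |].
by move=> u um; rewrite hp' //; move: et ht; clear; lia.
Qed.

End LastPositive.
End Structure.

Lemma last_mem_split (I : eqType) (P : pred I) (s : seq I) : has P s ->
  exists p x q, [/\ s = p ++ x :: q, P x & ~~ has P q].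
Proof.
elim/last_ind: s => // s x IH; rewrite has_rcons.
case: (boolP (P x)) => [Px _|nPx /= /IH [p [y [q [-> Py nPq]]]]].
  by exists s, x, [::]; rewrite cats1.
by exists p, y, (rcons q x); rewrite rcons_cat rcons_cons has_rcons negb_or nPx.
Qed.

Lemma grow_shift (I : eqType) (idx idx' neg : nat -> I) k c S l len s :
  grow idx neg k S l len s ->
  (forall t, (l <= t < l + len)%N -> idx t = idx' (c + t)%N) ->
  grow idx' neg k S (c + l) len s.
Proof.
elim=> {S l len s} [l|S l len s _ IH|S l len s _ IH|S l len s j jk hj _ IH] h.
- exact: grow_nil.
- rewrite h ?addnA; last by clear; lia.
  by apply/grow_right/IH => t ht; apply: h; move: ht; clear; lia.
- rewrite h; last by clear; lia.
  by apply/grow_left; rewrite -addnS; apply/IH => t ht; apply: h; move: ht; clear; lia.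
- by apply: grow_neg => //; exact: IH.
Qed.

Lemma nth_cat_rot (I : eqType) (x0 : I) (s : seq I) c t :
  (c <= size s)%N -> (t < size s)%N ->
  nth x0 (rot c s) t = nth x0 (s ++ s) (c + t).
Proof.
move=> hc ht; rewrite /rot !nth_cat size_drop nth_drop.
case: ltnP => h1; case: ltnP => h2 //; try by [move: h1 h2 hc ht; clear; lia].
by rewrite nth_take; [congr nth|]; move: h1 h2 hc ht; clear; lia.
Qed.

Section Strict.
Variables (F : realFieldType) (I : eqType) (f : I -> tri F) (x0 : I).
Variables (pos neg s : seq I).
Hypothesis (pn_uniq : uniq (pos ++ neg)) (s_perm : perm_eq s (pos ++ neg)).
Hypothesis (opt : optimal f s).
Hypothesis (pos_gt0 : {in pos, forall x, 0 < ta (f x) /\ 0 < td (f x)}).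
Hypothesis (neg_lt0 : {in neg, forall x, ta (f x) < 0 /\ 0 < td (f x)}).
Hypothesis (pos_ccw : ccw_sorted f x0 pos).

(** The rotation by l moves the positive matrix met last to the end, as [prefix_grow] requires.
    Doubling the list turns the arcs of the rotated list into windows of [pos ++ pos]. *)
Lemma strict_structure : exists l, [/\ (l <= size pos)%N,
  grow (nth x0 (pos ++ pos)) (nth x0 neg) (size neg) (2 ^ size neg).-1 l
    (size pos) s & neg = [::] -> s = rot l pos].
Proof.
have [c [hc hz]] : exists c, (c <= size pos)%N /\
    forall p x q, s = p ++ x :: q -> x \in pos ->
      x != nth x0 (rot c pos) (size (rot c pos)).-1 ->
      nth x0 (rot c pos) (size (rot c pos)).-1 \in q.
  case: (boolP (has (mem pos) s)) => [/last_mem_split[p [z [q [e zp nq]]]]|h]; last first.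
    exists 0%N; split=> // p x q e xp _; case/hasP: h; exists x => //.
    by rewrite e mem_cat inE eqxx orbT.
  have iz : (index z pos < size pos)%N by rewrite index_mem.
  exists (index z pos).+1; split=> // p' x q' e' xp.
  have -> : nth x0 (rot (index z pos).+1 pos) (size (rot (index z pos).+1 pos)).-1 = z.
    rewrite size_rot nth_cat_rot //; last by move: iz; clear; lia.
    rewrite nth_cat ifF; last by move: iz; clear; lia.
    by rewrite (_ : _ - _ = index z pos)%N ?nth_index //; move: iz; clear; lia.
  move=> xz; have zs : z \in s by rewrite e mem_cat inE eqxx orbT.
  have su : uniq s by rewrite (perm_uniq s_perm).
  have : x \in p ++ z :: q by rewrite -e e' mem_cat inE eqxx orbT.
  rewrite mem_cat inE (negPf xz) /= => /orP[xinp|xq]; last first.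
    by case/negP: nq; apply/hasP; exists x.
  (* As x occurs only once, both splittings of s at x coincide; z comes after x in the one, hence
     lies in the tail of the other. *)
  case/splitPr: xinp e => p1 p2 e; move: e'; rewrite e -catA /=.
  move: su; rewrite e -catA /= cat_uniq /= negb_or -!andbA => /and5P[_ xp1 _ xn _] e'.
  have : index x (p1 ++ x :: p2 ++ z :: q) = index x (p' ++ x :: q') by rewrite e'.
  have xp' : x \notin p'.
    have : uniq (p' ++ x :: q').
      by rewrite -e' (_ : p1 ++ _ = s) ?(perm_uniq s_perm) // e -catA.
    by rewrite cat_uniq /= negb_or => /and3P[_ /andP[]].
  rewrite !index_cat (negPf xp1) (negPf xp') /= !eqxx !addn0 => es.
  have /eqP := e'; rewrite eqseq_cat // => /andP[_ /eqP[<-]].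
  by rewrite mem_cat inE eqxx orbT.
have e1 : perm_eq (rot c pos ++ neg) (pos ++ neg) by rewrite perm_cat2r perm_rot.
have pn' : uniq (rot c pos ++ neg) by rewrite (perm_uniq e1).
have sp' : perm_eq s (rot c pos ++ neg) by rewrite (perm_trans s_perm) // perm_sym.
have pos' : {in rot c pos, forall x, 0 < ta (f x) /\ 0 < td (f x)}.
  by move=> x; rewrite mem_rot; exact: pos_gt0.
have ccw' := ccw_sorted_rot (n := c) pos_ccw.
have mp t : (t < size pos)%N -> nth x0 (rot c pos) t \in s.
  by move=> h; rewrite (perm_mem sp') mem_cat mem_nth ?size_rot.
have {}hz p x q : s = p ++ x :: q -> x \in rot c pos ->
    x != nth x0 (rot c pos) (size (rot c pos)).-1 ->
    nth x0 (rot c pos) (size (rot c pos)).-1 \in q.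
  by rewrite mem_rot; exact: hz.
exists c; split=> // [|neg0].
- rewrite -[c]addn0; apply: (@grow_shift _ (nth x0 (rot c pos))) => [|t /andP[_ ht]].
    apply: (prefix_grow pn' sp' opt pos' neg_lt0 ccw' hz (q := [::])).
    + by rewrite cats0.
    + by rewrite size_rot.
    + by rewrite ltn_predL expn_gt0.
    + by move=> t; rewrite size_rot => ht; rewrite mp // ht.
    + by move=> j jk; rewrite bit_full // (perm_mem sp') mem_cat mem_nth ?orbT.
  by apply: nth_cat_rot.
- rewrite (prefix_take pn' sp' opt pos' neg_lt0 ccw' hz neg0 (q := [::]) (len := size pos) (p := s)) ?cats0 ?size_rot //.
    by rewrite take_oversize ?size_rot.
  by move=> t ht; rewrite mp // ht.
Qed.
End Strict.

(** * Pseudo-angles *)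

Section Diamond.
Variable F : realFieldType.
Implicit Types (p q : F) (M : tri F).

(* The point with pseudo-angle p in [0, 4) on the circle |x| + |y| = 1. *)
Definition rhox p := `|p - 2| - 1.
Definition rhoy p := p - 2 - `|p - 1| + `|p - 3|.

(** Along the circle the normalized x falls from 1 to -1 on [0, 2] and rises again on [2, 4], which
    is inverted here. The zero vector gets the angle 1, as division by 0 gives 0. *)
Definition pseudo_angle M : F :=
  let x := tx M in let y := tb M in
  if y < 0 then 3 + x / (`|x| + `|y|) else 1 - x / (`|x| + `|y|).

Lemma rho_cases p : 0 <= p -> p < 4 ->
  [\/ (0 <= p <= 1) /\ (rhox p = 1 - p /\ rhoy p = p),
      (1 <= p <= 2) /\ (rhox p = 1 - p /\ rhoy p = 2 - p),
      (2 <= p <= 3) /\ (rhox p = p - 3 /\ rhoy p = 2 - p) |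
      (3 <= p <= 4) /\ (rhox p = p - 3 /\ rhoy p = p - 4)].
Proof.
move=> p0 p4; rewrite /rhox /rhoy.
case: (ger0P (p - 1)) => h1; case: (ger0P (p - 2)) => h2;
  case: (ger0P (p - 3)) => h3.
- by constructor 4; split; [apply/andP; split; lra | split; lra].
- by constructor 3; split; [apply/andP; split; lra | split; lra].
- by exfalso; lra.
- by constructor 2; split; [apply/andP; split; lra | split; lra].
- by exfalso; lra.
- by exfalso; lra.
- by exfalso; lra.
- by constructor 1; split; [apply/andP; split; lra | split; lra].
Qed.

(** The form taken by the cross product of two points in neighbouring quadrants, [(a, c)] and
    [(b, d)] being their barycentric weights on the sides of the diamond. *)
Lemma conv_gt0 (a b c d : F) : 0 <= a -> 0 <= b -> 0 <= c -> 0 <= d ->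
  a + c = 1 -> b + d = 1 -> 0 < a + d -> 0 < b + c -> 0 < a * b + c * d.
Proof.
move=> a0 b0 c0 d0 ac bd ad bc.
case: (ltrP 0 a) => ha; last first.
  by rewrite (_ : a = 0) ?mul0r ?add0r ?mulr_gt0 //; lra.
case: (ltrP 0 b) => hb; first by rewrite ltr_pwDl ?mulr_gt0 ?mulr_ge0.
by rewrite (_ : b = 0) ?mulr0 ?add0r ?mulr_gt0 //; lra.
Qed.

(** Half a turn is 2. In equal or opposite quadrants the quadratic terms cancel, leaving [q - p] or
    [2 - (q - p)]; neighbouring quadrants need [conv_gt0]. *)
Lemma rho_lt2 p q : 0 <= p -> p < q -> q < 4 -> q - p < 2 ->
  0 < rhox p * rhoy q - rhoy p * rhox q.
Proof.
move=> p0 pq q4 d2.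
have := rho_cases p0 (lt_trans pq q4); have := rho_cases (ltW (le_lt_trans p0 pq)) q4.
case=> -[/andP[hq1 hq2] [-> ->]]; case=> -[/andP[hp1 hp2] [-> ->]]; try lra.
- have := @conv_gt0 (1 - p) (2 - q) p (q - 1); lra.
- have := @conv_gt0 (2 - p) (3 - q) (p - 1) (q - 2); lra.
- have := @conv_gt0 (3 - p) (4 - q) (p - 2) (q - 3); lra.
Qed.

Lemma rho_gt2 p q : 0 <= p -> q < 4 -> 2 < q - p ->
  0 < rhox q * rhoy p - rhoy q * rhox p.
Proof.
move=> p0 q4 d2; have pq : p < q by lra.
have := rho_cases p0 (lt_trans pq q4); have := rho_cases (ltW (le_lt_trans p0 pq)) q4.
case=> -[/andP[hq1 hq2] [-> ->]]; case=> -[/andP[hp1 hp2] [-> ->]]; try lra.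
have := @conv_gt0 p (q - 3) (1 - p) (4 - q); lra.
Qed.

(** The three gaps are positive and add up to 4, so at most one of them reaches 2; the other two
    give the two positive cross products. *)
Lemma ccw_rho (A B C : tri F) (r1 r2 r3 p1 p2 p3 : F) :
  0 < r1 -> 0 < r2 -> 0 < r3 -> 0 <= p1 -> p1 < p2 -> p2 < p3 -> p3 < 4 ->
  tx A = r1 * rhox p1 -> tb A = r1 * rhoy p1 ->
  tx B = r2 * rhox p2 -> tb B = r2 * rhoy p2 ->
  tx C = r3 * rhox p3 -> tb C = r3 * rhoy p3 -> ccw A B C.
Proof.
move=> r10 r20 r30 p10 p12 p23 p34 xA yA xB yB xC yC.
have crE r r' p p' : 0 < r -> 0 < r' ->
    (0 < r * rhox p * (r' * rhoy p') - r * rhoy p * (r' * rhox p')) =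
    (0 < rhox p * rhoy p' - rhoy p * rhox p').
  move=> h h'; rewrite -[RHS](pmulr_rgt0 _ (mulr_gt0 h h')).
  by congr (0 < _); ring.
rewrite /ccw /cr xA xB xC yA yB yC !crE //.
case: (ltP (p2 - p1) 2) => d12; last first.
  by rewrite (@rho_lt2 p2 p3) ?(@rho_gt2 p1 p3) ?orbT //=; lra.
case: (ltP (p3 - p2) 2) => d23; last first.
  by rewrite (@rho_lt2 p1 p2) ?(@rho_gt2 p1 p3) ?orbT //=; lra.
by rewrite (@rho_lt2 p1 p2) ?(@rho_lt2 p2 p3) //=; lra.
Qed.

Lemma pseudo_angleP M : let r := `|tx M| + `|tb M| in
  [/\ 0 <= r, 0 <= pseudo_angle M < 4, tx M = r * rhox (pseudo_angle M)
    & tb M = r * rhoy (pseudo_angle M)].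
Proof.
rewrite /pseudo_angle /=; set x := tx M; set y := tb M; set r := `|x| + `|y|.
have r0 : 0 <= r by rewrite addr_ge0.
have [rz|rnz] := eqVneq r 0.
  have x0 : x = 0 by apply/eqP; rewrite -normr_eq0; apply/eqP; move: rz (normr_ge0 x) (normr_ge0 y); rewrite /r; lra.
  have y0 : y = 0 by apply/eqP; rewrite -normr_eq0; apply/eqP; move: rz (normr_ge0 x) (normr_ge0 y); rewrite /r; lra.
  rewrite rz y0 x0 ltxx !mul0r subr0; split=> //; lra.
have rgt : 0 < r by rewrite lt_neqAle eq_sym rnz.
set t := x / r.
have ex : x = r * t by rewrite /t mulrC divfK.
have ht : `|t| <= 1.
  by rewrite /t normrM normfV (ger0_norm r0) ler_pdivrMr // mul1r /r lerDl.
have ey : `|y| = r * (1 - `|t|).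
  rewrite mulrBr mulr1 -{2}(ger0_norm r0) -normrM -ex /r; ring.
case: (ltrP y 0) => hy.
- have yE : y = r * (`|t| - 1) by move: ey; rewrite ltr0_norm //; lra.
  have t1 : `|t| < 1.
    have : 0 < r * (1 - `|t|) by rewrite -ey normr_gt0 lt_eqF.
    by rewrite pmulr_rgt0 // subr_gt0.
  have := t1; rewrite ltr_norml => /andP[tl tu].
  split=> //; first by apply/andP; split; lra.
    rewrite {1}ex /rhox; congr (_ * _).
    by rewrite ger0_norm; lra.
  rewrite {1}yE /rhoy; congr (_ * _); rewrite (_ : 3 + t - 3 = t); last by ring.
  by rewrite (ger0_norm (_ : 0 <= 3 + t - 1)); lra.
- have yE : y = r * (1 - `|t|) by rewrite -ey ger0_norm.
  have := ht; rewrite ler_norml => /andP[tl tu].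
  split=> //; first by apply/andP; split; lra.
    rewrite {1}ex /rhox; congr (_ * _).
    by rewrite ler0_norm; lra.
  rewrite {1}yE /rhoy; congr (_ * _); rewrite (_ : 1 - t - 1 = - t); last by ring.
  by rewrite normrN (ler0_norm (_ : 1 - t - 3 <= 0)); lra.
Qed.

Lemma rho_lip p d : 0 <= d -> `|rhox (p + d) - rhox p| <= d /\
  `|rhoy (p + d) - rhoy p| <= 3 * d.
Proof.
move=> d0.
have h c : `| `|p + d - c| - `|p - c| | <= d.
  apply: le_trans (ler_dist_dist _ _) _.
  by rewrite (_ : _ - _ = d) ?ger0_norm //; ring.
have h2 := h 2; have h1 := h 1; have h3 := h 3; move: h1 h2 h3.
rewrite /rhox /rhoy !ler_norml => /andP[? ?] /andP[? ?] /andP[? ?].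
by split; apply/andP; split; lra.
Qed.

Lemma rho_le1 p : 0 <= p -> p < 4 -> `|rhox p| <= 1 /\ `|rhoy p| <= 1.
Proof.
move=> p0 p4; rewrite !ler_norml.
by case: (rho_cases p0 p4) => -[/andP[? ?] [-> ->]]; split; apply/andP; split; lra.
Qed.

End Diamond.

(** * Structure of optimal orders *)

Section SmallParameter.
Variable F : realFieldType.

Definition small (Q : F -> Prop) := exists2 d, 0 < d & forall e, 0 < e < d -> Q e.

Lemma small_and P Q : small P -> small Q -> small (fun e => P e /\ Q e).
Proof.
move=> [d d0 hd] [d' d'0 hd']; exists (Num.min d d'); first by rewrite lt_min d0.
by move=> e; rewrite lt_min => /and3P[e0 h1 h2]; split; [apply: hd|apply: hd']; rewrite e0.
Qed.

Lemma small_all (T : eqType) (s : seq T) (Q : T -> F -> Prop) :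
  (forall x, x \in s -> small (Q x)) -> small (fun e => forall x, x \in s -> Q x e).
Proof.
elim: s => [|x s IH] h; first by exists 1; rewrite ?ltr01.
have [d d0 hd] : small (fun e => Q x e /\ forall y, y \in s -> Q y e).
  apply: small_and; first by apply: h; rewrite inE eqxx.
  by apply: IH => y ys; apply: h; rewrite inE ys orbT.
exists d => // e /hd[h1 h2] y; rewrite inE => /predU1P[->|] //; exact: h2.
Qed.

(** Convergence at a linear rate: closed under sums and products, and free of any topology on
    [F]. *)
Definition near0 (g : F -> F) l :=
  exists2 C, 0 <= C & forall e, 0 < e < 1 -> `|g e - l| <= C * e.

Lemma near0_cst l : near0 (fun => l) l.
Proof. by exists 0 => // e _; rewrite subrr normr0 mul0r. Qed.

Lemma near0D g h l m : near0 g l -> near0 h m -> near0 (fun e => g e + h e) (l + m).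
Proof.
move=> [C C0 hC] [D D0 hD]; exists (C + D); first exact: addr_ge0.
move=> e he; rewrite (_ : _ - _ = (g e - l) + (h e - m)); last by ring.
by rewrite mulrDl (le_trans (ler_normD _ _)) // lerD ?hC ?hD.
Qed.

Lemma near0M g h l m : near0 g l -> near0 h m -> near0 (fun e => g e * h e) (l * m).
Proof.
move=> [C C0 hC] [D D0 hD]; exists (C * (`|m| + D) + `|l| * D).
  by rewrite !(addr_ge0, mulr_ge0).
move=> e he; have /andP[e0 e1] := he.
rewrite (_ : _ - _ = (g e - l) * h e + l * (h e - m)); last by ring.
rewrite [X in _ <= X]mulrDl; apply: le_trans (ler_normD _ _) _; rewrite !normrM.
apply: lerD; last by rewrite -mulrA ler_wpM2l // hD.
have hm : `|h e| <= `|m| + D.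
  rewrite (_ : h e = m + (h e - m)); last by ring.
  rewrite (le_trans (ler_normD _ _)) // lerD // (le_trans (hD e he)) //.
  by rewrite ler_piMr // ltW.
by rewrite mulrAC ler_pM // hC.
Qed.

Lemma near0_lt g h l m : near0 g l -> near0 h m -> l < m -> small (fun e => g e < h e).
Proof.
move=> [C C0 hC] [D D0 hD] lm.
have k0 : 0 < C + D + 1 by lra.
exists (Num.min 1 ((m - l) / (C + D + 1))); first by rewrite lt_min ltr01 divr_gt0 // subr_gt0.
move=> e; rewrite lt_min => /and3P[e0 e1]; rewrite ltr_pdivlMr // => h2.
have := hC e; have := hD e; rewrite e0 e1 => /(_ isT) a /(_ isT) b.
move: a b; rewrite !ler_norml => /andP[a1 a2] /andP[b1 b2]; lra.
Qed.

End SmallParameter.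

Section Limit.
Variables (F : realFieldType) (I : eqType) (f : I -> tri F) (g : F -> I -> tri F).

Definition near0_tri (h : F -> tri F) M := [/\ near0 (fun e => ta (h e)) (ta M),
  near0 (fun e => tb (h e)) (tb M) & near0 (fun e => td (h e)) (td M)].

Hypothesis (gf : forall x, near0_tri (g^~ x) (f x)).

Lemma near0_tprod s : near0_tri (fun e => tprod (g e) s) (tprod f s).
Proof.
elim/last_ind: s => [|s x [ha hb hd]]; first by split; exact: near0_cst.
have [ga gb gd] := gf x.
rewrite /near0_tri tprod_rcons /=; split.
  - have [C C0 hC] := near0M ga ha.
    by exists C => // e /hC; rewrite tprod_rcons.
  - have [C C0 hC] := near0D (near0M ga hb) (near0M gb hd).
    by exists C => // e /hC; rewrite tprod_rcons.
  - have [C C0 hC] := near0M gd hd.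
    by exists C => // e /hC; rewrite tprod_rcons.
Qed.
End Limit.

Lemma exists_min (F : realFieldType) (T : eqType) (v : T -> F) (s : seq T) x :
  x \in s -> exists2 y, y \in s & forall t, t \in s -> v y <= v t.
Proof.
elim: s x => // a s IH x _; case: s IH => [_|b s IH].
  by exists a; rewrite ?inE // => t; rewrite inE => /eqP->.
have [|y ys hy] := IH b; first by rewrite inE eqxx.
case: (lerP (v a) (v y)) => h.
  exists a; rewrite ?inE ?eqxx // => t; rewrite inE => /predU1P[->//|/hy].
  exact: le_trans.
exists y; first by rewrite inE ys orbT.
by move=> t; rewrite inE => /predU1P[->|/hy] //; exact: ltW.
Qed.

Section Structure.
Variables (F : realFieldType) (I : eqType) (f : I -> tri F) (x0 : I).
Variables (pos neg : seq I).
Hypothesis (pn_uniq : uniq (pos ++ neg)).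
Hypothesis (pos_ge0 : {in pos, forall x, 0 <= ta (f x) /\ 0 <= td (f x)}).
Hypothesis (neg_lt0 : {in neg, forall x, ta (f x) < 0 /\ 0 < td (f x)}).
Hypothesis (pos_sorted : sorted (fun x y => pseudo_angle (f x) <= pseudo_angle (f y)) pos).

Let pos_uniq : uniq pos. Proof. by move: pn_uniq; rewrite cat_uniq => /and3P[]. Qed.

Let rad x := `|tx (f x)| + `|tb (f x)|.

(* Small perturbation making all data positive and all angles distinct. *)
Definition perturb (e : F) x : tri F :=
  if x \in pos then
    let i := (index x pos)%:R in
    let p := pseudo_angle (f x) + e * i in
    let d := td (f x) + (rad x * i + 2) * e in
    Tri (d + (rad x + e) * rhox p) ((rad x + e) * rhoy p) d
  else f x.

Let rad_ge0 x : 0 <= rad x. Proof. by rewrite addr_ge0. Qed.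

Let near0_id c : 0 <= c -> near0 (fun e => c * e) (0 : F).
Proof.
by move=> c0; exists c => // e /andP[e0 _]; rewrite subr0 normrM !ger0_norm // ltW.
Qed.

Let perturb_near0 x : near0_tri (perturb^~ x) (f x).
Proof.
rewrite /perturb /near0_tri; case: (x \in pos); last by split; exact: near0_cst.
set i := (index x pos)%:R; have i0 : 0 <= i by rewrite ler0n.
have [_ _ ex ey] := pseudo_angleP (f x); rewrite -/(rad x) in ex ey.
set p := pseudo_angle _ in ex ey *.
have hx : near0 (fun e => (rad x + e) * rhox (p + e * i)) (tx (f x)).
  rewrite ex; apply: near0M.
    have := near0D (near0_cst (rad x)) (near0_id ler01).
    by move=> [C C0 hC]; exists C => // e /hC; rewrite mul1r addr0.
  exists i => // e /andP[e0 _]; rewrite mulrC; apply: (rho_lip _ _).1.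
  by rewrite mulr_ge0 // ltW.
have hy : near0 (fun e => (rad x + e) * rhoy (p + e * i)) (tb (f x)).
  rewrite ey; apply: near0M.
    have := near0D (near0_cst (rad x)) (near0_id ler01).
    by move=> [C C0 hC]; exists C => // e /hC; rewrite mul1r addr0.
  exists (3 * i) => [|e /andP[e0 _]]; first by rewrite mulr_ge0.
  by rewrite -mulrA [i * e]mulrC; apply: (rho_lip _ _).2; rewrite mulr_ge0 // ltW.
have hd : near0 (fun e => td (f x) + (rad x * i + 2) * e) (td (f x)).
  have := near0D (near0_cst (td (f x))) (near0_id (_ : 0 <= rad x * i + 2)).
  rewrite addr0; apply; rewrite addr_ge0 ?mulr_ge0 //.
split=> //=; have := near0D hd hx.
by rewrite (_ : td (f x) + tx (f x) = ta (f x)) // /tx addrC subrK.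
Qed.

Let perturb_gt0 x : x \in pos -> small (fun e =>
  (0 < ta (perturb e x) /\ 0 < td (perturb e x)) /\
  pseudo_angle (f x) + e * (index x pos)%:R < 4).
Proof.
move=> xp; have [a0 d0] := pos_ge0 xp; rewrite /perturb xp /=.
set i := (index x pos)%:R; have i0 : 0 <= i by rewrite ler0n.
have [_ /andP[p0 p4] ex ey] := pseudo_angleP (f x); rewrite -/(rad x) in ex ey.
set p := pseudo_angle _ in p0 p4 ex ey *.
have k0 : 0 < i + 1 by lra.
exists ((4 - p) / (i + 1)); first by rewrite divr_gt0 // subr_gt0.
move=> e; rewrite ltr_pdivlMr // => /andP[e0 he].
have hp : p + e * i < 4 by lra.
have ei : 0 <= e * i by rewrite mulr_ge0 // ltW.
split=> //; have hd : 0 < td (f x) + (rad x * i + 2) * e.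
  by rewrite ltr_wpDl // mulr_gt0 // ltr_wpDl // mulr_ge0.
split=> //.
have [] := rho_lip p ei; rewrite ler_norml => /andP[l1 _] _.
have [|//|] := @rho_le1 _ (p + e * i); first by rewrite addr_ge0.
rewrite ler_norml => /andP[l2 _] _.
have m1 := ler_wpM2l (rad_ge0 x) l1.
have m2 := ler_wpM2l (ltW e0) l2.
move: ex a0; rewrite /tx => ex a0; move: m1 m2.
set R1 := rhox (p + _); set R0 := rhox p in ex *.
move: ex hd; set r := rad x => ex hd m1 m2.
(* The shift of the angle by [e * i] lowers [rhox] by at most [e * i], and [rhox] is at least -1.
   The loss in [ta] is thus at most [r * i * e + e], and the coefficient [r * i + 2] leaves a gain
   of at least e. *)
have -> : td (f x) + (r * i + 2) * e + (r + e) * R1 =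
  ta (f x) + (r * i + 2) * e + r * (R1 - R0) + e * R1.
  have -> : r * (R1 - R0) = r * R1 - (ta (f x) - td (f x)) by rewrite ex mulrBr.
  by ring.
move: m1 m2; rewrite mulrN mulrN1 => m1 m2.
have : r * (e * i) = r * i * e by ring.
move: m1; set A1 := r * (_ - _); set A2 := r * (e * i); set A3 := e * R1 in m2 *; lra.
Qed.

(** An optimum s of a slightly perturbed problem is optimal for [f] as well: otherwise the strict
    gap between s and an optimum t of [f] would survive the perturbation. *)
Theorem optimal_structure : exists s l, [/\ perm_eq s (pos ++ neg), optimal f s,
  (l <= size pos)%N,
  grow (nth x0 (pos ++ pos)) (nth x0 neg) (size neg) (2 ^ size neg).-1 l
    (size pos) s & neg = [::] -> s = rot l pos].
Proof.
set ss := permutations (pos ++ neg).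
have [t tss tmin] : exists2 t, t \in ss &
    forall s, s \in ss -> tb (tprod f t) <= tb (tprod f s).
  by apply: (@exists_min _ _ _ _ (pos ++ neg)); rewrite mem_permutations.
have h1 : small (fun e => forall s, s \in ss -> tb (tprod f t) < tb (tprod f s) ->
    tb (tprod (perturb e) t) < tb (tprod (perturb e) s)).
  apply: small_all => s _; case: (ltrP (tb (tprod f t)) (tb (tprod f s))) => lt.
    have [_ nt _] := near0_tprod perturb_near0 t.
    have [_ ns _] := near0_tprod perturb_near0 s.
    by have [d d0 hd] := near0_lt nt ns lt; exists d => // e /hd.
  by exists 1 => // e _.
have [d d0 /(_ (d / 2))] := small_and h1 (small_all perturb_gt0).
have e0 : 0 < d / 2 by rewrite divr_gt0.
have ed : d / 2 < d by rewrite ltr_pdivrMr //; lra.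
rewrite e0 ed => /(_ isT); move: (d / 2) e0 => e e0 [he hpos] {d d0 ed h1}.
have [s sss smin] : exists2 s, s \in ss &
    forall s', s' \in ss -> tb (tprod (perturb e) s) <= tb (tprod (perturb e) s').
  by apply: (@exists_min _ _ _ _ (pos ++ neg)); rewrite mem_permutations.
have sp : perm_eq s (pos ++ neg) by rewrite -mem_permutations.
have s_opt : optimal f s.
  move=> s' ps'; have s'ss : s' \in ss by rewrite mem_permutations (perm_trans ps').
  apply: le_trans (tmin _ s'ss); rewrite leNgt; apply/negP => lt.
  by have := he s sss lt; rewrite ltNge smin.
have pos' : {in pos, forall x, 0 < ta (perturb e x) /\ 0 < td (perturb e x)}.
  by move=> x /hpos[].
have neg' : {in neg, forall x, ta (perturb e x) < 0 /\ 0 < td (perturb e x)}.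
  move=> x xn; rewrite /perturb ifF; first exact: neg_lt0.
  apply/negP => xp.
  by move: pn_uniq; rewrite cat_uniq => /and3P[_ /hasPn/(_ x xn) /=]; rewrite xp.
have opt' : optimal (perturb e) s.
  by move=> s' ps'; apply: smin; rewrite mem_permutations (perm_trans ps').
have ccw' : ccw_sorted (perturb e) x0 pos.
  move=> i j l /andP[ij jl] ls.
  have js := ltn_trans jl ls; have is_ := ltn_trans ij js.
  have sub (u v : nat) : (u < v)%N -> (v < size pos)%N ->
      pseudo_angle (f (nth x0 pos u)) + e * u%:R < pseudo_angle (f (nth x0 pos v)) + e * v%:R.
    move=> uv vs; have us := ltn_trans uv vs; apply: ler_ltD; last first.
      by rewrite ltr_pM2l // ltr_nat.
    by apply: (sorted_ltn_nth _ _ pos_sorted) => // y x z; exact: le_trans.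
  have hx u : (u < size pos)%N ->
    [/\ 0 < rad (nth x0 pos u) + e, 0 <= pseudo_angle (f (nth x0 pos u)) + e * u%:R,
     pseudo_angle (f (nth x0 pos u)) + e * u%:R < 4,
     tx (perturb e (nth x0 pos u)) = (rad (nth x0 pos u) + e) *
       rhox (pseudo_angle (f (nth x0 pos u)) + e * u%:R) &
     tb (perturb e (nth x0 pos u)) = (rad (nth x0 pos u) + e) *
       rhoy (pseudo_angle (f (nth x0 pos u)) + e * u%:R)].
    move=> us; have up := mem_nth x0 us.
    have [_] := hpos _ up; rewrite /perturb up index_uniq // => h4.
    have [_ /andP[p0 _] _ _] := pseudo_angleP (f (nth x0 pos u)).
    split=> //; first by rewrite ltr_wpDl.
      by rewrite addr_ge0 // mulr_ge0 ?ler0n // ltW.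
    by rewrite /tx /= addrC addKr.
  have [a1 a2 a3 a4 a5] := hx i is_; have [b1 b2 b3 b4 b5] := hx j js.
  have [c1 c2 c3 c4 c5] := hx l ls.
  exact: (ccw_rho a1 b1 c1 a2 (sub _ _ ij js) (sub _ _ jl ls) c3 a4 a5 b4 b5 c4 c5).
have [l [hl hg hr]] := strict_structure pn_uniq sp opt' pos' neg' ccw'.
by exists s, l.
Qed.
End Structure.

Local Open Scope nat_scope.

(** * Straight-line machine code *)

(** Unlike [run], it makes an exact number of steps and does not ask for a halt, so that runs can be
    composed. *)
Fixpoint msteps (P : program) (t : nat) (s : mstate) : option mstate :=
  if t is t'.+1 then obind (msteps P t') (step P s) else Some s.

Lemma mstepsD P t1 t2 s : msteps P (t1 + t2) s = obind (msteps P t2) (msteps P t1 s).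
Proof. by elim: t1 s => //= t1 IH s; case: (step P s) => //=. Qed.

Lemma msteps_trans P t1 t2 s1 s2 s3 :
  msteps P t1 s1 = Some s2 -> msteps P t2 s2 = Some s3 -> msteps P (t1 + t2) s1 = Some s3.
Proof. by rewrite mstepsD => ->. Qed.

Lemma run_msteps P t T s s' :
  msteps P t s = Some s' -> step P s' = None -> t <= T -> run P T s = Some s'.
Proof.
elim: t T s => [|t IH] T s /= => [[->] h _|].
  by case: T => [|T] /=; rewrite h.
case e : (step P s) => [s1|] //= h h' ; case: T => // T hT /=; rewrite e.
exact: IH.
Qed.

Definition code_at (P : program) p (c : seq instr) :=
  forall j, j < size c -> nth Halt P (p + j) = nth Halt c j.

Lemma code_at_cat P p c1 c2 : code_at P p (c1 ++ c2) ->
  code_at P p c1 /\ code_at P (p + size c1) c2.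
Proof.
move=> h; split=> j hj.
  by rewrite h ?size_cat ?nth_cat ?hj // ltn_addr.
by rewrite -addnA h ?size_cat ?ltn_add2l // nth_cat ifF ?addKn // ltnNge leq_addr.
Qed.

Definition mem := ((nat -> nat) * (nat -> R))%type.

Definition straight (i : instr) : bool :=
  match i with RLt _ _ _ | NLt _ _ _ | Jmp _ | Halt => false | _ => true end.

Definition exec1 (m : mem) (i : instr) : mem :=
  let: (N, M) := m in
  match i with
  | RZero d => (N, upd M (N d) 0%R)
  | ROne d => (N, upd M (N d) 1%R)
  | RCopy d a => (N, upd M (N d) (M (N a)))
  | RAdd d a b => (N, upd M (N d) (M (N a) + M (N b))%R)
  | RSub d a b => (N, upd M (N d) (M (N a) - M (N b))%R)
  | RMul d a b => (N, upd M (N d) (M (N a) * M (N b))%R)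
  | RDiv d a b => (N, upd M (N d) (M (N a) / M (N b))%R)
  | NConst d c => (upd N d c, M)
  | NAdd d a b => (upd N d (N a + N b), M)
  | NSub d a b => (upd N d (N a - N b), M)
  | NLoad d a => (upd N d (N (N a)), M)
  | NStore a s => (upd N (N a) (N s), M)
  | _ => m
  end.

Definition exec := foldl exec1.

Definition at_pc p (m : mem) := MState p m.1 m.2.

Lemma exec_msteps P p c m : all straight c -> code_at P p c ->
  msteps P (size c) (at_pc p m) = Some (at_pc (p + size c) (exec m c)).
Proof.
elim: c p m => [|i c IH] p m /=; first by rewrite addn0.
move=> /andP[si sc] h.
have hi := h 0 (ltn0Sn _); rewrite addn0 /= in hi.
have hc : code_at P p.+1 c by move=> j hj; rewrite addSnnS h.
have -> : step P (at_pc p m) = Some (at_pc p.+1 (exec1 m i)).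
  by case: m => N M; rewrite /step /= hi; case: i si {hi h}.
by rewrite /= IH // addSnnS.
Qed.

(** * A structured language *)

(* Memory is a family of arrays, read as [nv id i] and [rv id i]; a scalar is
   the entry 0 of its array. *)
Record st := St { nv : nat -> nat -> nat; rv : nat -> nat -> R }.

Inductive nexp :=
| Cst of nat | Get of nat & nexp | Plus of nexp & nexp | Minus of nexp & nexp.

Inductive rop := OAdd | OSub | OMul | ODiv.

(* [RInp e i] is the entry [4 * i + e] of the input block. *)
Inductive rexp :=
| RC0 | RC1 | RGet of nat & nexp | RInp of nat & nexp | ROp of rop & rexp & rexp.

Inductive cond := NLess of nexp & nexp | RLess of rexp & rexp.

Inductive cmd :=
| NSet of nat & nexp & nexp
| RSet of nat & nexp & rexp
| Seq of cmd & cmd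
| If of cond & cmd & cmd
| While of nexp & nexp & cmd.

Fixpoint neval s e := match e with
  | Cst c => c | Get id i => nv s id (neval s i)
  | Plus a b => neval s a + neval s b | Minus a b => neval s a - neval s b end.

Definition ropE o : R -> R -> R := match o with
  | OAdd => fun x y => (x + y)%R | OSub => fun x y => (x - y)%R
  | OMul => fun x y => (x * y)%R | ODiv => fun x y => (x / y)%R end.

(** [Nat.eqb] lets updates at literal array numbers reduce by simplification. *)
Definition setn s id i v :=
  St (fun id' i' => if Nat.eqb id' id && Nat.eqb i' i then v else nv s id' i') (rv s).
Definition setr s id i v :=
  St (nv s) (fun id' i' => if Nat.eqb id' id && Nat.eqb i' i then v else rv s id' i').

Section Semantics.
Variables (n : nat) (inp : nat -> R).

Fixpoint reval s e : R := match e with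
  | RC0 => 0%R | RC1 => 1%R | RGet id i => rv s id (neval s i)
  | RInp e i => inp (4 * neval s i + e)
  | ROp o a b => ropE o (reval s a) (reval s b) end.

(* Only the first [4 * n + 4] real registers hold the input. *)
Fixpoint rok s e : bool := match e with
  | RInp e i => (e < 4) && (neval s i <= n)
  | ROp o a b => rok s a && rok s b
  | _ => true end.

Definition ceval s c := match c with
  | NLess a b => neval s a < neval s b
  | RLess a b => (reval s a < reval s b)%R end.
Definition cok s c := match c with
  | NLess a b => true | RLess a b => rok s a && rok s b end.

(** * Compilation *)

(** Entry i of array [id < 32] lives in register [64 * i + id]. This leaves 32 to 63 free: an
    expression at depth k uses [32 + k], addresses of real operands pass through 60 and 61, and 63
    holds [4 * n + 4], where the real arrays start. *)
Definition T0 := 32.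
(** Multiplication by 64, as six doublings. *)
Definition shift6 r := nseq 6 (NAdd r r r).

Fixpoint cn e k : seq instr := let r := T0 + k in match e with
  | Cst c => [:: NConst r c]
  | Get id i => cn i k ++ shift6 r ++ [:: NConst r.+1 id; NAdd r r r.+1; NLoad r r]
  | Plus a b => cn a k ++ cn b k.+1 ++ [:: NAdd r r r.+1]
  | Minus a b => cn a k ++ cn b k.+1 ++ [:: NSub r r r.+1] end.

Definition BASE := 63.
Definition addr_tmp q k := [:: NConst q (T0 + k); NAdd q q BASE].
Definition instr_op o := match o with
  | OAdd => RAdd | OSub => RSub | OMul => RMul | ODiv => RDiv end.

Fixpoint crx e k : seq instr := match e with
  | RC0 => addr_tmp 60 k ++ [:: RZero 60]
  | RC1 => addr_tmp 60 k ++ [:: ROne 60]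
  | RGet id i => cn i 0 ++ shift6 T0 ++ [:: NConst T0.+1 id; NAdd T0 T0 T0.+1; NAdd T0 T0 BASE]
      ++ addr_tmp 60 k ++ [:: RCopy 60 T0]
  | RInp e i => cn i 0 ++ nseq 2 (NAdd T0 T0 T0) ++ [:: NConst T0.+1 e; NAdd T0 T0 T0.+1]
      ++ addr_tmp 60 k ++ [:: RCopy 60 T0]
  | ROp o a b => crx a k ++ crx b k.+1 ++ addr_tmp 60 k ++ addr_tmp 61 k.+1
      ++ [:: instr_op o 60 60 61] end.

(* The last argument is the target of the jump taken when the condition holds. *)
Definition ccond c : seq instr * (nat -> instr) := match c with
  | NLess a b => (cn a 0 ++ cn b 1, NLt T0 T0.+1)
  | RLess a b => (crx a 0 ++ crx b 1 ++ addr_tmp 60 0 ++ addr_tmp 61 1, RLt 60 61) end.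

Definition cnset id i e := cn i 0 ++ shift6 T0 ++ [:: NConst T0.+1 id; NAdd T0 T0 T0.+1]
  ++ cn e 1 ++ [:: NStore T0 T0.+1].
Definition crset id i e := crx e 0 ++ cn i 0 ++ shift6 T0 ++
  [:: NConst T0.+1 id; NAdd T0 T0 T0.+1; NAdd T0 T0 BASE] ++ addr_tmp 60 0 ++ [:: RCopy T0 60].

(** The length of the code does not depend on its address, so jump targets are known before the
    parts are compiled. *)
Fixpoint csize c := match c with
  | NSet id i e => size (cnset id i e)
  | RSet id i e => size (crset id i e)
  | Seq a b => csize a + csize b
  | If b c1 c2 => size (ccond b).1 + 1 + csize c2 + 1 + csize c1
  | While a b c => size (ccond (NLess a b)).1 + 2 + csize c + 1 end.

(** In a conditional the else branch comes first, because a test can only jump when the condition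
    holds. *)
Fixpoint comp p c : seq instr := match c with
  | NSet id i e => cnset id i e
  | RSet id i e => crset id i e
  | Seq a b => comp p a ++ comp (p + csize a) b
  | If b c1 c2 => let: (t, j) := ccond b in
      let p2 := p + size t + 1 in let p1 := p2 + csize c2 + 1 in
      t ++ [:: j p1] ++ comp p2 c2 ++ [:: Jmp (p1 + csize c1)] ++ comp p1 c1
  | While a b c => let: (t, j) := ccond (NLess a b) in
      let p1 := p + size t + 2 in
      t ++ [:: j p1; Jmp (p1 + csize c + 1)] ++ comp p1 c ++ [:: Jmp p] end.

Lemma size_comp p c : size (comp p c) = csize c.
Proof.
elim: c p => //= [a IHa b IHb|b c1 IH1 c2 IH2|a b c IH] p.
- by rewrite size_cat IHa IHb.
- by case: (ccond b) => t j /=; rewrite !size_cat /= size_cat /= IH1 IH2; lia.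
- by rewrite !size_cat /= !size_cat /= IH; lia.
Qed.

(** The bound on the depth keeps the temporaries below register 60. *)
Fixpoint wfn k e := (k < 20) && match e with
  | Cst _ => true | Get id i => (id < 32) && wfn k i
  | Plus a b | Minus a b => wfn k a && wfn k.+1 b end.
Fixpoint wfr k e := (k < 20) && match e with
  | RGet id i => (id < 32) && wfn 0 i | RInp _ i => wfn 0 i
  | ROp _ a b => wfr k a && wfr k.+1 b | _ => true end.
Definition wfb c := match c with
  | NLess a b => wfn 0 a && wfn 1 b | RLess a b => wfr 0 a && wfr 1 b end.
Fixpoint wf c := match c with
  | NSet id i e => [&& id < 32, wfn 0 i & wfn 1 e]
  | RSet id i e => [&& id < 32, wfn 0 i & wfr 0 e]
  | Seq a b => wf a && wf b
  | If b c1 c2 => [&& wfb b, wf c1 & wf c2]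
  | While a b c => [&& wfn 0 a, wfn 1 b & wf c] end.

Definition base := 4 * n + 4.

(** Silent about the temporaries, which any command may overwrite. *)
Record rel (s : st) (m : mem) : Prop := Rel {
  rel_n : forall id i, id < 32 -> m.1 (64 * i + id) = nv s id i;
  rel_r : forall id i, id < 32 -> m.2 (base + 64 * i + id) = rv s id i;
  rel_b : m.1 BASE = base;
  rel_i : forall a, a < base -> m.2 a = inp a }.

Lemma exec_cat m c1 c2 : exec m (c1 ++ c2) = exec (exec m c1) c2.
Proof. exact: foldl_cat. Qed.

(* [N'] differs from [N] only in the integer temporaries numbered k or more. *)
Definition same_n k (N N' : nat -> nat) :=
  forall a, ~~ (T0 + k <= a < 63) -> N' a = N a.

Lemma upd_same (T : Type) (g : nat -> T) d v : upd g d v d = v.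
Proof. by rewrite /upd eqxx. Qed.

Lemma upd_neq (T : Type) (g : nat -> T) d v j : j != d -> upd g d v j = g j.
Proof. by rewrite /upd => /negPf->. Qed.

Lemma same_n_trans k k' N1 N2 N3 : k <= k' ->
  same_n k N1 N2 -> same_n k' N2 N3 -> same_n k N1 N3.
Proof. by move=> kk h1 h2 a ha; rewrite h2 ?h1 //; move: ha; rewrite /T0; lia. Qed.

Lemma same_n_upd k N N' d v : same_n k N N' -> T0 + k <= d < 63 -> same_n k N (upd N' d v).
Proof.
move=> h hd a ha; rewrite upd_neq ?h //.
by apply: contraNneq ha => ->.
Qed.

Lemma exec_shift6 r N M : exists N', [/\ exec (N, M) (shift6 r) = (N', M),
  N' r = 64 * N r & forall a, a != r -> N' a = N a].
Proof.
eexists; split; first by [].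
  by rewrite !upd_same; lia.
by move=> a ha; rewrite !upd_neq.
Qed.

Definition rel_nat s (N : nat -> nat) := forall id i, id < 32 -> N (64 * i + id) = nv s id i.

Lemma rel_nat_same s k N N' : rel_nat s N -> same_n k N N' -> rel_nat s N'.
Proof. by move=> h hs id i hid; rewrite hs ?h // /T0; lia. Qed.

Lemma cn_get id i k : cn (Get id i) k = cn i k ++ shift6 (T0 + k) ++
  [:: NConst (T0 + k).+1 id; NAdd (T0 + k) (T0 + k) (T0 + k).+1; NLoad (T0 + k) (T0 + k)].
Proof. by []. Qed.

Lemma exec_cn s e k N M : wfn k e -> rel_nat s N ->
  exists N', [/\ exec (N, M) (cn e k) = (N', M), N' (T0 + k) = neval s e & same_n k N N'].
Proof.
elim: e k N => [c|id i IH|a IHa b IHb|a IHa b IHb] k N; rewrite [wfn _ _]/= [neval _ _]/= => /andP[k20 h] hN.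
- exists (upd N (T0 + k) c); split; rewrite ?upd_same //.
  by apply: same_n_upd => //; rewrite /T0; lia.
- have /andP[hid hi] := h.
  have [N1 [e1 v1 s1]] := IH k N hi hN.
  have [N2 [e2 v2 s2]] := exec_shift6 (T0 + k) N1 M.
  rewrite cn_get !exec_cat e1 e2 /=; eexists; split; first by [].
    have neq : T0 + k != (T0 + k).+1 by lia.
    rewrite !upd_same (upd_neq _ _ neq) v2 v1 /= .
    have e3 : 64 * neval s i + id != T0 + k by rewrite /T0; lia.
    have e4 : 64 * neval s i + id != (T0 + k).+1 by rewrite /T0; lia.
    rewrite (upd_neq _ _ e3) (upd_neq _ _ e4) s2 // s1 ?hN //.
    by rewrite /T0; lia.
  have s12 : same_n k N N2.
    move=> x hx; rewrite s2 ?s1 //; apply: contraNneq hx => ->.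
    by rewrite /T0; lia.
  by do 3![apply: same_n_upd; last by rewrite /T0; lia].
- have /andP[ha hb] := h.
  have [N1 [e1 v1 s1]] := IHa k N ha hN.
  have [N2 [e2 v2 s2]] := IHb k.+1 N1 hb (rel_nat_same hN s1).
  rewrite !exec_cat e1 e2 /=; eexists; split; first by [].
    rewrite upd_same -addnS v2 (s2 (T0 + k)) ?v1 //; by rewrite /T0; lia.
  apply: same_n_upd; last by rewrite /T0; lia.
  exact: same_n_trans (leqnSn k) s1 s2.
- have /andP[ha hb] := h.
  have [N1 [e1 v1 s1]] := IHa k N ha hN.
  have [N2 [e2 v2 s2]] := IHb k.+1 N1 hb (rel_nat_same hN s1).
  rewrite !exec_cat e1 e2 /=; eexists; split; first by [].
    rewrite upd_same -addnS v2 (s2 (T0 + k)) ?v1 //; by rewrite /T0; lia.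
  apply: same_n_upd; last by rewrite /T0; lia.
  exact: same_n_trans (leqnSn k) s1 s2.
Qed.

Definition same_r k (M M' : nat -> R) :=
  forall a, ~~ (base + T0 + k <= a < base + 64) -> M' a = M a.

Lemma same_r_trans k k' M1 M2 M3 : k <= k' ->
  same_r k M1 M2 -> same_r k' M2 M3 -> same_r k M1 M3.
Proof. by move=> kk h1 h2 a ha; rewrite h2 ?h1 //; move: ha; rewrite /T0; lia. Qed.

Lemma same_r_upd k M d v : base + T0 + k <= d < base + 64 -> same_r k M (upd M d v).
Proof.
by move=> hd a ha; rewrite upd_neq //; apply: contraNneq ha => ->.
Qed.

Lemma rel_same s N M N' M' : rel s (N, M) -> same_n 0 N N' -> same_r 0 M M' ->
  rel s (N', M').
Proof.
case=> /= r1 r2 r3 r4 hN hM; split=> /=.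
- exact: rel_nat_same r1 hN.
- by move=> id i hid; rewrite hM ?r2 // /T0; lia.
- by rewrite hN ?r3 // /T0 /BASE; lia.
- by move=> a ha; rewrite hM ?r4 // /T0; lia.
Qed.

Lemma exec_addr q k N M : N BASE = base -> 60 <= q < 63 ->
  exists N', [/\ exec (N, M) (addr_tmp q k) = (N', M), N' q = base + T0 + k &
    forall a, a != q -> N' a = N a].
Proof.
move=> hb hq; eexists; split; first by [].
  by rewrite !upd_same upd_neq ?hb; rewrite /BASE; lia.
by move=> a ha; rewrite !upd_neq.
Qed.

Lemma same_n_addr k N N' q : 60 <= q < 63 -> k <= 20 ->
  (forall a, a != q -> N' a = N a) -> same_n k N N'.
Proof.
move=> hq hk h a ha; apply: h; apply: contraNneq ha => ->.
by rewrite /T0; lia.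
Qed.

Lemma exec_copy k (N : nat -> nat) (M : nat -> R) : N BASE = base -> k < 20 ->
  exists N', exec (N, M) (addr_tmp 60 k ++ [:: RCopy 60 T0]) =
    (N', upd M (base + T0 + k) (M (N T0))) /\ same_n 0 N N'.
Proof.
move=> hb k20; have [N1 [e1 v1 s1]] := @exec_addr 60 k N M hb isT.
exists N1; split; last by apply: same_n_addr s1.
by rewrite exec_cat e1 /= v1 s1.
Qed.

Lemma crx_op o e1 e2 k : crx (ROp o e1 e2) k = crx e1 k ++ crx e2 k.+1 ++
  addr_tmp 60 k ++ addr_tmp 61 k.+1 ++ [:: instr_op o 60 60 61].
Proof. by []. Qed.

Lemma crx_get id i k : crx (RGet id i) k = cn i 0 ++ shift6 T0 ++
  [:: NConst T0.+1 id; NAdd T0 T0 T0.+1; NAdd T0 T0 BASE] ++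
  addr_tmp 60 k ++ [:: RCopy 60 T0].
Proof. by []. Qed.

Lemma exec_crx s e k N M : wfr k e -> rok s e -> rel s (N, M) ->
  exists N' M', [/\ exec (N, M) (crx e k) = (N', M'), M' (base + T0 + k) = reval s e,
    same_n 0 N N' & same_r k M M'].
Proof.
elim: e k N M => [||id i|e i|o e1 IH1 e2 IH2] k N M; rewrite [wfr _ _]/= => /andP[k20 h] ok hs;
  have hb : N BASE = base by case: hs.
- have [N1 [e1 v1 s1]] := @exec_addr 60 k N M hb isT.
  exists N1, (upd M (base + T0 + k) 0%R); split; rewrite ?upd_same //.
  + by rewrite exec_cat e1 /= v1.
  + exact: same_n_addr s1.
  + by apply: same_r_upd; rewrite /T0; lia.
- have [N1 [e1 v1 s1]] := @exec_addr 60 k N M hb isT.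
  exists N1, (upd M (base + T0 + k) 1%R); split; rewrite ?upd_same //.
  + by rewrite exec_cat e1 /= v1.
  + exact: same_n_addr s1.
  + by apply: same_r_upd; rewrite /T0; lia.
- have /andP[hid hi] := h.
  have [N1 [e1 v1 s1]] := exec_cn M hi (rel_n hs).
  have [N2 [e2 v2 s2]] := exec_shift6 T0 N1 M.
  set N3 := (exec (N2, M) [:: NConst T0.+1 id; NAdd T0 T0 T0.+1; NAdd T0 T0 BASE]).1.
  have s12 : same_n 0 N N2.
    move=> x hx; rewrite s2 ?s1 //; apply: contraNneq hx => ->.
    by rewrite /T0; lia.
  have s3 : same_n 0 N N3 by do 3![apply: same_n_upd; last by rewrite /T0; lia].
  have v3 : N3 T0 = base + 64 * neval s i + id.
    rewrite /N3 /= !upd_same ![upd _ _ _ BASE]upd_neq // ?upd_same upd_neq //.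
    by rewrite v2 -[T0]addn0 v1 s12 ?hb; rewrite /T0 /BASE; lia.
  have hb3 : N3 BASE = base by rewrite s3 ?hb // /T0 /BASE; lia.
  have [N4 [e4 s4]] := @exec_copy k N3 M hb3 k20.
  exists N4, (upd M (base + T0 + k) (M (N3 T0))); split.
  + by rewrite crx_get exec_cat e1 exec_cat e2 exec_cat -e4.
  + by rewrite upd_same v3; apply: (rel_r hs).
  + exact: same_n_trans (leqnn 0) s3 s4.
  + by apply: same_r_upd; rewrite /T0; lia.
- have [N1 [e1 v1 s1]] := exec_cn M h (rel_n hs).
  set N3 := (exec (N1, M) [:: NAdd T0 T0 T0; NAdd T0 T0 T0; NConst T0.+1 e; NAdd T0 T0 T0.+1]).1.
  have s3 : same_n 0 N N3 by do 4![apply: same_n_upd; last by rewrite /T0; lia].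
  have v3 : N3 T0 = 4 * neval s i + e.
    rewrite /N3 /= !upd_same ![upd _ T0.+1 _ T0]upd_neq // ?upd_same.
    by rewrite -[T0]addn0 v1; lia.
  have hb3 : N3 BASE = base by rewrite s3 ?hb // /T0 /BASE; lia.
  have [N4 [e4 s4]] := @exec_copy k N3 M hb3 k20.
  exists N4, (upd M (base + T0 + k) (M (N3 T0))); split.
  + by rewrite [crx _ _]/= exec_cat e1 -e4.
  + rewrite upd_same v3; apply: (rel_i hs).
    by move: ok => /= /andP[h1 h2]; rewrite /base; lia.
  + exact: same_n_trans (leqnn 0) s3 s4.
  + by apply: same_r_upd; rewrite /T0; lia.
- have /andP[h1 h2] := h; have /andP[ok1 ok2] := ok.
  have [N1 [M1 [E1 v1 s1 r1]]] := IH1 k N M h1 ok1 hs.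
  have hs1 : rel s (N1, M1).
    by apply: rel_same hs s1 _ => a ha; apply: r1; move: ha; rewrite /T0; lia.
  have [N2 [M2 [E2 v2 s2 r2]]] := IH2 k.+1 N1 M1 h2 ok2 hs1.
  have hb2 : N2 BASE = base by rewrite s2 ?s1 ?hb // /T0 /BASE; lia.
  have [N3 [E3 v3 s3]] := @exec_addr 60 k N2 M2 hb2 isT.
  have hb3 : N3 BASE = base by rewrite s3.
  have [N4 [E4 v4 s4]] := @exec_addr 61 k.+1 N3 M2 hb3 isT.
  have v34 : N4 60 = base + T0 + k by rewrite s4.
  exists N4, (upd M2 (base + T0 + k) (ropE o (reval s e1) (reval s e2))).
  have r12 : same_r k M M2 by exact: same_r_trans (leqnSn k) r1 r2.
  split.
  + rewrite crx_op !exec_cat E1 E2 E3 E4.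
    have a1 : M2 (N4 60) = reval s e1 by rewrite v34 r2 ?v1 // /T0; lia.
    have a2 : M2 (N4 61) = reval s e2 by rewrite v4 -v2.
    by case: (o); rewrite /= a1 a2 v34.
  + by rewrite upd_same.
  + apply: (@same_n_trans 0 0 N N1 N4) => //.
    apply: (@same_n_trans 0 0 N1 N2 N4) => //.
    apply: (@same_n_trans 0 0 N2 N3 N4) => //; first exact: same_n_addr s3.
    exact: same_n_addr s4.
  + apply: same_r_trans (leqnn k) r12 _.
    by apply: same_r_upd; rewrite /T0; lia.
Qed.

Lemma straight_cn e k : all straight (cn e k).
Proof.
elim: e k => [c|id i IH|a IHa b IHb|a IHa b IHb] k //=;
  by rewrite !all_cat /= ?IH ?IHa ?IHb.
Qed.

Lemma straight_crx e k : all straight (crx e k).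
Proof.
elim: e k => [||id i|e i|o e1 IH1 e2 IH2] k //=.
- by rewrite !all_cat straight_cn.
- by rewrite !all_cat straight_cn.
- by rewrite !all_cat IH1 IH2; case: (o).
Qed.

(** * Big-step semantics with running time *)

(** The time is the exact number of steps of the compiled code; the added constants are the tests
    and the unconditional jumps. *)
Inductive ev : cmd -> st -> nat -> st -> Prop :=
| ev_nset id i e s : ev (NSet id i e) s (size (cnset id i e)) (setn s id (neval s i) (neval s e))
| ev_rset id i e s : rok s e ->
    ev (RSet id i e) s (size (crset id i e)) (setr s id (neval s i) (reval s e))
| ev_seq a b s t1 s1 t2 s2 : ev a s t1 s1 -> ev b s1 t2 s2 -> ev (Seq a b) s (t1 + t2) s2
| ev_ift b c1 c2 s t s' : cok s b -> ceval s b -> ev c1 s t s' ->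
    ev (If b c1 c2) s (size (ccond b).1 + 1 + t) s'
| ev_iff b c1 c2 s t s' : cok s b -> ~~ ceval s b -> ev c2 s t s' ->
    ev (If b c1 c2) s (size (ccond b).1 + 1 + t + 1) s'
| ev_while0 a b c s : ~~ (neval s a < neval s b) ->
    ev (While a b c) s (size (ccond (NLess a b)).1 + 2) s
| ev_whileS a b c s t s1 t' s2 : neval s a < neval s b -> ev c s t s1 ->
    ev (While a b c) s1 t' s2 ->
    ev (While a b c) s (size (ccond (NLess a b)).1 + 1 + t + 1 + t') s2.

Lemma exec_cond s b m : wfb b -> cok s b -> rel s m ->
  all straight (ccond b).1 /\
  exists m', [/\ exec m (ccond b).1 = m', rel s m' &
    forall P p l, nth Halt P p = (ccond b).2 l ->
      step P (at_pc p m') = Some (at_pc (if ceval s b then l else p.+1) m')].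
Proof.
case: m => N M; case: b => a b; rewrite [wfb _]/= => /andP[wa wb]; rewrite [cok _ _]/= => ok hs.
- split; first by rewrite /= all_cat !straight_cn.
  have [N1 [e1 v1 s1]] := exec_cn M wa (rel_n hs).
  have [N2 [e2 v2 s2]] := exec_cn M wb (rel_nat_same (rel_n hs) s1).
  exists (N2, M); split.
  + by rewrite /= exec_cat e1 e2.
  + by apply: rel_same hs _ _ => //; exact: same_n_trans (leq0n 1) s1 s2.
  + move=> P p l hl; rewrite /step /= hl /= -[T0.+1]addn1 v2 (s2 T0); last by rewrite /T0; lia.
    by rewrite -[T0]addn0 v1.
- have /andP[oka okb] := ok.
  split; first by rewrite /= !all_cat !straight_crx.
  have [N1 [M1 [E1 v1 s1 r1]]] := exec_crx wa oka hs.
  have hs1 := rel_same hs s1 r1.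
  have [N2 [M2 [E2 v2 s2 r2]]] := exec_crx wb okb hs1.
  have r12 : same_r 0 M M2 by exact: same_r_trans (leq0n 1) r1 r2.
  have s12 : same_n 0 N N2 by exact: same_n_trans (leqnn 0) s1 s2.
  have hs2 := rel_same hs s12 r12.
  have [N3 [E3 v3 s3]] := @exec_addr 60 0 N2 M2 (rel_b hs2) isT.
  have hb3 : N3 BASE = base by rewrite s3 //; exact: (rel_b hs2).
  have [N4 [E4 v4 s4]] := @exec_addr 61 1 N3 M2 hb3 isT.
  exists (N4, M2); split.
  + have -> : (ccond (RLess a b)).1 = crx a 0 ++ crx b 1 ++ addr_tmp 60 0 ++ addr_tmp 61 1 by [].
    by rewrite exec_cat E1 exec_cat E2 exec_cat E3 E4.
  + apply: rel_same hs2 _ (fun _ _ => erefl).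
    apply: (@same_n_trans 0 0 N2 N3 N4) => //; first exact: same_n_addr s3.
    exact: same_n_addr s4.
  + move=> P p l hl; rewrite /step /= hl /= v4 s4 // v3 v2 r2 ?v1 //.
    by rewrite /T0; lia.
Qed.

Lemma rel_setn s N M id i v : id < 32 -> rel s (N, M) ->
  rel (setn s id i v) (upd N (64 * i + id) v, M).
Proof.
move=> hid [/= r1 r2 r3 r4]; split=> //=.
- move=> id' i' hid'; rewrite /upd.
  have -> : (64 * i' + id' == 64 * i + id) = Nat.eqb id' id && Nat.eqb i' i by lia.
  by rewrite r1.
- by rewrite upd_neq //; rewrite /BASE; lia.
Qed.

Lemma rel_setr s N M id i v : id < 32 -> rel s (N, M) ->
  rel (setr s id i v) (N, upd M (base + 64 * i + id) v).
Proof.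
move=> hid [/= r1 r2 r3 r4]; split=> //=.
- move=> id' i' hid'; rewrite /upd.
  have -> : (base + 64 * i' + id' == base + 64 * i + id) = Nat.eqb id' id && Nat.eqb i' i by lia.
  by rewrite r2.
- by move=> a ha; rewrite upd_neq ?r4 //; lia.
Qed.

Lemma exec_cnset s id i e m : [&& id < 32, wfn 0 i & wfn 1 e] -> rel s m ->
  rel (setn s id (neval s i) (neval s e)) (exec m (cnset id i e)).
Proof.
case: m => N M /and3P[hid wi we] hs; rewrite /cnset.
have [N1 [e1 v1 s1]] := exec_cn M wi (rel_n hs).
have [N2 [e2 v2 s2]] := exec_shift6 T0 N1 M.
have s12 : same_n 0 N N2.
  move=> x hx; rewrite s2 ?s1 //; apply: contraNneq hx => ->.
  by rewrite /T0; lia.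
rewrite exec_cat e1 exec_cat e2 exec_cat.
set N3 := (exec (N2, M) [:: NConst T0.+1 id; NAdd T0 T0 T0.+1]).1.
have s3 : same_n 0 N N3 by do 2![apply: same_n_upd; last by rewrite /T0; lia].
have v3 : N3 T0 = 64 * neval s i + id.
  rewrite /N3 /= !upd_same ![upd _ T0.+1 _ T0]upd_neq // v2.
  by rewrite -[T0]addn0 v1.
have [N4 [e4 v4 s4]] := exec_cn M we (rel_nat_same (rel_n hs) s3).
rewrite exec_cat -[exec (N2, M) _]/(N3, M) e4 /= (s4 T0); last by rewrite /T0; lia.
rewrite v3 -[T0.+1]addn1 v4; apply: rel_setn => //.
by apply: rel_same hs _ (fun _ _ => erefl); exact: same_n_trans (leq0n 1) s3 s4.
Qed.

Lemma exec_crset s id i e m : [&& id < 32, wfn 0 i & wfr 0 e] -> rok s e -> rel s m ->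
  rel (setr s id (neval s i) (reval s e)) (exec m (crset id i e)).
Proof.
case: m => N0 M0 /and3P[hid wi we] ok hs0; rewrite /crset.
have [N [M [e0 v0 s0 r0]]] := exec_crx we ok hs0.
have hs := rel_same hs0 s0 r0.
have [N1 [e1 v1 s1]] := exec_cn M wi (rel_n hs).
have [N2 [e2 v2 s2]] := exec_shift6 T0 N1 M.
have s12 : same_n 0 N N2.
  move=> x hx; rewrite s2 ?s1 //; apply: contraNneq hx => ->.
  by rewrite /T0; lia.
rewrite exec_cat e0 exec_cat e1 exec_cat e2 exec_cat.
set N3 := (exec (N2, M) [:: NConst T0.+1 id; NAdd T0 T0 T0.+1; NAdd T0 T0 BASE]).1.
have s3 : same_n 0 N N3 by do 3![apply: same_n_upd; last by rewrite /T0; lia].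
have hb : N BASE = base := rel_b hs.
have v3 : N3 T0 = base + 64 * neval s i + id.
  rewrite /N3 /= !upd_same ![upd _ _ _ BASE]upd_neq // ?upd_same upd_neq //.
  by rewrite v2 -[T0]addn0 v1 s12 ?hb; rewrite /= /T0 /BASE; lia.
have hs3 := rel_same hs s3 (fun _ _ => erefl).
have [N4 [e4 v4 s4]] := @exec_addr 60 0 N3 M (rel_b hs3) isT.
rewrite exec_cat -[exec (N2, M) _]/(N3, M) e4 /= s4 // v3 v4 v0.
apply: rel_setr => //; apply: rel_same hs3 _ (fun _ _ => erefl).
exact: same_n_addr s4.
Qed.

Lemma code_at_cons P p i c : code_at P p (i :: c) ->
  nth Halt P p = i /\ code_at P p.+1 c.
Proof.
move=> h; split; first by have := h 0 isT; rewrite addn0.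
by move=> j hj; rewrite addSnnS h.
Qed.

Lemma msteps1 P s s' : step P s = Some s' -> msteps P 1 s = Some s'.
Proof. by move=> /= ->. Qed.

Lemma step_jmp P p l m : nth Halt P p = Jmp l -> step P (at_pc p m) = Some (at_pc l m).
Proof. by move=> h; rewrite /step /= h. Qed.

Lemma code_at1 P p i : code_at P p [:: i] -> nth Halt P p = i.
Proof. by move=> /(_ 0 isT); rewrite addn0. Qed.

Theorem comp_correct c s t s' : ev c s t s' -> wf c ->
  forall P p m, code_at P p (comp p c) -> rel s m ->
  exists m', msteps P t (at_pc p m) = Some (at_pc (p + csize c) m') /\ rel s' m'.
Proof.
elim=> {c s t s'}.
- move=> id i e s wfc P p m hc hs.
  exists (exec m (cnset id i e)); split; last exact: exec_cnset.
  by apply: exec_msteps => //; rewrite /cnset !all_cat !straight_cn.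
- move=> id i e s ok wfc P p m hc hs.
  exists (exec m (crset id i e)); split; last exact: exec_crset.
  by apply: exec_msteps => //; rewrite /crset !all_cat straight_cn straight_crx.
- move=> a b s t1 s1 t2 s2 _ IH1 _ IH2 /= /andP[wa wb] P p m /code_at_cat[h1 h2] hs.
  have [m1 [e1 hs1]] := IH1 wa P p m h1 hs.
  rewrite size_comp in h2.
  have [m2 [e2 hs2]] := IH2 wb P _ m1 h2 hs1.
  by exists m2; split=> //; rewrite (msteps_trans e1 e2) addnA.
- move=> b c1 c2 s t s' ok hb _ IH /and3P[wb w1 w2] P p m hc hs.
  have [hst [m' [em hm hstep]]] := exec_cond wb ok hs.
  move: hc; rewrite [comp _ _]/= [csize (If _ _ _)]/=.
  case: (ccond b) hst em hstep => tt j /= hst em hstep.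
  move=> /code_at_cat[h1 /code_at_cons[h2 /code_at_cat[_ /code_at_cons[_ h5]]]].
  rewrite size_comp in h5.
  have e0 : ((p + size tt).+1 + csize c2).+1 = p + size tt + 1 + csize c2 + 1.
    by rewrite !addn1 addSn.
  rewrite e0 in h5.
  have := exec_msteps m hst h1; rewrite em => e1.
  have := hstep _ _ _ h2; rewrite hb => e2.
  have [m2 [e3 hs2]] := IH w1 P _ m' h5 hm.
  exists m2; split=> //; rewrite (msteps_trans (msteps_trans e1 (msteps1 e2)) e3).
  by congr (Some (at_pc _ _)); rewrite !addnA; lia.
- move=> b c1 c2 s t s' ok hb _ IH /and3P[wb w1 w2] P p m hc hs.
  have [hst [m' [em hm hstep]]] := exec_cond wb ok hs.
  move: hc; rewrite [comp _ _]/= [csize (If _ _ _)]/=.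
  case: (ccond b) hst em hstep => tt j /= hst em hstep.
  move=> /code_at_cat[h1 /code_at_cons[h2 /code_at_cat[h3 /code_at_cons[h4 _]]]].
  rewrite size_comp in h4.
  have := exec_msteps m hst h1; rewrite em => e1.
  have := hstep _ _ _ h2; rewrite (negPf hb) => e2.
  rewrite addn1 in h3 h4.
  have [m2 [e3 hs2]] := IH w2 P _ m' h3 hm.
  exists m2; split=> //.
  have := msteps_trans (msteps_trans e1 (msteps1 e2)) e3 => e4.
  rewrite (msteps_trans e4 (msteps1 (step_jmp m2 h4))).
  by congr (Some (at_pc _ _)); lia.
- move=> a b c s hb wfc P p m hc hs; have /and3P[wa wb wc] := wfc.
  have [hst [m' [em hm hstep]]] := @exec_cond s (NLess a b) m (introT andP (conj wa wb)) isT hs.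
  move: hc; rewrite [comp _ _]/= [csize (While _ _ _)]/=.
  move: hst em; rewrite [(ccond _).1]/(cn a 0 ++ cn b 1).
  set tt := cn a 0 ++ cn b 1 => hst em.
  move=> /code_at_cat[h1 /code_at_cons[h2 /code_at_cons[h3 _]]].
  have := exec_msteps m hst h1; rewrite em => e1.
  have := hstep _ _ _ h2; rewrite /= (negPf hb) => e2.
  exists m'; split=> //.
  rewrite (_ : size tt + 2 = size tt + 1 + 1); last by lia.
  rewrite (msteps_trans (msteps_trans e1 (msteps1 e2)) (msteps1 (step_jmp m' h3))).
  by congr (Some (at_pc _ _)); lia.
- move=> a b c s t s1 t' s2 hb _ IH1 _ IH2 wfc P p m hc hs; have /and3P[wa wb wc] := wfc.
  have hc' := hc.
  have [hst [m' [em hm hstep]]] := @exec_cond s (NLess a b) m (introT andP (conj wa wb)) isT hs.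
  move: hc'; rewrite [comp _ _]/= [csize (While _ _ _)]/=.
  move: hst em; rewrite [(ccond _).1]/(cn a 0 ++ cn b 1).
  set tt := cn a 0 ++ cn b 1 => hst em.
  move=> /code_at_cat[h1 /code_at_cons[h2 /code_at_cons[h3 /code_at_cat[h4 h5]]]].
  rewrite size_comp in h5; have {}h5 := code_at1 h5.
  have := exec_msteps m hst h1; rewrite em => e1.
  have := hstep _ _ _ h2; rewrite /= hb => e2.
  have e0 : (p + size tt).+2 = p + size tt + 2 by lia.
  rewrite e0 in h4 h5.
  have [m1 [e3 hs1]] := IH1 wc P _ m' h4 hm.
  have [m2 [e4 hs2]] := IH2 wfc P p m1 hc hs1.
  exists m2; split=> //; move: e4; rewrite [csize (While _ _ _)]/= => e4.
  have e5 := step_jmp m1 h5.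
  have e123 := msteps_trans (msteps_trans e1 (msteps1 e2)) e3.
  exact: msteps_trans (msteps_trans e123 (msteps1 e5)) e4.
Qed.

End Semantics.

(** * Whole programs *)

Definition prelude := [:: NAdd 63 0 0; NAdd 63 63 63; NConst 62 4; NAdd 63 63 62].

(* The output, held in the entries [n, ..., 2n-1] of array [OUT], is moved
   downwards to registers 1, ..., n. Going from the last entry to the first
   preserves the entries still to be moved; registers 0 to 5 drive the loop, so
   that the last five moves are unrolled. *)
Definition OUT := 30.
Definition epi_setup := NAdd 4 0 0 :: shift6 4 ++
  [:: NConst 5 OUT; NAdd 4 4 5; NConst 1 64; NSub 4 4 1; NConst 5 0; NAdd 2 0 5;
      NAdd 0 4 5; NConst 3 1; NConst 5 5].
Definition epi_loop p := [:: NLt 5 2 (p + 2); Jmp (p + 7); NLoad 4 0; NStore 2 4;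
  NSub 0 0 1; NSub 2 2 3; Jmp p].
Definition epi_tail := NSub 4 5 2 :: shift6 4 ++
  [:: NAdd 0 0 4; NLoad 5 0; NSub 0 0 1; NLoad 4 0; NSub 0 0 1; NLoad 3 0;
      NSub 0 0 1; NLoad 2 0; NSub 0 0 1; NLoad 1 0].

Definition whole c : program :=
  prelude ++ comp 4 c ++ epi_setup ++ epi_loop (4 + csize c + size epi_setup) ++ epi_tail.

Section Epilogue.
Variables (n : nat) (A : nat -> nat) (P : program) (M : nat -> R).

(** As the output starts at entry n, every source lies beyond register n and beyond the loop
    registers, hence is never overwritten by a move. *)
Let src d := 64 * (n + d.-1) + OUT.

Record linv d (N : nat -> nat) : Prop := LInv {
  l2 : N 2 = d; l0 : 0 < n -> N 0 = src d; l1 : N 1 = 64; l3 : N 3 = 1; l5 : N 5 = 5;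
  lout : forall a, d < a <= n -> 5 < a -> N a = A (src a);
  lrest : forall a, n < a -> 5 < a -> N a = A a }.

Definition body := [:: NLoad 4 0; NStore 2 4; NSub 0 0 1; NSub 2 2 3].

Lemma step_nlt p a b l N : nth Halt P p = NLt a b l ->
  step P (at_pc p (N, M)) = Some (at_pc (if N a < N b then l else p.+1) (N, M)).
Proof. by move=> h; rewrite /step /= h. Qed.

Lemma linv_body d N : 5 < d <= n -> linv d N ->
  exists2 N', exec (N, M) body = (N', M) & linv d.-1 N'.
Proof.
move=> /andP[d5 dn] [i2 i0 i1 i3 i5 io ir]; eexists; first by [].
have n0 : 0 < n by lia.
have E0 : N 0 = src d by exact: i0.
have hs : N (src d) = A (src d) by apply: ir; rewrite /src /OUT; lia.
have nd k : k < 6 -> (k == d) = false by move: d5; clear; lia.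
split.
- by rewrite /upd /= i2 !nd //= i3 subn1.
- move=> _; rewrite /upd /= i2 !nd //= E0 i1.
  by move: n0 d5; clear; rewrite /src; lia.
- by rewrite /upd /= i2 !nd.
- by rewrite /upd /= i2 !nd.
- by rewrite /upd /= i2 !nd.
- move=> a ha a5; rewrite /upd ifF; last by move: a5; clear; lia.
  rewrite ifF; last by move: a5; clear; lia.
  rewrite /= i2 E0 hs; case: eqP => [->|/eqP ne] //.
  by rewrite ifF ?io //; move: ne ha a5; clear; lia.
- move=> a ha a5; rewrite /upd ifF; last by move: a5; clear; lia.
  rewrite ifF; last by move: a5; clear; lia.
  rewrite /= i2 ifF; last by move: ha dn; clear; lia.
  by rewrite ifF ?ir //; move: a5; clear; lia.
Qed.

Lemma epi_loop_ok p d N : code_at P p (epi_loop p) -> d <= n -> linv d N ->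
  (0 < n -> 0 < d) ->
  exists t N' d', [/\ t <= 6 * d + 2, msteps P t (at_pc p (N, M)) = Some (at_pc (p + 7) (N', M)),
    d' <= 5 /\ d' <= n, (0 < n -> 0 < d') & linv d' N'].
Proof.
move=> hc; elim/ltn_ind: d N => d IH N dn h hpos.
have [h0 /code_at_cons[h1 hr]] := code_at_cons hc.
have [hb h6] := @code_at_cat P p.+2 body [:: Jmp p] hr.
have {}h6 := code_at1 h6.
have e0 := step_nlt N h0; rewrite (l2 h) (l5 h) in e0.
have [d5|d5] := leqP d 5.
  rewrite ltnNge d5 /= in e0.
  exists 2, N, d; split=> //; first by lia.
  by rewrite (msteps_trans (msteps1 e0) (msteps1 (step_jmp (N, M) h1))).
rewrite d5 in e0.
have [|N1 e1 i1] := @linv_body d N _ h; first by rewrite d5.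
have e2 := @exec_msteps P p.+2 body (N, M) isT hb; rewrite e1 in e2.
have a1 : d.-1 < d by move: d5; clear; lia.
have a2 : d.-1 <= n by move: dn; clear; lia.
have a3 : 0 < n -> 0 < d.-1 by move: d5; clear; lia.
have [t [N2 [d' [ht e3 hd' hp hi]]]] := IH d.-1 a1 N1 a2 i1 a3.
exists (1 + size body + 1 + t), N2, d'; split=> //; first by move: ht d5; clear; rewrite /=; lia.
rewrite addn2 in e0.
exact: msteps_trans (msteps_trans (msteps_trans (msteps1 e0) e2) (msteps1 (step_jmp _ h6))) e3.
Qed.

(** For n < 5 the loop stops at some d < 5. The pointer is first advanced to [src 5], and registers
    5 to 1 are then all loaded, those beyond n with irrelevant values. Register 1 is last because it
    holds the stride 64. *)
Lemma tail_ok d N : 0 < d <= 5 -> d <= n -> linv d N ->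
  exists2 N', exec (N, M) epi_tail = (N', M) & forall a, 0 < a <= n -> N' a = A (src a).
Proof.
move=> /andP[d0 d5] dn [i2 i0 i1 i3 i5 io ir].
have n0 : 0 < n by lia.
have E0 : N 0 = src d by exact: i0.
set c1 := NSub 4 5 2 :: shift6 4 ++ [:: NAdd 0 0 4].
have [N1 [E1 v0 v1 vo]] : exists N1, [/\ exec (N, M) c1 = (N1, M), N1 0 = src 5, N1 1 = 64
    & forall a, 5 < a -> N1 a = N a].
  eexists; split; first by [].
  - rewrite /upd /= i5 i2 E0; move: d0 d5 dn; clear; rewrite /src; lia.
  - by rewrite /upd /= i1.
  - by move=> a a5; rewrite /upd /= !ifF //; lia.
have mv k N' : 1 < k <= 5 -> N' 0 = src k -> N' 1 = 64 -> exists N2,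
    [/\ exec (N', M) [:: NLoad k 0; NSub 0 0 1] = (N2, M), N2 0 = src k.-1, N2 1 = 64,
     N2 k = N' (src k) & forall a : nat, a != k -> 0 < a -> N2 a = N' a].
  move=> /andP[k1 k5] h0 h1; eexists; split; first by [].
  - rewrite /= /upd /= h0 h1 !ifF; try by move: k1; clear; lia.
    by move: k1; clear; rewrite /src; lia.
  - by rewrite /= /upd /= ifF //; move: k1; clear; lia.
  - by rewrite /= /upd /= ifF ?eqxx ?h0 //; move: k1; clear; lia.
  - by move=> a ak a0; rewrite /= /upd /= ifF ?(negPf ak) //; move: a0; clear; lia.
have [N2 [E2 v02 v12 w2 o2]] := mv 5 N1 isT v0 v1.
have [N3 [E3 v03 v13 w3 o3]] := mv 4 N2 isT v02 v12.
have [N4 [E4 v04 v14 w4 o4]] := mv 3 N3 isT v03 v13.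
have [N5 [E5 v05 v15 w5 o5]] := mv 2 N4 isT v04 v14.
exists (upd N5 1 (N5 (src 1))).
  rewrite (_ : epi_tail = c1 ++ [:: NLoad 5 0; NSub 0 0 1] ++ [:: NLoad 4 0; NSub 0 0 1]
    ++ [:: NLoad 3 0; NSub 0 0 1] ++ [:: NLoad 2 0; NSub 0 0 1] ++ [:: NLoad 1 0]) //.
  by rewrite exec_cat E1 exec_cat E2 exec_cat E3 exec_cat E4 exec_cat E5 /= v05.
have hA k : 5 < src k by rewrite /src /OUT; clear; lia.
have hs k : N (src k) = A (src k).
  by apply: ir => //; rewrite /src /OUT; clear; lia.
have o (N' N'' : nat -> nat) k : k <= 5 -> (forall a : nat, a != k -> 0 < a -> N'' a = N' a) ->
    forall j, N'' (src j) = N' (src j).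
  by move=> k5 h j; apply: h; have := hA j; move: k5; clear; lia.
have p2 := o N1 N2 5 isT o2; have p3 := o N2 N3 4 isT o3.
have p4 := o N3 N4 3 isT o4; have p5 := o N4 N5 2 isT o5.
have p1 j : N1 (src j) = A (src j) by rewrite vo.
move=> a /andP[a0 an]; rewrite /upd.
case: a a0 an => [|[|[|[|[|[|a]]]]]] // _ an /=.
- by rewrite p5 p4 p3 p2 p1.
- by rewrite w5 p4 p3 p2 p1.
- by rewrite o5 // w4 p3 p2 p1.
- by rewrite o5 // o4 // w3 p2 p1.
- by rewrite o5 // o4 // o3 // w2 p1.
- rewrite o5 // o4 // o3 // o2 // vo // io //.
  by move: d5 an; clear; lia.
Qed.

Lemma setup_ok N : (forall a, N a = A a) -> A 0 = n ->
  exists2 N', exec (N, M) epi_setup = (N', M) & linv n N'.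
Proof.
move=> hN A0; have [N2 [E2 v2 s2]] := exec_shift6 4 (upd N 4 (N 0 + N 0)) M.
have v24 : N2 4 = 64 * (n + n) by rewrite v2 upd_same hN A0.
have s2' a : a != 4 -> N2 a = A a by move=> ha; rewrite s2 // upd_neq.
eexists; first by rewrite /epi_setup -cat1s exec_cat exec_cat E2.
split; rewrite /= /upd /= ?v24 ?s2' ?A0 ?addn0 //.
- by move=> n0; move: n0; rewrite /src /OUT; clear; lia.
- by move=> a /andP[]; clear; lia.
- by move=> a an a5; rewrite !ifF ?s2' //; move: a5; clear; lia.
Qed.

End Epilogue.

Section Whole.
Variables (n : nat) (Ms : 'I_n -> 'M[R]_2) (w y : 'cV[R]_2).

Definition input := rmem (input_state Ms w y).
Definition init_st := St (fun id i => if (id == 0) && (i == 0) then n else 0) (fun _ _ => 0%R).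

Lemma input_out a : 4 * n + 4 <= a -> input a = 0%R.
Proof.
move=> h; rewrite /input /=; case: insubP => [i|_]; first by rewrite ltn_divLR //; lia.
by rewrite !ifF //; lia.
Qed.

Lemma prelude_ok : exists m, exec ((input_state Ms w y).(nmem), input) prelude = m /\ rel n input init_st m.
Proof.
eexists; split=> //; split=> //=.
- move=> id i hid; rewrite !upd_neq; try by [move: hid; clear; lia].
  by case: id i hid => [|id] [|i] hid //=; rewrite ifF //; clear; lia.
- by move=> id i _; rewrite input_out // /base; lia.
- by rewrite /upd /= /base; lia.
Qed.

Theorem whole_correct c t s : wf c -> ev n input c init_st t s -> nv s 0 0 = n ->
  exists s', run (whole c) (t + 6 * n + 100) (input_state Ms w y) = Some s' /\ forall i, i < n -> nmem s' i.+1 = nv s OUT (n + i).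
Proof.
move=> wfc hev hn; set P := whole c.
have hP : code_at P 0 (prelude ++ comp 4 c ++ epi_setup ++
    epi_loop (4 + csize c + size epi_setup) ++ epi_tail) by [].
have [h1 /code_at_cat[h2 /code_at_cat[h3 /code_at_cat[h4 h5]]]] := code_at_cat hP.
rewrite size_comp in h3 h4 h5.
have [m0 [e0 r0]] := prelude_ok.
have E0 := @exec_msteps P 0 prelude ((input_state Ms w y).(nmem), input) isT h1.
rewrite e0 in E0.
have [m1 [E1 r1]] := comp_correct hev wfc h2 r0.
have A0 : m1.1 0 = n by have := rel_n r1 (id := 0) 0 isT; rewrite hn.
case: m1 E1 r1 A0 => N M E1 r1 A0.
have [N1 e2 i1] := @setup_ok n N M N (fun=> erefl) A0.
have E2 := @exec_msteps P _ epi_setup (N, M) isT h3; rewrite e2 in E2.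
have [t3 [N2 [d [ht E3 [d5 dn] dp i2]]]] := @epi_loop_ok n N P M _ n N1 h4 (leqnn n) i1 id.
have E4 := @exec_msteps P _ epi_tail (N2, M) isT h5.
have E := msteps_trans (msteps_trans (msteps_trans (msteps_trans E0 E1) E2) E3) E4.
have hs : step P (at_pc (0 + size prelude + csize c + size epi_setup + 7 + size epi_tail)
    (exec (N2, M) epi_tail)) = None.
  rewrite /step nth_default // /P /whole !size_cat size_comp /=; lia.
exists (at_pc (0 + size prelude + csize c + size epi_setup + 7 + size epi_tail)
    (exec (N2, M) epi_tail)); split.
  by apply: run_msteps E hs _; rewrite /=; lia.
move=> i lt; have n0 : 0 < n by lia.
have d05 : 0 < d <= 5 by rewrite dp.
have [N3 -> h] := @tail_ok n N M d N2 d05 dn i2.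
rewrite /= h ?lt //; exact: (rel_n r1 (n + i) (isT : OUT < 32)).
Qed.

End Whole.

(** * Loop rules *)

Section WP.
Variables (n : nat) (inp : nat -> R).

Definition wp c s t (Q : st -> Prop) :=
  exists t' s', [/\ t' <= t, ev n inp c s t' s' & Q s'].

Lemma wp_weak c s t t' (Q Q' : st -> Prop) : wp c s t Q -> t <= t' ->
  (forall s', Q s' -> Q' s') -> wp c s t' Q'.
Proof.
move=> [t1 [s1 [h1 h2 h3]]] h h'; exists t1, s1; split=> //; last exact: h'.
exact: leq_trans h1 h.
Qed.

Lemma wp_le c s t t' Q : wp c s t Q -> t <= t' -> wp c s t' Q.
Proof. by move=> h le; apply: wp_weak h le _. Qed.

Lemma wp_seq a b s t1 t2 Q : wp a s t1 (fun s1 => wp b s1 t2 Q) ->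
  wp (Seq a b) s (t1 + t2) Q.
Proof.
move=> [t [s1 [h1 h2 [t' [s2 [h3 h4 h5]]]]]]; exists (t + t'), s2; split=> //.
  exact: leq_add.
exact: ev_seq h2 h4.
Qed.

Fixpoint loopfree c := match c with
  | NSet _ _ _ | RSet _ _ _ => true
  | Seq a b => loopfree a && loopfree b
  | If _ a b => loopfree a && loopfree b
  | While _ _ _ => false end.

(** Symbolic execution: blocks without loops are verified by computing their final state. *)
Fixpoint sx c s : st := match c with
  | NSet id i e => setn s id (neval s i) (neval s e)
  | RSet id i e => setr s id (neval s i) (reval inp s e)
  | Seq a b => sx b (sx a s)
  | If b c1 c2 => if ceval inp s b then sx c1 s else sx c2 s
  | While _ _ _ => s end.

Fixpoint okc c s : bool := match c with
  | NSet _ _ _ => true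
  | RSet _ _ e => rok n s e
  | Seq a b => okc a s && okc b (sx a s)
  | If b c1 c2 => cok n s b && (if ceval inp s b then okc c1 s else okc c2 s)
  | While _ _ _ => false end.

End WP.

(** A time bound for loop-free commands, where both branches are simply added. A loop counts as one
    test and one body; on programs with loops [tm] only serves as a constant factor. *)
Fixpoint tm c : nat := match c with
  | NSet id i e => size (cnset id i e)
  | RSet id i e => size (crset id i e)
  | Seq a b => tm a + tm b
  | If b c1 c2 => size (ccond b).1 + 1 + (tm c1 + tm c2) + 1
  | While a b c => size (ccond (NLess a b)).1 + 2 + tm c end.

Section WP2.
Variables (n : nat) (inp : nat -> R).

Lemma wp_sx c s (Q : st -> Prop) : loopfree c -> okc n inp c s -> Q (sx inp c s) ->
  wp n inp c s (tm c) Q.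
Proof.
move=> lf ok q; suff [t ht hev] : exists2 t, t <= tm c & ev n inp c s t (sx inp c s).
  by exists t, (sx inp c s).
elim: c s lf ok {Q q} => //= [id i e|id i e|a IHa b IHb|b c1 IH1 c2 IH2] s.
- by move=> _ _; exists (size (cnset id i e)) => //; exact: ev_nset.
- by move=> _ ok; exists (size (crset id i e)) => //; exact: ev_rset.
- move=> /andP[la lb] /andP[oa ob].
  have [t1 h1 e1] := IHa s la oa; have [t2 h2 e2] := IHb _ lb ob.
  by exists (t1 + t2); [exact: leq_add | exact: ev_seq e1 e2].
- move=> /andP[l1 l2] /andP[ob]; case: ifP => hb ok.
    have [t h e] := IH1 s l1 ok; exists (size (ccond b).1 + 1 + t); last exact: ev_ift.
    by move: h; clear; lia.
  have [t h e] := IH2 s l2 ok; exists (size (ccond b).1 + 1 + t + 1).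
    by move: h; clear; lia.
  by apply: ev_iff => //; rewrite hb.
Qed.

(** [I i] is the invariant after i rounds; the additional round in the bound pays for the failing
    test. *)
Lemma wp_for (I : nat -> st -> Prop) m a b c s K (Q : st -> Prop) :
  I 0 s ->
  (forall i s, i < m -> I i s -> neval s a < neval s b /\ wp n inp c s K (I i.+1)) ->
  (forall s, I m s -> ~~ (neval s a < neval s b) /\ Q s) ->
  wp n inp (While a b c) s (m.+1 * (K + (size (ccond (NLess a b)).1 + 2))) Q.
Proof.
move=> h0 hstep hend.
suff h k s' : k <= m -> I (m - k) s' ->
    wp n inp (While a b c) s' (k.+1 * (K + (size (ccond (NLess a b)).1 + 2))) Q.
  by apply: h => //; rewrite subnn.
elim: k s' => [|k IH] s' km hI.
  rewrite subn0 in hI; have [h q] := hend _ hI.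
  exists (size (ccond (NLess a b)).1 + 2), s'; split=> //; last exact: ev_while0.
  by rewrite mul1n leq_addl.
have lt : m - k.+1 < m by move: km; clear; lia.
have [h [t [s1 [ht e1 I1]]]] := hstep _ _ lt hI.
rewrite subnSK // in I1.
have [t' [s2 [ht' e2 q]]] := IH s1 (ltnW km) I1.
exists (size (ccond (NLess a b)).1 + 1 + t + 1 + t'), s2; split=> //.
  by rewrite mulSn; move: ht ht'; clear; lia.
exact: ev_whileS e1 e2.
Qed.

Lemma wp_seq2 a b s t1 t2 (P Q : st -> Prop) : wp n inp a s t1 P ->
  (forall s1, P s1 -> wp n inp b s1 t2 Q) -> wp n inp (Seq a b) s (t1 + t2) Q.
Proof.
by move=> h1 h2; apply: wp_seq; apply: wp_weak h1 (leqnn _) _.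
Qed.

Lemma wp_if b c1 c2 s t1 t2 (Q : st -> Prop) : cok n s b ->
  (ceval inp s b -> wp n inp c1 s t1 Q) -> (~~ ceval inp s b -> wp n inp c2 s t2 Q) ->
  wp n inp (If b c1 c2) s (size (ccond b).1 + 1 + (t1 + t2) + 1) Q.
Proof.
move=> ok; case: (boolP (ceval inp s b)) => hb h1 h2.
  have [t [s' [ht e q]]] := h1 isT.
  exists (size (ccond b).1 + 1 + t), s'; split=> //; last exact: ev_ift.
  by move: ht; clear; lia.
have [t [s' [ht e q]]] := h2 isT.
exists (size (ccond b).1 + 1 + t + 1), s'; split=> //; last exact: ev_iff.
by move: ht; clear; lia.
Qed.

End WP2.

Lemma eqbE (a b : nat) : Nat.eqb a b = (a == b).
Proof. by lia. Qed.

Notation "'V' x" := (Get x (Cst 0)) (at level 9, x at level 0).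
Notation "'RV' x" := (RGet x (Cst 0)) (at level 9, x at level 0).
Notation "x ::= e" := (NSet x (Cst 0) e) (at level 75).
Notation "x ::=r e" := (RSet x (Cst 0) e) (at level 75).
Notation "a ;; b" := (Seq a b) (at level 76, right associativity).
(** The language has no skip; a write to the real array 31, which is never read, replaces it. *)
Definition NOP := 31 ::=r RC0.

(** * Computing the triangular form *)

Definition radd := ROp OAdd.
Definition rsub := ROp OSub.
Definition rmul := ROp OMul.
Definition rdiv := ROp ODiv.
Definition rsq e := rmul e e.
Definition nincr x := x ::= Plus (V x) (Cst 1).

(* Integer variables: 1 pivot, 2 loop index. Real variables: 0 and 1 the common
   eigenvector, 15, 16 and 17 the entries of a commutator. *)
Definition pivE e := RInp e (V 1).
Definition curE e := RInp e (V 2).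
Definition eigen_body :=
  If (RLess RC0 (radd (rsq (rsub (pivE 0) (pivE 3))) (radd (rsq (pivE 1)) (rsq (pivE 2)))))
     NOP (1 ::= V 2) ;;
  17 ::=r rsub (radd (rmul (pivE 2) (curE 0)) (rmul (pivE 3) (curE 2)))
               (radd (rmul (curE 2) (pivE 0)) (rmul (curE 3) (pivE 2))) ;;
  15 ::=r rsub (rmul (pivE 1) (curE 2)) (rmul (curE 1) (pivE 2)) ;;
  16 ::=r rsub (radd (rmul (pivE 0) (curE 1)) (rmul (pivE 1) (curE 3)))
               (radd (rmul (curE 0) (pivE 1)) (rmul (curE 1) (pivE 3))) ;;
  If (RLess RC0 (rsq (RV 17))) (0 ::=r RV 15 ;; 1 ::=r RV 17)
    (If (RLess RC0 (rsq (RV 16))) (0 ::=r RV 16 ;; 1 ::=r RC0) NOP) ;;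
  nincr 2.
Definition eigen_prog := 2 ::= Cst 0 ;; 1 ::= Cst 0 ;; 0 ::=r RC0 ;; 1 ::=r RC0 ;;
  While (V 2) (V 0) eigen_body.

Section Eigen.
Variables (n : nat) (inp : nat -> R).

Definition m_ i e := inp (4 * i + e).
Definition nonscalar i : bool :=
  (0 < (m_ i 0 - m_ i 3) * (m_ i 0 - m_ i 3) + (m_ i 1 * m_ i 1 + m_ i 2 * m_ i 2))%R.
Definition comm21 p i :=
  (m_ p 2 * m_ i 0 + m_ p 3 * m_ i 2 - (m_ i 2 * m_ p 0 + m_ i 3 * m_ p 2))%R.
Definition comm11 p i := (m_ p 1 * m_ i 2 - m_ i 1 * m_ p 2)%R.
Definition comm12 p i :=
  (m_ p 0 * m_ i 1 + m_ p 1 * m_ i 3 - (m_ i 0 * m_ p 1 + m_ i 1 * m_ p 3))%R.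

(** The commutator kills the common eigenvector and has trace 0. If its lower left entry is not 0,
    the first column is taken; otherwise its diagonal vanishes and the second column is
    [(comm12, 0)]. Squares serve to test for 0 by a single comparison. *)
Definition eigen_step (z : nat * (R * R)) i :=
  let p := if nonscalar z.1 then z.1 else i in
  (p, if (0 < comm21 p i * comm21 p i)%R then (comm11 p i, comm21 p i)
      else if (0 < comm12 p i * comm12 p i)%R then (comm12 p i, 0%R) else z.2).
Definition eigen_iter i := foldl eigen_step (0, (0%R, 0%R)) (iota 0 i).
Definition eigen_vec := (eigen_iter n).2.

Lemma eigen_iterS i : eigen_iter i.+1 = eigen_step (eigen_iter i) i.
Proof. by rewrite /eigen_iter -addn1 iotaD foldl_cat. Qed.

Lemma eigen_piv_le i : (eigen_iter i).1 <= i.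
Proof.
elim: i => // i IH; rewrite eigen_iterS /=.
by case: ifP => _ //; exact: leq_trans IH (leqnSn _).
Qed.

Lemma eigen_prog_ok s : nv s 0 0 = n ->
  wp n inp eigen_prog s ((tm eigen_prog + tm eigen_body) * n.+1) (fun s' =>
    [/\ nv s' 0 0 = n, rv s' 0 0 = eigen_vec.1 & rv s' 1 0 = eigen_vec.2]).
Proof.
move=> hn; pose I i s' := [/\ nv s' 0 0 = n, nv s' 2 0 = i, nv s' 1 0 = (eigen_iter i).1,
  rv s' 0 0 = (eigen_iter i).2.1 & rv s' 1 0 = (eigen_iter i).2.2].
apply: wp_le.
- do 4![apply: wp_seq; apply: wp_sx => //=].
  apply: (@wp_for _ _ I n _ _ _ _ (tm eigen_body)) => //.
  - move=> i s' lt [h0 h2 h1 hx hy]; split; first by rewrite /= h0 h2.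
    have hp := eigen_piv_le i.
    set p := (eigen_step (eigen_iter i) i).1.
    have hpn : p <= n by rewrite /p -eigen_iterS; apply: leq_trans (eigen_piv_le _) lt.
    apply: (@wp_seq2 _ _ _ _ _ _ _ (fun s1 => [/\ nv s1 0 0 = n, nv s1 2 0 = i, nv s1 1 0 = p
       & forall a, a < 2 -> rv s1 a = rv s' a])).
      apply: wp_sx => //; first by rewrite /= h1 (leq_trans hp (ltnW lt)) /=; case: ifP.
      rewrite /= h1 h2 -/(nonscalar _) /p /eigen_step /=.
      by case: ifP => _ /=; split=> //; case=> [|[|]].
    move=> s1 [k0 k2 k1 kr].
    do 3![apply: wp_seq; apply: wp_sx => //=; first by rewrite k1 k2 hpn (ltnW lt)].
    rewrite k1 k2.
    apply: (@wp_seq2 _ _ _ _ _ _ _ (fun s2 => [/\ nv s2 0 0 = n, nv s2 2 0 = i, nv s2 1 0 = p,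
       rv s2 0 0 = (eigen_iter i.+1).2.1 & rv s2 1 0 = (eigen_iter i.+1).2.2])).
      apply: wp_sx => //; first by rewrite /=; do 2?case: ifP.
      rewrite /= -/(comm21 p i) -/(comm12 p i) -/(comm11 p i) eigen_iterS /eigen_step -/p /=.
      by case: ifP => _ //=; case: ifP => _ //=; rewrite !kr.
    move=> s2 [j0 j2 j1 jx jy]; apply: wp_sx => //.
    by split=> //=; rewrite ?j2 ?addn1 // eigen_iterS.
  - by move=> s' [h0 h2 h1 hx hy]; rewrite /= h0 h2 ltnn -/eigen_vec; split.
- rewrite /eigen_prog /=; move: (tm eigen_body) => *; nia.
Qed.
End Eigen.

(* Real variables: 2 the coefficient of the objective; arrays 3, 4 and 5 hold
   the entries of the triangular matrices. *)
Definition idxE a := RGet a (V 2).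
Definition flip_sign :=
  RSet 3 (V 2) (rsub RC0 (idxE 3)) ;; RSet 4 (V 2) (rsub RC0 (idxE 4)) ;;
  RSet 5 (V 2) (rsub RC0 (idxE 5)) ;; 2 ::=r rsub RC0 (RV 2).
Definition tri_body :=
  18 ::=r radd (rmul (curE 0) (RV 0)) (rmul (curE 1) (RV 1)) ;;
  19 ::=r radd (rmul (curE 2) (RV 0)) (rmul (curE 3) (RV 1)) ;;
  RSet 3 (V 2) (radd (rmul (RV 0) (RV 18)) (rmul (RV 1) (RV 19))) ;;
  18 ::=r rsub (rmul (curE 1) (RV 0)) (rmul (curE 0) (RV 1)) ;;
  19 ::=r rsub (rmul (curE 3) (RV 0)) (rmul (curE 2) (RV 1)) ;;
  RSet 4 (V 2) (radd (rmul (RV 0) (RV 18)) (rmul (RV 1) (RV 19))) ;;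
  RSet 5 (V 2) (rsub (rmul (RV 0) (RV 19)) (rmul (RV 1) (RV 18))) ;;
  If (RLess (idxE 5) RC0) flip_sign
    (If (RLess RC0 (idxE 5)) NOP (If (RLess (idxE 3) RC0) flip_sign NOP)) ;;
  nincr 2.
Definition lastE e := RInp e (V 0).
Definition tri_prog :=
  2 ::=r rmul (radd (rmul (lastE 0) (RV 0)) (rmul (lastE 1) (RV 1)))
              (rsub (rmul (lastE 3) (RV 0)) (rmul (lastE 2) (RV 1))) ;;
  2 ::= Cst 0 ;; While (V 2) (V 0) tri_body.

Section Tri.
Variables (n : nat) (inp : nat -> R) (v : R * R).

(** With u the quarter turn of v, these are the inner products of v with Mv, of v with Mu and of u
    with Mu: the coordinates of M in the basis v, u, multiplied by the squared length of v. *)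
Definition tri_raw i : tri R :=
  Tri (v.1 * (m_ inp i 0 * v.1 + m_ inp i 1 * v.2) + v.2 * (m_ inp i 2 * v.1 + m_ inp i 3 * v.2))%R
      (v.1 * (m_ inp i 1 * v.1 - m_ inp i 0 * v.2) + v.2 * (m_ inp i 3 * v.1 - m_ inp i 2 * v.2))%R
      (v.1 * (m_ inp i 3 * v.1 - m_ inp i 2 * v.2) - v.2 * (m_ inp i 1 * v.1 - m_ inp i 0 * v.2))%R.

Definition topp (M : tri R) : tri R := Tri (0 - ta M)%R (0 - tb M)%R (0 - td M)%R.
(** The second clause makes [ta] nonnegative when [td] is 0, so that singular matrices count as
    positive. *)
Definition flipped i :=
  (td (tri_raw i) < 0)%R || (~~ (0 < td (tri_raw i))%R && (ta (tri_raw i) < 0)%R).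
Definition tri_pos i := if flipped i then topp (tri_raw i) else tri_raw i.

(** Block n of the input holds w and y. This is the inner product of w with v times that of y with
    u. *)
Definition coef0 : R :=
  ((m_ inp n 0 * v.1 + m_ inp n 1 * v.2) * (m_ inp n 3 * v.1 - m_ inp n 2 * v.2))%R.
Definition coef_step (c : R) i := if flipped i then (0 - c)%R else c.
Definition coef_iter i := foldl coef_step coef0 (iota 0 i).

Lemma coef_iterS i : coef_iter i.+1 = coef_step (coef_iter i) i.
Proof. by rewrite /coef_iter -addn1 iotaD foldl_cat. Qed.

Definition holds_tri s i (M : tri R) := [/\ rv s 3 i = ta M, rv s 4 i = tb M & rv s 5 i = td M].

Lemma tri_prog_ok s : nv s 0 0 = n -> rv s 0 0 = v.1 -> rv s 1 0 = v.2 ->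
  wp n inp tri_prog s ((tm tri_prog + tm tri_body) * n.+1) (fun s' =>
    [/\ nv s' 0 0 = n, rv s' 2 0 = coef_iter n & forall i, i < n -> holds_tri s' i (tri_pos i)]).
Proof.
move=> hn hx hy; pose I i s' := [/\ nv s' 0 0 = n /\ nv s' 2 0 = i, rv s' 0 0 = v.1,
  rv s' 1 0 = v.2, rv s' 2 0 = coef_iter i & forall j, j < i -> holds_tri s' j (tri_pos j)].
apply: wp_le.
- apply: wp_seq; apply: wp_sx => //=; first by rewrite hn leqnn.
  apply: wp_seq; apply: wp_sx => //=.
  apply: (@wp_for _ _ I n _ _ _ _ (tm tri_body)).
  + by split=> //=; rewrite hn hx hy.
  + move=> i s' lt [[h0 h2] k0 k1 k2 hI]; split; first by rewrite /= h0 h2.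
    do 7![apply: wp_seq; apply: wp_sx => //=; try by rewrite h2 (ltnW lt)].
    set S := (X in wp _ _ _ X _ _).
    have S0 : nv S = nv s' by [].
    have Sr a : a < 3 -> rv S a 0 = rv s' a 0 by case: a => [|[|[|]]].
    have SI : holds_tri S i (tri_raw i).
      by rewrite /holds_tri /S /= h2 k0 k1 eqbE eqxx.
    have SJ j : j < i -> holds_tri S j (tri_pos j).
      move=> ji; rewrite /holds_tri /S /= h2 !eqbE (ltn_eqF ji); exact: hI.
    move: S S0 Sr SI SJ => S S0 Sr SI SJ.
    apply: (@wp_seq2 _ _ _ _ _ _ _ (fun s1 => [/\ nv s1 0 0 = n /\ nv s1 2 0 = i, rv s1 0 0 = v.1,
       rv s1 1 0 = v.2, rv s1 2 0 = coef_iter i.+1 & forall j, j <= i -> holds_tri s1 j (tri_pos j)])).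
      apply: wp_sx => //; first by rewrite /=; do 3?case: ifP.
      have [e3 e4 e5] := SI; have hb := coef_iterS i; rewrite /coef_step /flipped in hb.
      have SJ' j : j <= i -> j != i -> holds_tri S j (tri_pos j).
        by move=> h1 h2'; apply: SJ; rewrite ltn_neqAle h2'.
      rewrite /= S0 h2 e5 e3; rewrite /tri_pos /flipped in SJ' *.
      case: (ltrP (td (tri_raw i)) 0) hb => c1 hb /=; [|case: (ltrP 0 (td (tri_raw i))) hb => c2 hb /=;
        [|case: (ltrP (ta (tri_raw i)) 0) hb => c3 hb /=]]; (split=> /=;
        [by rewrite S0 | by rewrite Sr | by rewrite Sr | by rewrite ?Sr // hb ?k2 |
         move=> j ji]); rewrite /holds_tri /= ?S0 ?h2 ?eqbE; (case: (eqVneq j i) => [->|ne]; last exact: SJ');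
        rewrite ?c1 ?c2 ?c3 ?(le_gtF c1) ?(le_gtF c2) ?(le_gtF c3) /= ?e3 ?e4 ?e5 //.
    move=> s1 [[j0 j2] jx jy jc jI]; apply: wp_sx => //.
    by split=> //=; rewrite j2 addn1.
  + by move=> s' [[h0 h2] k0 k1 k2 hI]; rewrite /= h0 h2 ltnn; split.
- rewrite /tri_prog /=; move: (tm tri_body) => *; nia.
Qed.
End Tri.

(* Integer variables: 4 and 5 the lengths of the arrays 7 and 6, which list the
   matrices with nonnegative and with negative determinant. Real array 6 holds
   the pseudo-angles. *)
Definition key_body :=
  If (RLess (RV 2) RC0) (RSet 4 (V 2) (rsub RC0 (idxE 4))) NOP ;;
  18 ::=r rsub (idxE 3) (idxE 5) ;;
  If (RLess (RV 18) RC0) (20 ::=r rsub RC0 (RV 18)) (20 ::=r RV 18) ;;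
  If (RLess (idxE 4) RC0)
    (7 ::=r rsub RC0 (idxE 4) ;;
     RSet 6 (V 2) (radd (radd RC1 (radd RC1 RC1)) (rdiv (RV 18) (radd (RV 20) (RV 7)))))
    (RSet 6 (V 2) (rsub RC1 (rdiv (RV 18) (radd (RV 20) (idxE 4))))) ;;
  If (RLess (idxE 3) RC0) (NSet 6 (V 5) (V 2) ;; nincr 5) (NSet 7 (V 4) (V 2) ;; nincr 4) ;;
  nincr 2.
Definition key_prog := 4 ::= Cst 0 ;; 5 ::= Cst 0 ;; 2 ::= Cst 0 ;; While (V 2) (V 0) key_body.

Definition holds_arr s id (l : seq nat) := forall t, t < size l -> nv s id t = nth 0 l t.

Lemma holds_arr_rcons s s' id l x : holds_arr s id l -> nv s' id (size l) = x ->
  (forall t, t < size l -> nv s' id t = nv s id t) -> holds_arr s' id (rcons l x).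
Proof.
move=> h hx hs t; rewrite size_rcons ltnS nth_rcons leq_eqVlt => /predU1P[->|lt].
  by rewrite ltnn eqxx.
by rewrite lt hs ?h.
Qed.

Section Key.
Variables (n : nat) (inp : nat -> R) (c : R) (g : nat -> tri R).

(** Conjugation by diag(1, -1) negates the upper right entry of every product and thereby turns
    maximization into minimization. *)
Definition tri_fin i : tri R :=
  if (c < 0)%R then Tri (ta (g i)) (0 - tb (g i))%R (td (g i)) else g i.
Definition isneg i := (ta (tri_fin i) < 0)%R.
Definition negs i := [seq j <- iota 0 i | isneg j].
Definition poss i := [seq j <- iota 0 i | ~~ isneg j].

Lemma negsS i : negs i.+1 = if isneg i then rcons (negs i) i else negs i.
Proof.
rewrite /negs -addn1 iotaD filter_cat /= add0n; case: (isneg i); last by rewrite cats0.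
by rewrite cats1.
Qed.

Lemma possS i : poss i.+1 = if isneg i then poss i else rcons (poss i) i.
Proof.
rewrite /poss -addn1 iotaD filter_cat /= add0n; case: (isneg i); first by rewrite cats0.
by rewrite cats1.
Qed.

Definition holds_fin s i := holds_tri s i (tri_fin i) /\ rv s 6 i = pseudo_angle (tri_fin i).

Record ready (i : nat) (s : st) : Prop := Ready {
  rd_n : nv s 0 0 = n;
  rd_m : nv s 4 0 = size (poss i); rd_k : nv s 5 0 = size (negs i);
  rd_neg : holds_arr s 6 (negs i); rd_pos : holds_arr s 7 (poss i);
  rd_tri : forall j, j < i -> holds_fin s j }.

Lemma key_prog_ok s : nv s 0 0 = n -> rv s 2 0 = c -> (forall i, i < n -> holds_tri s i (g i)) ->
  wp n inp key_prog s ((tm key_prog + tm key_body) * n.+1) (ready n).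
Proof.
move=> hn hc hg; pose I i s' := [/\ ready i s', nv s' 2 0 = i, rv s' 2 0 = c &
  forall j, i <= j -> j < n -> holds_tri s' j (g j)].
apply: wp_le.
- do 3![apply: wp_seq; apply: wp_sx => //=].
  apply: (@wp_for _ _ I n _ _ _ _ (tm key_body)).
  + by split=> //= j _ /hg.
  + move=> i s' lt [[h0 hm hk hneg hpos htri] h2 kc hI]; split; first by rewrite /= h0 h2.
    have [g3 g4 g5] := hI i (leqnn i) lt.
    apply: (@wp_seq2 _ _ _ _ _ _ _ (fun s1 => nv s1 = nv s' /\ [/\ rv s1 2 0 = c,
        holds_tri s1 i (tri_fin i), forall j, i < j -> j < n -> holds_tri s1 j (g j) &
        forall j, j < i -> holds_fin s1 j])).
      apply: wp_sx => //; first by rewrite /=; case: ifP.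
      rewrite /= kc /tri_fin.
      have ne j : (i < j) || (j < i) -> (j == i) = false by lia.
      case: ifP => c0 /=; (split; first by []); split=> //.
      * by rewrite /holds_tri /= h2 g3 g4 g5 eqbE eqxx.
      * move=> j ij jn; rewrite /holds_tri /= h2 eqbE ne ?ij //.
        by apply: hI => //; exact: ltnW.
      * move=> j ji; rewrite /holds_fin /holds_tri /= h2 eqbE ne ?ji ?orbT //.
        by have := htri j ji.
      * by move=> j ij jn; apply: hI => //; exact: ltnW.
    move=> s1 [n1 [c1 [e3 e4 e5] hI1 htri1]].
    apply: wp_seq; apply: wp_sx => //=; rewrite n1 h2 e3 e5 -/(tx (tri_fin i)).
    apply: (@wp_seq2 _ _ _ _ _ _ _ (fun s2 => nv s2 = nv s' /\ [/\ rv s2 18 0 = tx (tri_fin i),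
       rv s2 20 0 = `|tx (tri_fin i)|%R & forall a, a < 7 -> rv s2 a = rv s1 a])).
      apply: wp_sx => //; first by rewrite /=; case: ifP.
      rewrite /=; case: ltrP => cx /=; split=> //; split=> //=.
      * by rewrite ltr0_norm // sub0r.
      * by case=> [|[|[|[|[|[|[|]]]]]]].
      * by rewrite ger0_norm.
      * by case=> [|[|[|[|[|[|[|]]]]]]].
    move=> s2 [n2 [e18 e20 r2]].
    apply: (@wp_seq2 _ _ _ _ _ _ _ (fun s3 => nv s3 = nv s' /\ [/\ rv s3 6 i = pseudo_angle (tri_fin i),
        forall a, a < 6 -> rv s3 a = rv s1 a & forall j, j != i -> rv s3 6 j = rv s1 6 j])).
      apply: wp_sx => //; first by rewrite /=; case: ifP.
      rewrite /= n2 h2 e18 e20 !r2 // e4 /pseudo_angle.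
      case: ltrP => cy /=; split=> //; split=> //=.
      * rewrite ?n2 ?h2 eqbE eqxx /= (ltr0_norm cy) sub0r; congr (_ + _)%R.
      * case=> [|[|[|[|[|[|]]]]]] // _; rewrite /= ?n2 ?h2 ?r2 //.
      * by move=> j ne; rewrite ?n2 ?h2 eqbE (negPf ne) r2.
      * by rewrite ?n2 ?h2 eqbE eqxx (ger0_norm cy).
      * case=> [|[|[|[|[|[|]]]]]] // _; rewrite /= ?r2 //.
      * by move=> j ne; rewrite ?n2 ?h2 eqbE (negPf ne) r2.
    move=> s3 [n3 [e6 r3 r6]].
    have fin3 j : j <= i -> holds_fin s3 j.
      rewrite leq_eqVlt => /predU1P[->|lj].
        by split=> //; rewrite /holds_tri !r3.
      have [t1 t2] := htri1 j lj; split; first by rewrite /holds_tri !r3.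
      by rewrite r6 // ltn_eqF.
    have I3 j : i < j -> j < n -> holds_tri s3 j (g j).
      by move=> h1' h2'; have := hI1 j h1' h2'; rewrite /holds_tri !r3.
    apply: (@wp_seq2 _ _ _ _ _ _ _ (fun s4 => [/\ ready i.+1 s4, nv s4 2 0 = i & rv s4 = rv s3])).
      apply: wp_sx => //; first by rewrite /=; case: ifP.
      rewrite /= n3 h2 r3 // e3; have hp := possS i; have hq := negsS i.
      move: hp hq; rewrite /isneg; case: ifP => cn hp hq /=; split=> //=; rewrite ?n3 //.
      * split=> /=; rewrite ?n3 ?hp ?hq ?size_rcons ?hk ?addn1 //.
        - apply: (holds_arr_rcons hneg) => [|t lt'] /=; rewrite eqbE ?eqxx //.
          by rewrite (ltn_eqF lt') n3.
        - by move=> t /hpos <- /=; rewrite ?n3.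
      * split=> /=; rewrite ?n3 ?hp ?hq ?size_rcons ?hm ?addn1 //.
        - by move=> t /hneg <- /=; rewrite ?n3.
        - apply: (holds_arr_rcons hpos) => [|t lt'] /=; rewrite eqbE ?eqxx //.
          by rewrite (ltn_eqF lt') n3.
    move=> s4 [[a0 am ak aneg apos atri] a2 ar]; apply: wp_sx => //.
    split=> //=; rewrite ?a2 ?addn1 //.
    * by rewrite ar r3.
    * by move=> j h1' h2'; rewrite /holds_tri /= ar; apply: I3.
  + by move=> s' [hr h2 _ _]; rewrite /= (rd_n hr) h2 ltnn.
- rewrite /key_prog /=; move: (tm key_body) => *; nia.
Qed.
End Key.

(** * Merge sort *)

(* Integer variables: 9 the block length, 10 the output position, 14 and 15 the
   input positions, 11 and 12 the ends of the two input blocks. *)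
Definition keyE i := RGet 6 (Get 7 (V i)).
Definition min_with x := If (NLess (V 4) (V x)) (x ::= V 4) NOP.
Definition new_block :=
  14 ::= V 10 ;; 11 ::= Plus (V 10) (V 9) ;; min_with 11 ;; 15 ::= V 11 ;;
  12 ::= Plus (Plus (V 10) (V 9)) (V 9) ;; min_with 12.
Definition take_from x := 13 ::= V x ;; nincr x.
Definition choose := If (NLess (V 14) (V 11))
  (If (NLess (V 15) (V 12)) (If (RLess (keyE 15) (keyE 14)) (take_from 15) (take_from 14))
    (take_from 14)) (take_from 15).
Definition merge_body := If (NLess (V 10) (V 12)) NOP new_block ;; choose ;;
  NSet 8 (V 10) (Get 7 (V 13)) ;; nincr 10.
Definition copy_body := NSet 7 (V 2) (Get 8 (V 2)) ;; nincr 2.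
Definition pass_prog := 10 ::= Cst 0 ;; 12 ::= Cst 0 ;; While (V 10) (V 4) merge_body ;;
  2 ::= Cst 0 ;; While (V 2) (V 4) copy_body.
Definition sort_body := pass_prog ;; 9 ::= Plus (V 9) (V 9).
Definition sort_prog := 9 ::= Cst 1 ;; While (V 9) (V 4) sort_body.

Section Sort.
Variables (n : nat) (inp : nat -> R) (key : nat -> R).
Implicit Types (l t : seq nat) (s : st).

Definition slice a b l := take (b - a) (drop a l).

Lemma slice_cons a b l : a < b -> b <= size l -> slice a b l = nth 0 l a :: slice a.+1 b l.
Proof.
move=> ab bl; rewrite /slice (drop_nth 0) ?(leq_trans ab bl) //.
by rewrite -(subnSK ab).
Qed.

Lemma slice_nil a l : slice a a l = [::].
Proof. by rewrite /slice subnn take0. Qed.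

Lemma slice_drop a b l : a <= b -> slice a b l ++ drop b l = drop a l.
Proof. by move=> ab; rewrite -[in drop b l](subnK ab) -drop_drop cat_take_drop. Qed.

Lemma slice_cat_all a b c l : a <= b -> b <= c ->
  slice a b l ++ slice b c l ++ drop c l = drop a l.
Proof. by move=> ab bc; rewrite !slice_drop. Qed.

Definition kle l a b := (key (nth 0 l a) <= key (nth 0 l b))%R.
Definition bsorted w l := forall c a b, c * w <= a -> a < b -> b < c.+1 * w -> b < size l -> kle l a b.

Definition keep s s' := [/\ nv s' 0 = nv s 0, nv s' 4 = nv s 4, nv s' 5 = nv s 5,
  nv s' 6 = nv s 6 & forall a, a < 31 -> rv s' a = rv s a].

Lemma nv_setn s id i v a : a != id -> nv (setn s id i v) a = nv s a.
Proof. by move=> h; rewrite /setn /=; have -> : Nat.eqb a id = false by rewrite eqbE (negPf h). Qed.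

Lemma rv_setr s id i v a : a != id -> rv (setr s id i v) a = rv s a.
Proof. by move=> h; rewrite /setr /=; have -> : Nat.eqb a id = false by rewrite eqbE (negPf h). Qed.

Lemma keep_setn s s' id i v : id \notin [:: 0; 4; 5; 6] -> keep s s' -> keep s (setn s' id i v).
Proof.
rewrite !inE !negb_or => /and4P[h0 h4 h5 h6] [a0 a4 a5 a6 ar].
by split=> //; rewrite nv_setn // eq_sym.
Qed.

Lemma keep_nop s s' v : keep s s' -> keep s (setr s' 31 0 v).
Proof.
move=> [a0 a4 a5 a6 ar]; split=> // a h; rewrite rv_setr ?ar //.
by rewrite ltn_eqF.
Qed.

Section Pass.
Variables (w : nat) (l : seq nat) (s0 : st).
Hypothesis (w0 : 0 < w) (bs : bsorted w l).
Hypothesis (hkey : forall x, x \in l -> rv s0 6 x = key x).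
Let m := size l.
Hypothesis (hm : nv s0 4 0 = m).

(** The output of the current block stays below the unread inputs, so that any of these may be
    appended without breaking the order. *)
Definition dominated t lo p a b := forall u v, lo <= u < p -> a <= v < b ->
  (key (nth 0 t u) <= key (nth 0 l v))%R.

Record inblock (p hi : nat) t s : Prop := InBlock {
  ib_hi : nv s 12 0 = hi; ib_le : p < hi; ib_m : hi <= m;
  ib_ex : exists c mid i j, [/\ [/\ nv s 11 0 = mid, nv s 14 0 = i & nv s 15 0 = j],
    [/\ c * (w + w) <= i, i <= mid, mid <= j, j <= hi & hi <= c.+1 * (w + w)] /\ i + j = p + mid,
    (hi = m \/ hi = c.+1 * (w + w)) /\
    [/\ forall a b, c * (w + w) <= a -> a < b -> b < mid -> kle l a b &
     forall a b, mid <= a -> a < b -> b < hi -> kle l a b],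
    dominated t (c * (w + w)) p i mid /\ dominated t (c * (w + w)) p j hi &
    perm_eq (t ++ slice i mid l ++ slice j hi l ++ drop hi l) l] }.

Record common (p : nat) t s : Prop := Common {
  cm_keep : keep s0 s; cm_w : nv s 9 0 = w; cm_p : nv s 10 0 = p;
  cm_src : holds_arr s 7 l; cm_size : size t = p; cm_out : holds_arr s 8 t;
  cm_bs : bsorted (w + w) t }.

Record boundary (p : nat) t s : Prop := Boundary {
  bd_hi : nv s 12 0 = p; bd_le : p <= m; bd_c : p = m \/ exists c, p = c * (w + w);
  bd_perm : perm_eq (t ++ drop p l) l }.

(** A whole pass is one loop over the output positions; a new pair of blocks is opened whenever the
    position reaches the end of the previous pair. *)
Definition minv p s := exists t, common p t s /\ (boundary p t s \/ exists hi, inblock p hi t s).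

Lemma min_with_ok x s v : x \in [:: 11; 12] -> nv s 4 0 = m -> nv s x 0 = v ->
  wp n inp (min_with x) s (tm (min_with x)) (fun s' => exists r,
    s' = setr s 31 0 r /\ v <= m \/ s' = setn s x 0 m /\ m < v).
Proof.
move=> hx h4 hv; apply: wp_sx => //=; rewrite ?h4 ?hv; first by case: ifP.
by case: ltnP => h; exists 0%R; [right|left].
Qed.

Lemma new_block_ok p t s : common p t s -> boundary p t s -> p < m ->
  wp n inp new_block s (tm new_block) (fun s' => common p t s' /\ exists hi, inblock p hi t s').
Proof.
move=> [k1 k2 k3 k4 k5 k6 k7] [b1 b2 [bc|[c bc]] b4] pm; first by move: pm; rewrite bc ltnn.
have h4 : nv s 4 0 = m by case: k1 => _ -> _ _ _.
pose mid := if m < p + w then m else p + w.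
pose hi := if m < p + w + w then m else p + w + w.
have common_set s' x v : common p t s' -> x \in [:: 11; 12; 14; 15] -> common p t (setn s' x 0 v).
  move=> [j1 j2 j3 j4 j5 j6 j7] hx; split=> //.
  - by apply: keep_setn => //; move: hx; rewrite !inE => /or4P[]/eqP->.
  - by rewrite nv_setn //; move: hx; rewrite !inE => /or4P[]/eqP->.
  - by rewrite nv_setn //; move: hx; rewrite !inE => /or4P[]/eqP->.
  - by move=> u /j4; rewrite nv_setn //; move: hx; rewrite !inE => /or4P[]/eqP->.
  - by move=> u /j6; rewrite nv_setn //; move: hx; rewrite !inE => /or4P[]/eqP->.
have common_nop s' v : common p t s' -> common p t (setr s' 31 0 v).
  by move=> [j1 j2 j3 j4 j5 j6 j7]; split=> //; exact: keep_nop.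
pose P s' := common p t s' /\ nv s' 14 0 = p.
apply: (@wp_seq2 _ _ _ _ _ _ _ P).
  by apply: wp_sx => //=; rewrite k3; split=> //; apply: common_set.
move=> s1 [c1 e1]; apply: wp_seq; apply: wp_sx => //=.
rewrite (cm_p c1) (cm_w c1); set s2 := setn _ _ _ _.
have c2 : common p t s2 by exact: common_set.
have h42 : nv s2 4 0 = m by have [[_ -> _ _ _]] := c2.
apply: (@wp_seq2 _ _ _ _ _ _ _ (fun s' => [/\ common p t s', nv s' 14 0 = p & nv s' 11 0 = mid])).
  apply: wp_weak (@min_with_ok 11 s2 (p + w) isT h42 erefl) (leqnn _) _ => s' [r [[-> h]|[-> h]]].
    by split=> //; [exact: common_nop | rewrite /mid ltnNge h].
  by split=> //; [exact: common_set | rewrite /mid h].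
move=> s3 [c3 e3 f3]; do 2![apply: wp_seq; apply: wp_sx => //=].
rewrite f3 (cm_p c3) (cm_w c3); set s4 := setn _ _ _ _.
have c4 : common p t s4 by do 2![apply: (common_set) => //].
have h44 : nv s4 4 0 = m by have [[_ -> _ _ _]] := c4.
apply: wp_weak (@min_with_ok 12 s4 (p + w + w) isT h44 erefl) (leqnn _) _ => s' hs'.
have [c5 [h12 h14 h11 h15]] : common p t s' /\ [/\ nv s' 12 0 = hi, nv s' 14 0 = p,
    nv s' 11 0 = mid & nv s' 15 0 = mid].
  case: hs' => r [[-> h]|[-> h]].
    by split; [exact: common_nop | split=> //=; rewrite /hi ltnNge h].
  by split; [exact: common_set | split=> //=; rewrite /hi h].
split=> //; exists hi.
have [pmid midhi him] : [/\ p <= mid, mid <= hi & hi <= m].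
  by rewrite /mid /hi; move: pm; clear; case: (ltnP m (p + w)); case: (ltnP m (p + w + w)) => ? ? ?; split; lia.
have phi : p < hi by rewrite /hi; move: pm w0; clear; case: (ltnP m (p + w + w)); lia.
split=> //; exists c, mid, p, mid; split=> //.
- split=> //; split=> //; first by rewrite bc.
  by rewrite /hi bc; clear; rewrite mulSn; case: (ltnP m (c * (w + w) + w + w)); lia.
- split; first by rewrite /hi bc mulSn; clear; case: (ltnP m (c * (w + w) + w + w)); [left | right; lia].
  split=> a b.
  + move=> ha ab hb; apply: (bs (c := c + c)) => //.
    * by move: ha; clear; lia.
    * by move: hb; rewrite /mid bc; clear; rewrite mulSn; case: (ltnP m (c * (w + w) + w)); lia.
    * by apply: leq_trans hb _; exact: leq_trans midhi him.
  + move=> ha ab hb; apply: (bs (c := (c + c).+1)) => //.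
    * move: ha ab hb; rewrite /mid /hi bc; clear; rewrite mulSn.
      by case: (ltnP m (c * (w + w) + w)); case: (ltnP m (c * (w + w) + w + w)); lia.
    * by move: hb; rewrite /hi bc; clear; rewrite !mulSn; case: (ltnP m (c * (w + w) + w + w)); lia.
    * exact: leq_trans hb him.
- by split=> u v /andP[h1]; rewrite bc ltnNge h1.
- by rewrite slice_cat_all.
Qed.

Lemma choose_ok p hi t s mid i j : common p t s -> inblock p hi t s ->
  [/\ nv s 11 0 = mid, nv s 14 0 = i & nv s 15 0 = j] ->
  mid <= hi -> (mid <= i -> j < hi) ->
  wp n inp choose s (tm choose) (fun s' =>
    [/\ s' = setn (setn s 13 0 i) 14 0 (i + 1), i < mid & j < hi -> kle l i j] \/
    [/\ s' = setn (setn s 13 0 j) 15 0 (j + 1), j < hi & i < mid -> kle l j i]).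
Proof.
move=> [k1 k2 k3 k4 k5 k6 k7] [b1 b2 b3 b4] [e11 e14 e15] mh hij.
have hk x : x < size l -> rv s 6 (nth 0 l x) = key (nth 0 l x).
  by move=> xl; have [_ _ _ _ ->] := k1; rewrite ?hkey // mem_nth.
apply: wp_sx => //; first by rewrite /=; do 3?case: ifP.
rewrite /= e14 e11 e15 b1.
case: (ltnP i mid) => him /=; last by right; split=> //; exact: hij.
case: (ltnP j hi) => hjh /=; last by left; split.
have il : i < size l by apply: leq_trans him (leq_trans mh b3).
have jl : j < size l by apply: leq_trans hjh b3.
rewrite k4 // k4 // !hk //; case: ltrP => hlt /=.
  by right; split=> // _; exact: ltW.
by left; split.
Qed.

Lemma append_ok p t s s1 x : common p t s -> p < m -> keep s0 s1 -> nv s1 9 0 = w ->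
  nv s1 10 0 = p -> (forall a, a \in [:: 7; 8] -> nv s1 a = nv s a) -> nv s1 7 (nv s1 13 0) = x ->
  bsorted (w + w) (rcons t x) ->
  forall (Q : st -> Prop),
  (forall s2, common p.+1 (rcons t x) s2 ->
     (forall a, a \in [:: 11; 12; 14; 15] -> nv s2 a = nv s1 a) -> Q s2) ->
  wp n inp (NSet 8 (V 10) (Get 7 (V 13)) ;; nincr 10) s1
    (tm (NSet 8 (V 10) (Get 7 (V 13)) ;; nincr 10)) Q.
Proof.
move=> [k1 k2 k3 k4 k5 k6 k7] pm k1' h9 h10 h78 hx hb Q hQ.
apply: wp_sx => //=; rewrite h10 hx; apply: hQ.
  split=> //.
  - by rewrite /= addn1.
  - by move=> u /k4 <-; rewrite /= h78.
  - by rewrite size_rcons k5.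
  - apply: (holds_arr_rcons k6); rewrite /= ?k5 ?eqbE ?eqxx // => u up.
    by rewrite eqbE (ltn_eqF up) h78.
by move=> a; rewrite !inE => /or4P[]/eqP->.
Qed.

Lemma merge_body_ok p s : minv p s -> p < m ->
  wp n inp merge_body s (tm merge_body) (minv p.+1).
Proof.
move=> [t [hc hb]] pm; apply: (@wp_seq2 _ _ _ _ _ _ _
    (fun s' => common p t s' /\ exists hi, inblock p hi t s')).
  have h10 := cm_p hc.
  case: hb => [hb|[hi hb]].
    apply: wp_if => //= [|_]; last exact: new_block_ok.
    by rewrite h10 (bd_hi hb) ltnn.
  apply: wp_if => //= [_|]; last by rewrite h10 (ib_hi hb) (ib_le hb).
  apply: wp_sx => //=; split; last by exists hi; case: hb => *; split.
  by case: hc => *; split=> //; exact: keep_nop.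
move=> {hc hb} s1 [hc [hi hb]].
have [b1 b2 b3 [c [mid [i [j [he [[l1 l2 l3 l4 l5] hij] [hhi [si sj]] [di dj] hp]]]]]] := hb.
apply: (@wp_seq2 _ _ _ _ _ _ _ (fun s' => [/\ s' = setn (setn s1 13 0 i) 14 0 (i + 1), i < mid & j < hi -> kle l i j] \/
    [/\ s' = setn (setn s1 13 0 j) 15 0 (j + 1), j < hi & i < mid -> kle l j i])).
  apply: choose_ok hc hb he _ _; first exact: leq_trans l3 l4.
  by move: hij b2 l2; clear; lia.
have [k1 k2 k3 k4 k5 k6 k7] := hc.
have ext x : (forall u, c * (w + w) <= u < p -> (key (nth 0 t u) <= key x)%R) ->
    bsorted (w + w) (rcons t x).
  move=> hx c' a b ha ab hb'; rewrite size_rcons k5 ltnS leq_eqVlt /kle => /predU1P[eb|bp].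
    rewrite !nth_rcons k5 eb ltnn eqxx -eb ab; apply: hx.
    (* The block [c'] containing position p cannot precede the current block c, which starts at or
       before p. *)
    rewrite -eb ab andbT; apply: leq_trans ha; rewrite leq_mul2r orbC leqNgt.
    apply/orP; left; apply/negP => lt; have := leq_mul lt (leqnn (w + w)).
    by move: hb' eb l1 l2 l3 hij; clear; lia.
  by rewrite !nth_rcons k5 bp (ltn_trans ab bp); apply: (k7 c') => //; rewrite k5.
have il : i < mid -> i < size l by move: l3 l4 b3; clear => *; lia.
have jl : j < hi -> j < size l by move: b3; clear => *; lia.
have [e11 e14 e15] := he.
have fin t' s2 : common p.+1 t' s2 -> (exists i' j', [/\ nv s2 11 0 = mid, nv s2 14 0 = i',
      nv s2 15 0 = j' & nv s2 12 0 = hi] /\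
     [/\ i <= i' <= mid, j <= j' <= hi, i' + j' = p.+1 + mid,
      dominated t' (c * (w + w)) p.+1 i' mid /\ dominated t' (c * (w + w)) p.+1 j' hi &
      perm_eq (t' ++ slice i' mid l ++ slice j' hi l ++ drop hi l) l]) -> minv p.+1 s2.
  move=> hc2 [i' [j' [[f11 f14 f15 f12] [/andP[i1 i2] /andP[j1 j2] hij' [d1 d2] hp']]]].
  exists t'; split=> //.
  case: (ltnP p.+1 hi) => hph; [right|left].
    exists hi; split=> //; exists c, mid, i', j'; split=> //.
    by split=> //; split=> //; [exact: leq_trans l1 i1 | exact: leq_trans l3 j1].
  have ep : p.+1 = hi by apply/eqP; rewrite eqn_leq hph b2.
  have [ei ej] : i' = mid /\ j' = hi by move: hij' i2 j2 ep; clear; lia.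
  split; rewrite ?f12 ?ep //; first by case: hhi => [->|->]; [left | right; exists c.+1].
  by move: hp'; rewrite ei ej !slice_nil.
move=> s2 [[-> h1 h2]|[-> h1 h2]].
- apply: (@append_ok p t s1 _ (nth 0 l i)) => //.
  + by move=> a; rewrite !inE => /orP[]/eqP->.
  + by rewrite /= k4 // il.
  + by apply: ext => u hu; apply: di => //; rewrite leqnn.
  move=> s3 hc3 hs3; apply: (fin _ _ hc3); exists (i + 1), j.
  split; first by rewrite !hs3 //= .
  split; [by move: h1; clear; lia | by rewrite leqnn l4 | by move: hij; clear; lia | split | ].
  + move=> u v /andP[u1 u2] /andP[v1 v2].
    have iv : kle l i v by apply: si => //; move: v1; clear; lia.
    rewrite nth_rcons k5; move: u2; rewrite ltnS leq_eqVlt => /predU1P[->|up].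
      by rewrite ltnn eqxx.
    by rewrite up; apply: di; rewrite ?u1 //; move: v1 v2; clear; lia.
  + move=> u v /andP[u1 u2] /andP[v1 v2].
    have jv : kle l j v.
      move: v1; rewrite leq_eqVlt => /predU1P[->|jv]; first exact: lexx.
      by apply: sj.
    rewrite nth_rcons k5; move: u2; rewrite ltnS leq_eqVlt => /predU1P[->|up].
      by rewrite ltnn eqxx; apply: le_trans jv; apply: h2; exact: leq_ltn_trans v1 v2.
    by rewrite up; apply: dj; rewrite ?u1 ?v1.
  + move: hp; rewrite (slice_cons h1 (leq_trans l3 (leq_trans l4 b3))) addn1.
    by rewrite cat_rcons.
- apply: (@append_ok p t s1 _ (nth 0 l j)) => //.
  + by move=> a; rewrite !inE => /orP[]/eqP->.
  + by rewrite /= k4 // jl.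
  + by apply: ext => u hu; apply: dj => //; rewrite leqnn.
  move=> s3 hc3 hs3; apply: (fin _ _ hc3); exists i, (j + 1).
  split; first by rewrite !hs3 //= .
  split; [by rewrite leqnn l2 | by move: h1; clear; lia | by move: hij; clear; lia | split | ].
  + move=> u v /andP[u1 u2] /andP[v1 v2].
    have iv : kle l i v.
      move: v1; rewrite leq_eqVlt => /predU1P[->|iv]; first exact: lexx.
      by apply: si.
    rewrite nth_rcons k5; move: u2; rewrite ltnS leq_eqVlt => /predU1P[->|up].
      by rewrite ltnn eqxx; apply: le_trans iv; apply: h2; exact: leq_ltn_trans v1 v2.
    by rewrite up; apply: di; rewrite ?u1 ?v1.
  + move=> u v /andP[u1 u2] /andP[v1 v2].
    have jv : kle l j v by apply: sj => //; move: v1; clear; lia.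
    rewrite nth_rcons k5; move: u2; rewrite ltnS leq_eqVlt => /predU1P[->|up].
      by rewrite ltnn eqxx.
    by rewrite up; apply: dj; rewrite ?u1 //; move: v1 v2; clear; lia.
  + apply: perm_trans hp; rewrite (slice_cons h1 b3) addn1 cat_rcons perm_cat2l.
    by rewrite -cat1s perm_catCA.
Qed.

Lemma pass_ok s : keep s0 s -> nv s 9 0 = w -> holds_arr s 7 l ->
  wp n inp pass_prog s ((tm pass_prog + tm merge_body + tm copy_body) * m.+1) (fun s' =>
    exists l', [/\ perm_eq l' l, bsorted (w + w) l', holds_arr s' 7 l', nv s' 9 0 = w & keep s0 s']).
Proof.
move=> hk h9 h7; apply: wp_le.
- do 2![apply: wp_seq; apply: wp_sx => //=].
  apply: (@wp_seq2 _ _ _ _ _ _ _ (fun s' => exists t, [/\ common m t s' & perm_eq t l])).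
    apply: (@wp_for _ _ minv m _ _ _ _ (tm merge_body)).
    + exists [::]; split; first by split=> // c a b.
      by left; split=> //; [right; exists 0 | rewrite drop0].
    + move=> p s' pm hI; split; last exact: merge_body_ok.
      have [t [[[_ k4 _ _ _] _ k10 _ _ _ _] _]] := hI.
      by rewrite /= k10 k4 hm.
    + move=> s' [t [hc hb]]; have [[_ k4 _ _ _] _ k10 _ _ _ _] := hc.
      split; first by rewrite /= k10 k4 hm ltnn.
      case: hb => [hb|[hi hb]]; last by have := leq_trans (ib_le hb) (ib_m hb); rewrite ltnn.
      by exists t; split=> //; have := bd_perm hb; rewrite drop_oversize // cats0.
  move=> s' [t [[k1 k2 k3 k4 k5 k6 k7] pt]].
  apply: wp_seq; apply: wp_sx => //=.
  pose J i s1 := [/\ keep s0 s1, nv s1 9 0 = w, nv s1 2 0 = i, holds_arr s1 8 t &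
    forall u, u < i -> nv s1 7 u = nth 0 t u].
  apply: (@wp_for _ _ J m _ _ _ _ (tm copy_body)) => //.
  + move=> i s1 im [j1 j2 j3 j4 j5]; split.
      by have [_ e4 _ _ _] := j1; rewrite /= j3 e4 hm.
    apply: wp_sx => //=; rewrite j3 j4 ?k5 //; split=> //=; first by rewrite addn1.
    move=> u; rewrite ltnS leq_eqVlt eqbE => /predU1P[->|ui]; first by rewrite eqxx.
    by rewrite (ltn_eqF ui) j5.
  + move=> s1 [j1 j2 j3 j4 j5]; split.
      by have [_ e4 _ _ _] := j1; rewrite /= j3 e4 hm ltnn.
    by exists t; split=> // u; rewrite k5; exact: j5.
- rewrite /pass_prog /=; move: (tm merge_body) (tm copy_body) => *; nia.
Qed.

End Pass.

(** The block length doubles with each pass, and after [up_log 2 (size l)] passes a single block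
    covers the list. *)
Lemma sort_prog_ok s0 l : nv s0 4 0 = size l -> holds_arr s0 7 l ->
  (forall x, x \in l -> rv s0 6 x = key x) ->
  wp n inp sort_prog s0 (tm sort_prog + (up_log 2 (size l)).+1 *
    ((tm sort_prog + tm pass_prog + tm merge_body + tm copy_body) * (size l).+1)) (fun s' =>
    exists l', [/\ perm_eq l' l, sorted (fun x y => (key x <= key y)%R) l', holds_arr s' 7 l' & keep s0 s']).
Proof.
move=> hm h7 hk; apply: wp_le.
- apply: wp_seq; apply: wp_sx => //=.
  pose I i s := [/\ keep s0 s, nv s 9 0 = 2 ^ i & exists l', [/\ perm_eq l' l,
    bsorted (2 ^ i) l' & holds_arr s 7 l']].
  apply: (@wp_for _ _ I (up_log 2 (size l)) _ _ _ _
    ((tm pass_prog + tm merge_body + tm copy_body) * (size l).+1 + tm (9 ::= Plus (V 9) (V 9)))).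
  + split=> //; exists l; split=> //.
    by move=> c a b; rewrite !muln1; clear; lia.
  + move=> i s lt [k1 k9 [l' [pl bl hl]]]; split.
      have [_ e4 _ _ _] := k1; rewrite /= k9 e4 hm ltnNge; apply/negP => h.
      by have := up_log_min (isT : 1 < 2) h; rewrite leqNgt lt.
    have w0 : 0 < 2 ^ i by rewrite expn_gt0.
    have hk' x : x \in l' -> rv s0 6 x = key x by rewrite (perm_mem pl); exact: hk.
    have hm' : nv s0 4 0 = size l' by rewrite hm (perm_size pl).
    rewrite -(perm_size pl).
    apply: (wp_seq2 (pass_ok w0 bl hk' hm' k1 k9 hl)) => s1 [l2 [p2 b2 h2 n2 kp2]].
    apply: wp_sx => //=; rewrite n2; split=> //=.
      by rewrite expnS; clear; lia.
    exists l2; split=> //; first exact: perm_trans p2 pl.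
    by move: b2; rewrite expnS mul2n addnn.
  + move=> s [k1 k9 [l' [pl bl hl]]]; split.
      have [_ e4 _ _ _] := k1; rewrite /= k9 e4 hm -leqNgt.
      exact: up_logP.
    exists l'; split=> //; case: l' pl bl {hl} => // x l' pl bl.
    apply/(pathP 0) => u us /=; apply: (bl 0 u u.+1) => //.
    rewrite mul1n; apply: leq_ltn_trans us _.
    have : size l <= 2 ^ up_log 2 (size l) by exact: up_logP.
    by rewrite -(perm_size pl).
- have -> : tm sort_prog = tm (9 ::= Cst 1) + (size (ccond (NLess (V 9) (V 4))).1 + 2 +
    (tm pass_prog + tm (9 ::= Plus (V 9) (V 9)))) by [].
  move: (tm (9 ::= Cst 1)) (tm (9 ::= Plus (V 9) (V 9))) (size _ + 2) (tm pass_prog).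
  move: (tm merge_body) (tm copy_body) (up_log 2 _) => x y z a b c d; clear.
  rewrite leq_add ?leq_mul2l //; first by lia.
  by nia.
Qed.
End Sort.

(** * Best rotation *)

(* Real arrays 21 and 22 hold the upper right and lower right entries of the
   products of the suffixes of the list; real variables 24, 25 and 26 are the
   entries of the product of the current prefix. *)
Definition elemE a := RGet a (V 13).
Definition suffix_body :=
  2 ::= Minus (V 2) (Cst 1) ;; 13 ::= Get 7 (V 2) ;;
  RSet 21 (V 2) (radd (rmul (RV 23) (elemE 4)) (rmul (RGet 21 (Plus (V 2) (Cst 1))) (elemE 5))) ;;
  RSet 22 (V 2) (rmul (RGet 22 (Plus (V 2) (Cst 1))) (elemE 5)) ;;
  23 ::=r rmul (RV 23) (elemE 3).
Definition rot_body :=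
  27 ::=r radd (rmul (RV 24) (RGet 21 (V 2))) (rmul (RV 25) (RGet 22 (V 2))) ;;
  If (RLess (RV 27) (RV 28)) (28 ::=r RV 27 ;; 14 ::= V 2) NOP ;;
  13 ::= Get 7 (V 2) ;;
  25 ::=r radd (rmul (elemE 3) (RV 25)) (rmul (elemE 4) (RV 26)) ;;
  24 ::=r rmul (elemE 3) (RV 24) ;;
  26 ::=r rmul (elemE 5) (RV 26) ;;
  nincr 2.
Definition write_body :=
  NSet OUT (Plus (V 0) (V 10)) (Get 7 (V 14)) ;; nincr 14 ;;
  If (NLess (V 14) (V 4)) NOP (14 ::= Cst 0) ;; nincr 10.
Definition suffix_prog :=
  23 ::=r RC1 ;; RSet 21 (V 4) RC0 ;; RSet 22 (V 4) RC1 ;; 2 ::= V 4 ;;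
  While (Cst 0) (V 2) suffix_body.
Definition best_prog :=
  24 ::=r RC1 ;; 25 ::=r RC0 ;; 26 ::=r RC1 ;; 28 ::=r RGet 21 (Cst 0) ;; 14 ::= Cst 0 ;;
  2 ::= Cst 0 ;; While (V 2) (V 4) rot_body.
Definition write_prog := 10 ::= Cst 0 ;; While (V 10) (V 4) write_body.
Definition rot_prog := suffix_prog ;; best_prog ;; write_prog.

Section Rot.
Variables (n : nat) (inp : nat -> R) (f : nat -> tri R) (l : seq nat).
Let m := size l.

Record rdata s : Prop := RData { rd0 : nv s 0 0 = n; rd4 : nv s 4 0 = m;
  rd7 : holds_arr s 7 l; rdf : forall x, x \in l -> holds_tri s x (f x) }.

Lemma rdata_setn s id i v : rdata s -> id \notin [:: 0; 4; 7] -> rdata (setn s id i v).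
Proof.
move=> [h0 h4 h7 hf]; rewrite !inE !negb_or => /and3P[n0 n4 n7]; split=> //.
- by rewrite nv_setn // eq_sym.
- by rewrite nv_setn // eq_sym.
- by move=> t /h7 <-; rewrite nv_setn // eq_sym.
Qed.

Lemma rdata_setr s id i v : rdata s -> 5 < id -> rdata (setr s id i v).
Proof.
move=> [h0 h4 h7 hf] hid; split=> // x /hf[h1 h2 h3].
by split; rewrite rv_setr //; move: hid; clear; lia.
Qed.

Definition suffixes i s := forall j, i <= j <= m ->
  rv s 21 j = tb (tprod f (drop j l)) /\ rv s 22 j = td (tprod f (drop j l)).

Lemma suffix_prog_ok s : rdata s ->
  wp n inp suffix_prog s ((tm suffix_prog + tm suffix_body) * m.+1) (fun s' =>
    rdata s' /\ suffixes 0 s').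
Proof.
move=> hs; apply: wp_le.
- do 4![apply: wp_seq; apply: wp_sx => //=].
  pose I i s' := [/\ rdata s', nv s' 2 0 = m - i, suffixes (m - i) s' &
     rv s' 23 0 = ta (tprod f (drop (m - i) l))].
  apply: (@wp_for _ _ I m _ _ _ _ (tm suffix_body)).
  + split=> //=.
    - by apply: rdata_setn => //; do 3![apply: rdata_setr => //].
    - by rewrite subn0 (rd4 hs).
    - move=> j; rewrite subn0 => hj; have -> : j = m by move: hj; clear; lia.
      by rewrite /= (rd4 hs) eqbE eqxx drop_size.
    - by rewrite subn0 drop_size.
  + move=> i s' im [h1 h2 h3 h4]; split; first by rewrite /= h2 subn_gt0.
    have e1 : m - i - 1 = m - i.+1 by clear; lia.
    have e2 : m - i.+1 + 1 = m - i by move: im; clear; lia.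
    have lt : m - i.+1 < size l by move: im; clear; rewrite -/m; lia.
    set x := nth 0 l (m - i.+1).
    have hx : x \in l by rewrite mem_nth.
    have [t1 t2 t3] := rdf h1 hx.
    have [] := h3 (m - i) _; first by clear; lia.
    move=> v1 v2.
    apply: wp_sx => //=; rewrite h2 e1 e2 (rd7 h1) // -/x t1 t2 t3 h4 v1 v2.
    have e3 : tprod f (drop (m - i.+1) l) = tmul (tprod f (drop (m - i) l)) (f x).
      by rewrite (drop_nth 0) // subnSK // tprod_cons.
    split=> //=.
    - by do 3![apply: rdata_setr => //]; do 2![apply: rdata_setn => //].
    - move=> j hj /=; rewrite !eqbE; case: eqP => [->|ne] /=; first by rewrite e3.
      by apply: h3; move: hj ne im; clear; lia.
    - by rewrite e3.
  + move=> s' [h1 h2 h3 h4]; rewrite /= h2 subnn; split=> //; split=> //.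
    by move: h3; rewrite subnn.
- rewrite /suffix_prog /=; move: (tm suffix_body) => *; nia.
Qed.

Definition rot_val i := tb (tprod f (rot i l)).

(** Once the prefix and suffix products are known, a rotation is evaluated in constant time, and all
    of them in linear time. *)
Lemma rot_valE i : rot_val i =
  (ta (tprod f (take i l)) * tb (tprod f (drop i l)) +
   tb (tprod f (take i l)) * td (tprod f (drop i l)))%R.
Proof. by rewrite /rot_val /rot tprod_cat. Qed.

Lemma best_prog_ok s : rdata s -> suffixes 0 s ->
  wp n inp best_prog s ((tm best_prog + tm rot_body) * m.+1) (fun s' =>
    [/\ rdata s', m = 0 \/ nv s' 14 0 < m & forall i, i < m -> (rot_val (nv s' 14 0) <= rot_val i)%R]).
Proof.
move=> hs hsuf; apply: wp_le.
- do 6![apply: wp_seq; apply: wp_sx => //=].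
  pose I i s' := [/\ rdata s' /\ suffixes 0 s', nv s' 2 0 = i,
    [/\ rv s' 24 0 = ta (tprod f (take i l)), rv s' 25 0 = tb (tprod f (take i l)) &
     rv s' 26 0 = td (tprod f (take i l))],
    rv s' 28 0 = rot_val (nv s' 14 0) /\ (m = 0 \/ nv s' 14 0 < m) &
    forall j, j < i -> (rv s' 28 0 <= rot_val j)%R].
  apply: (@wp_for _ _ I m _ _ _ _ (tm rot_body)).
  + split=> //=.
    - split; first by do 2![apply: rdata_setn => //]; do 4![apply: rdata_setr => //].
      by [].
    - by rewrite take0.
    - split; last by case: (m) => [|k]; [left|right].
      by rewrite /rot_val rot0; have [-> _] := hsuf 0 (leq0n _); rewrite drop0.
  + move=> i s' im [[h1 h2] h3 [a1 a2 a3] [b1 b2] b3]; split; first by rewrite /= h3 (rd4 h1).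
    have hv : rot_val i = (rv s' 24 0 * rv s' 21 i + rv s' 25 0 * rv s' 22 i)%R.
      have [|-> ->] := h2 i; first by move: im; clear; lia.
      by rewrite a1 a2 rot_valE.
    apply: wp_seq; apply: wp_sx => //=; rewrite h3 -hv.
    apply: (@wp_seq2 _ _ _ _ _ _ _ (fun s1 => [/\ rdata s1 /\ suffixes 0 s1, nv s1 2 0 = i,
      [/\ rv s1 24 0 = ta (tprod f (take i l)), rv s1 25 0 = tb (tprod f (take i l)) &
       rv s1 26 0 = td (tprod f (take i l))],
      rv s1 28 0 = rot_val (nv s1 14 0) /\ (m = 0 \/ nv s1 14 0 < m) &
      forall j, j < i.+1 -> (rv s1 28 0 <= rot_val j)%R])).
      apply: wp_sx => //; first by rewrite /=; case: ifP.
      rewrite /=; case: ltrP => hlt /=; split=> //=.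
      - split=> //; apply: rdata_setn => //; do 2![apply: rdata_setr => //].
      - by rewrite h3; split=> //; right.
      - move=> j; rewrite ltnS leq_eqVlt => /predU1P[->//|/b3].
        by move=> h; apply: le_trans h; exact: ltW.
      - by split=> //; do 2![apply: rdata_setr => //].
      - by move=> j; rewrite ltnS leq_eqVlt => /predU1P[->//|/b3].
    move=> s1 [[c1 c2] c3 [d1 d2 d3] [e1 e2] e3].
    set x := nth 0 l i; have hx : x \in l by rewrite mem_nth.
    have [t1 t2 t3] := rdf c1 hx.
    apply: wp_sx => //=; rewrite c3 (rd7 c1) // -/x t1 t2 t3 d1 d2 d3.
    have e4 : tprod f (take i.+1 l) = tmul (f x) (tprod f (take i l)).
      by rewrite (take_nth 0) // tprod_rcons.
    split=> //=; rewrite ?addn1 ?e4 //.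
    split; last by [].
    by apply: rdata_setn => //; do 3![apply: rdata_setr => //]; apply: rdata_setn.
  + move=> s' [[h1 h2] h3 _ [b1 b2] b3]; rewrite /= h3 (rd4 h1) ltnn; split=> //; split=> //.
    by move=> i im; rewrite -b1; exact: b3.
- rewrite /best_prog /=; move: (tm rot_body) => *; nia.
Qed.

Lemma nth_rot b i : b <= m -> i < m -> nth 0 (rot b l) i = nth 0 l ((b + i) %% m).
Proof.
move=> bm im; rewrite /rot nth_cat size_drop nth_drop -/m; case: ltnP => h.
  by rewrite modn_small //; move: h; clear; lia.
rewrite nth_take; last by move: h im bm; clear; lia.
congr nth; have -> : b + i = i - (m - b) + m by move: h bm; clear; lia.
by rewrite modnDr modn_small //; move: im; clear; lia.
Qed.

Lemma write_prog_ok s b : rdata s -> nv s 14 0 = b -> m = 0 \/ b < m ->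
  wp n inp write_prog s ((tm write_prog + tm write_body) * m.+1) (fun s' =>
    nv s' 0 0 = n /\ forall t, t < m -> nv s' OUT (n + t) = nth 0 (rot b l) t).
Proof.
move=> hs hb bm; apply: wp_le.
- apply: wp_seq; apply: wp_sx => //=.
  pose I i s' := [/\ rdata s', nv s' 10 0 = i, nv s' 14 0 = (b + i) %% m &
    forall t, t < i -> nv s' OUT (n + t) = nth 0 (rot b l) t].
  apply: (@wp_for _ _ I m _ _ _ _ (tm write_body)).
  + split=> //=; first by apply: rdata_setn.
    by rewrite hb addn0; case: bm => [->|h]; rewrite ?modn0 // modn_small.
  + move=> i s' im [h1 h2 h3 h4]; split; first by rewrite /= h2 (rd4 h1).
    have m0 : 0 < m by apply: leq_ltn_trans im.
    have bm' : b < m by case: bm => // m00; move: m0; rewrite m00.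
    have lt : (b + i) %% m < m by rewrite ltn_mod.
    have eo : nth 0 (rot b l) i = nth 0 l ((b + i) %% m).
      by apply: nth_rot => //; exact: ltnW.
    have eS : (b + i.+1) %% m = if (b + i) %% m + 1 < m then (b + i) %% m + 1 else 0.
      rewrite addnS -addn1 -modnDml; case: ltnP => h; first by rewrite modn_small.
      have -> : (b + i) %% m + 1 = m by move: h lt; clear; lia.
      by rewrite modnn.
    apply: wp_sx => //=; first by case: ifP.
    rewrite h2 h3 (rd0 h1) (rd4 h1) (rd7 h1) // -eo.
    have hO u v : u < i.+1 -> (forall t, t < i -> nv s' OUT (n + t) = nth 0 (rot b l) t) ->
        v = nth 0 (rot b l) i ->
        (if Nat.eqb (n + u) (n + i) then v else nv s' OUT (n + u)) = nth 0 (rot b l) u.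
      move=> ui h ->; rewrite eqbE eqn_add2l; case: eqP => [->//|ne].
      by apply: h; move: ui ne; clear; lia.
    move: eS; case: ifP => h eS /=; split; rewrite /= ?h2 ?eS ?addn1 //.
    - by do 3?[apply: rdata_setn => //]; apply: rdata_setr => //; do 2?[apply: rdata_setn => //].
    - by move=> u ui; apply: hO.
    - by do 4?[apply: rdata_setn => //].
    - by move=> u ui; apply: hO.
  + by move=> s' [h1 h2 h3 h4]; rewrite /= h2 (rd4 h1) ltnn; split=> //; split=> //; case: h1.
- rewrite /write_prog /=; move: (tm write_body) => *; nia.
Qed.

End Rot.

Local Arguments tm : simpl never.

(** * Dynamic program *)

(* The dynamic program ranges over the cells (S, len, l), numbered
   (S * (m + 1) + len) * (2 * m + 1) + l. Cell e owns the entries 2e (minimum)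
   and 2e + 1 (maximum) of the arrays: real array 21 holds the extremal values,
   integer arrays 28 and 29 the preceding entry and the last element of a list
   attaining it; real array 22 holds the lower right entries.
   Integer variables: 14 S, 15 len, 16 l, 17 e, 18 = 2m+1, 19 = (m+1)(2m+1),
   arrays 20 and 21 the multiples of 1 and of 19 by powers of two, 22 whether a
   candidate has been met, 23 the candidate, 24 the bits still to be scanned,
   25 and 26 the preceding cell and the element of the candidate, 27 whether it
   exists. *)
Definition double_body := NSet 7 (Plus (V 2) (V 4)) (Get 7 (V 2)) ;; nincr 2.
Definition stride_body := 19 ::= Plus (V 19) (V 18) ;; nincr 2.
Definition twice id := NSet id (Plus (V 2) (Cst 1)) (Plus (Get id (V 2)) (Get id (V 2))).
Definition power_body := twice 20 ;; twice 21 ;; nincr 2.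
Definition dp_setup :=
  2 ::= Cst 0 ;; While (V 2) (V 4) double_body ;;
  18 ::= Plus (Plus (V 4) (V 4)) (Cst 1) ;;
  19 ::= Cst 0 ;; 2 ::= Cst 0 ;; While (V 2) (Plus (V 4) (Cst 1)) stride_body ;;
  20 ::= Cst 1 ;; 21 ::= V 19 ;; 2 ::= Cst 0 ;; While (V 2) (V 5) power_body.

Definition select_neg :=
  2 ::= Minus (Minus (V 5) (V 23)) (Cst 1) ;;
  If (NLess (V 24) (Get 20 (V 2))) NOP
    (24 ::= Minus (V 24) (Get 20 (V 2)) ;; 27 ::= Cst 1 ;;
     25 ::= Minus (V 17) (Get 21 (V 2)) ;; 26 ::= Get 6 (V 2)).
Definition select_pos :=
  If (NLess (Cst 0) (V 15))
    (27 ::= Cst 1 ;;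
     If (NLess (V 5) (V 23))
       (25 ::= Plus (Minus (V 17) (V 18)) (Cst 1) ;; 26 ::= Get 7 (V 16))
       (25 ::= Minus (V 17) (V 18) ;; 26 ::= Get 7 (Minus (Plus (V 16) (V 15)) (Cst 1)))) NOP.
Definition select := 27 ::= Cst 0 ;; If (NLess (V 23) (V 5)) select_neg select_pos.

Definition candE a := RGet a (V 26).
Definition store p q v := RSet 21 (V p) (RV v) ;; NSet 28 (V p) (V q) ;; NSet 29 (V p) (V 26).
Definition cand_value q v :=
  v ::=r radd (rmul (candE 3) (RGet 21 (V q))) (rmul (candE 4) (RGet 22 (V 25))).
Definition apply_values :=
  11 ::= Plus (V 17) (V 17) ;; 12 ::= Plus (V 11) (Cst 1) ;;
  If (RLess (candE 3) RC0)
    (10 ::= Plus (V 25) (V 25) ;; 9 ::= Plus (V 10) (Cst 1))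
    (9 ::= Plus (V 25) (V 25) ;; 10 ::= Plus (V 9) (Cst 1)) ;;
  cand_value 9 23 ;; cand_value 10 24.
Definition apply_min := If (NLess (Cst 0) (V 22))
  (If (RLess (RV 23) (RGet 21 (V 11))) (store 11 9 23) NOP) (store 11 9 23).
Definition apply_max := If (NLess (Cst 0) (V 22))
  (If (RLess (RGet 21 (V 12)) (RV 24)) (store 12 10 24) NOP) (store 12 10 24).
Definition apply_end := RSet 22 (V 17) (rmul (candE 5) (RGet 22 (V 25))) ;; 22 ::= Cst 1.
Definition apply_cand := apply_values ;; apply_min ;; apply_max ;; apply_end.
Definition cand_body := select ;; If (NLess (Cst 0) (V 27)) apply_cand NOP ;; nincr 23.
Definition base_cell :=
  RSet 21 (Plus (V 17) (V 17)) RC0 ;; RSet 21 (Plus (Plus (V 17) (V 17)) (Cst 1)) RC0 ;;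
  RSet 22 (V 17) RC1.
Definition cell_prog :=
  22 ::= Cst 0 ;; 24 ::= V 14 ;; 23 ::= Cst 0 ;;
  While (V 23) (Plus (V 5) (Cst 2)) cand_body ;;
  If (NLess (Cst 0) (V 22)) NOP base_cell.

Definition l_body := If (NLess (Plus (V 16) (V 15)) (V 18)) cell_prog NOP ;; nincr 17 ;; nincr 16.
Definition len_body := 16 ::= Cst 0 ;; While (V 16) (V 18) l_body ;; nincr 15.
Definition set_body := 15 ::= Cst 0 ;; While (V 15) (Plus (V 4) (Cst 1)) len_body ;; nincr 14.
Definition dp_main := 17 ::= Cst 0 ;; 14 ::= Cst 0 ;; While (V 14) (Get 20 (V 5)) set_body.

Definition valueE i := RGet 21 (Plus (V i) (V i)).
Definition final_body := 9 ::= Plus (V 2) (V 16) ;;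
  If (RLess (valueE 9) (valueE 25)) (25 ::= V 9) NOP ;; nincr 16.
Definition trace_body := 10 ::= Minus (V 10) (Cst 1) ;;
  NSet OUT (Plus (V 0) (V 10)) (Get 29 (V 26)) ;; 26 ::= Get 28 (V 26).
Definition dp_final :=
  2 ::= Minus (V 17) (V 18) ;; 25 ::= V 2 ;; 16 ::= Cst 0 ;;
  While (V 16) (Plus (V 4) (Cst 1)) final_body ;;
  26 ::= Plus (V 25) (V 25) ;; 10 ::= V 0 ;; While (Cst 0) (V 10) trace_body.
Definition dp_prog := dp_setup ;; dp_main ;; dp_final.

Section DP.
Variables (n : nat) (inp : nat -> R) (f : nat -> tri R) (pos neg : seq nat).
Let m := size pos.
Let k := size neg.
Let L2 := m + m + 1.
Let ST := (m + 1) * L2.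
Let idx := nth 0 (pos ++ pos).
Let ng := nth 0 neg.

Definition cls S l len lst := grow idx ng k S l len lst.
Definition cell S len l := (S * (m + 1) + len) * L2 + l.

(** Candidate q describes the last element: for [q < k] the negative matrix number [k - q - 1], as
    bits are scanned from the highest down; for [q = k] the right end of the arc; for [q = k + 1]
    its left end. *)
Definition via S l len q lst := exists lst' x, lst = rcons lst' x /\
  if q < k then [/\ bit S (k - q - 1), x = ng (k - q - 1) & cls (S - 2 ^ (k - q - 1)) l len lst']
  else 0 < len /\ if k < q then x = idx l /\ cls S l.+1 len.-1 lst'
                  else x = idx (l + len - 1) /\ cls S l len.-1 lst'.

Lemma via_cls S l len q lst : q < k + 2 -> via S l len q lst -> cls S l len lst.
Proof.
move=> hq [lst' [x [-> ]]]; case: ltnP => qk.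
  move=> [hb -> hc]; have jk : k - q - 1 < k by move: qk; clear; lia.
  by have := grow_neg jk (bitB hb) hc; rewrite subnK ?bit_le.
case: len => [|len] [] // _; case: ltnP => qk' [-> hc]; first exact: grow_left.
by rewrite addnS subn1 /=; exact: grow_right.
Qed.

Lemma cls_via S l len lst : cls S l len lst ->
  [/\ lst = [::], S = 0 & len = 0] \/ exists2 q, q < k + 2 & via S l len q lst.
Proof.
case=> {S l len lst} [l|S l len s hs|S l len s hs|S l len s j jk hj hs]; first by left.
- right; exists k; first by clear; lia.
  by exists s, (idx (l + len)); rewrite !ltnn addnS subn1.
- right; exists k.+1; first by clear; lia.
  by exists s, (idx l); rewrite ltnS ltnNge leqnSn /= ltnSn.
- right; exists (k - j - 1); first by move: jk; clear; lia.
  have e : k - (k - j - 1) - 1 = j by move: jk; clear; lia.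
  exists s, (ng j); split=> //; rewrite ifT; last by move: jk; clear; lia.
  by rewrite e bitD // eqxx addnK.
Qed.

Definition enabled S len q := if q < k then bit S (k - q - 1) else 0 < len.

Lemma via_enabled S l len q lst : via S l len q lst -> enabled S len q.
Proof. by rewrite /enabled => -[lst' [x [_]]]; case: ifP => _ []. Qed.

Lemma enabled_base S len : S < 2 ^ k -> (forall q, q < k + 2 -> ~~ enabled S len q) ->
  S = 0 /\ len = 0.
Proof.
move=> hS h; split.
  apply: (bits_eq0 hS) => j jk; have := h (k - j - 1) _; rewrite /enabled ifT.
  - by rewrite (_ : k - (k - j - 1) - 1 = j) => [|]; [apply; move: jk; clear; lia | move: jk; clear; lia].
  - by move: jk; clear; lia.
by have := h k _; rewrite /enabled ltnn lt0n negbK => /(_ ltac:(clear; lia))/eqP.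
Qed.

Lemma cell_right S len l : 0 < len -> cell S len l - L2 = cell S len.-1 l /\ cell S len.-1 l < cell S len l.
Proof.
case: len => // len _; rewrite /cell [_ + len.+1]addnS mulSn [len.+1.-1]/=.
move: (_ * L2) => c; have : 0 < L2 by rewrite /L2 addn1.
by clear; lia.
Qed.

(** For m = 0 the row length [L2] would be 1 and the cell number would not decrease. *)
Lemma cell_left S len l : 0 < len -> 0 < m ->
  cell S len l - L2 + 1 = cell S len.-1 l.+1 /\ cell S len.-1 l.+1 < cell S len l.
Proof.
case: len => // len _ m0; rewrite /cell [_ + len.+1]addnS mulSn [len.+1.-1]/=.
by move: (_ * L2) => c; rewrite /L2; move: m0; clear; lia.
Qed.

Lemma cell_neg S len l j : bit S j ->
  cell S len l - 2 ^ j * ST = cell (S - 2 ^ j) len l /\ cell (S - 2 ^ j) len l < cell S len l.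
Proof.
move=> /bit_le h; have p2 : 0 < 2 ^ j by rewrite expn_gt0.
have ST0 : 0 < ST by rewrite /ST /L2 muln_gt0 !addn1.
have e : cell S len l = cell (S - 2 ^ j) len l + 2 ^ j * ST.
  rewrite /cell -{1}(subnK h) /ST !mulnDl -!addnA; congr (_ + _).
  by rewrite !addnA [LHS]addnC; clear; nia.
by rewrite e addnK; split=> //; rewrite -[X in X < _]addn0 ltn_add2l muln_gt0 p2.
Qed.

(** The remainder holds the bits of S not yet scanned. Its top bit is tested by comparison with a
    tabulated power of two and cleared by subtraction. *)
Lemma rem_step S q : q < k ->
  (S %% 2 ^ (k - q) < 2 ^ (k - q - 1)) = ~~ bit S (k - q - 1) /\
  S %% 2 ^ (k - q.+1) = if bit S (k - q - 1) then S %% 2 ^ (k - q) - 2 ^ (k - q - 1) else S %% 2 ^ (k - q).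
Proof.
move=> qk; have ej : k - q.+1 = k - q - 1 by clear; lia.
have ek : k - q = (k - q - 1).+1 by move: qk; clear; lia.
rewrite ej; move: ek; move: (k - q - 1) => j ->; rewrite /bit.
have e1 := divn_eq S (2 ^ j); set r := S %% 2 ^ j in e1 *.
have rl : r < 2 ^ j by rewrite ltn_mod expn_gt0.
have e2 : S %% 2 ^ j.+1 = odd (S %/ 2 ^ j) * 2 ^ j + r.
  have e3 : S = (S %/ 2 ^ j)./2 * 2 ^ j.+1 + (odd (S %/ 2 ^ j) * 2 ^ j + r).
    rewrite {1}e1 -{1}[S %/ 2 ^ j]odd_double_half expnS; move: (_./2) => h.
    by rewrite -muln2; move: (nat_of_bool _); clear; nia.
  rewrite {1}e3 modnMDl modn_small // expnS mul2n -addnn.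
  by case: (odd _); rewrite ?mul1n ?mul0n; move: rl; clear; lia.
rewrite e2; case: (odd _) => /=; rewrite ?mul1n ?mul0n ?add0n.
- by rewrite addKn ltnNge leq_addr.
- by rewrite rl.
Qed.

Definition bval lst := tb (tprod f lst).

(** Back pointers lead to smaller cells, so writing to later cells leaves a stored path intact. A
    path may end at any entry: the number of elements to be traced is known. *)
Inductive path (s : st) : nat -> seq nat -> Prop :=
| path_nil p : path s p [::]
| path_rcons p lst : (nv s 28 p)./2 < p./2 -> path s (nv s 28 p) lst ->
    path s p (rcons lst (nv s 29 p)).

Definition same_at p s s' :=
  [/\ nv s' 28 p = nv s 28 p, nv s' 29 p = nv s 29 p & rv s' 21 p = rv s 21 p].
Definition agree e s s' := (forall p, p./2 < e -> same_at p s s') /\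
  (forall c, c < e -> rv s' 22 c = rv s 22 c).

Lemma path_same s s' p lst : path s p lst -> agree p./2 s s' -> same_at p s s' -> path s' p lst.
Proof.
elim=> {p lst} [p|p lst hp _ IH] ha hs; first exact: path_nil.
have [e1 e2 _] := hs; rewrite -e2; apply: path_rcons; rewrite e1 //; apply: IH; last first.
  by have [h _] := ha; exact: h.
have [h1 h2] := ha; split=> [p' hp'|c hc]; [apply: h1 | apply: h2]; exact: ltn_trans hp.
Qed.

Definition opt (le : R -> R -> bool) (C : seq nat -> Prop) p s :=
  (exists2 lst, C lst & path s p lst /\ rv s 21 p = bval lst) /\
  forall lst, C lst -> le (rv s 21 p) (bval lst).

Lemma opt_same le C p s s' : opt le C p s -> agree p./2 s s' -> same_at p s s' -> opt le C p s'.
Proof.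
move=> [[lst Cl [h1 h2]] h3] ha hs; have [_ _ e] := hs; split.
  by exists lst => //; split; [exact: path_same h1 ha hs | rewrite e].
by move=> lst' /h3; rewrite e.
Qed.

Lemma opt_equiv le (C C' : seq nat -> Prop) p s : (forall lst, C lst <-> C' lst) ->
  opt le C p s -> opt le C' p s.
Proof.
move=> h [[lst Cl hl] hb]; split; first by exists lst => //; exact/h.
by move=> lst' /h; exact: hb.
Qed.

Definition le_min : R -> R -> bool := fun x y => (x <= y)%R.
Definition le_max : R -> R -> bool := fun x y => (y <= x)%R.

(** One lower right entry per cell suffices, because all lists of a class use the same matrices. *)
Definition good s c C := [/\ opt le_min C (c + c) s, opt le_max C (c + c + 1) s &
  forall lst, C lst -> rv s 22 c = td (tprod f lst)].

Lemma half_even c : (c + c)./2 = c. Proof. by rewrite addnn doubleK. Qed.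
Lemma half_odd c : (c + c + 1)./2 = c. Proof. by rewrite addnn addn1 /= uphalf_double. Qed.

Lemma agree_setn e s a i v : a != 28 -> a != 29 -> agree e s (setn s a i v).
Proof. by move=> h1 h2; split=> // p _; split; rewrite ?nv_setn // eq_sym. Qed.

Lemma agree_setr e s a i v : a != 21 -> a != 22 -> agree e s (setr s a i v).
Proof. by move=> h1 h2; split=> [p _|c _]; [split|]; rewrite ?rv_setr // eq_sym. Qed.

Lemma agree_sub e e' s s' : e' <= e -> agree e s s' -> agree e' s s'.
Proof. by move=> le [h1 h2]; split=> [p hp|c hc]; [apply: h1|apply: h2]; exact: leq_trans le. Qed.

Lemma good_agree e s s' c C : c < e -> agree e s s' -> good s c C -> good s' c C.
Proof.
move=> ce ha [g1 g2 g3]; have [h1 h2] := ha; split.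
- apply: opt_same g1 _ _; first by rewrite half_even; exact: agree_sub (ltnW ce) ha.
  by apply: h1; rewrite half_even.
- apply: opt_same g2 _ _; first by rewrite half_odd; exact: agree_sub (ltnW ce) ha.
  by apply: h1; rewrite half_odd.
- by move=> lst /g3; rewrite h2.
Qed.

Lemma good_equiv s c (C C' : seq nat -> Prop) : (forall lst, C lst <-> C' lst) ->
  good s c C -> good s c C'.
Proof.
move=> h [g1 g2 g3]; split; [exact: opt_equiv g1 | exact: opt_equiv g2 |].
by move=> lst /h; exact: g3.
Qed.

(** Cells whose window would leave the doubled list have a number but are never filled. *)
Definition dpinv e s := forall S len l, S < 2 ^ k -> len <= m -> l + len <= m + m ->
  cell S len l < e -> good s (cell S len l) (cls S l len).

Lemma dpinv_agree e s s' : agree e s s' -> dpinv e s -> dpinv e s'.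
Proof. by move=> ha h S len l h1 h2 h3 h4; exact: good_agree h4 ha (h _ _ _ h1 h2 h3 h4). Qed.

Record ddata s : Prop := DData { dd_n : nv s 0 0 = n; dd_m : nv s 4 0 = m; dd_k : nv s 5 0 = k;
  dd_L : nv s 18 0 = L2;
  dd_idx : forall t, t < m + m -> nv s 7 t = idx t; dd_neg : forall j, j < k -> nv s 6 j = ng j;
  dd_p2 : forall j, j <= k -> nv s 20 j = 2 ^ j; dd_st : forall j, j <= k -> nv s 21 j = 2 ^ j * ST;
  dd_tri : forall x, x \in pos ++ neg -> holds_tri s x (f x) }.

Definition dframe := [:: 0; 4; 5; 6; 7; 18; 20; 21].

Lemma ddata_same s s' : (forall a, a \in dframe -> nv s' a = nv s a) ->
  (forall a, a < 6 -> rv s' a = rv s a) -> ddata s -> ddata s'.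
Proof.
move=> hn hr [d1 d2 d3 d4 d5 d6 d7 d8 d9].
split; rewrite ?hn //.
by move=> x /d9; rewrite /holds_tri !hr.
Qed.

(** * Filling one cell *)

Section Cell.
Variables (S len l : nat).
Hypothesis (hS : S < 2 ^ k) (hlen : len <= m) (hl : l + len <= m + m).
Let e := cell S len l.

Record cst s : Prop := CSt { cs_d : ddata s; cs14 : nv s 14 0 = S; cs15 : nv s 15 0 = len;
  cs16 : nv s 16 0 = l; cs17 : nv s 17 0 = e; cs_inv : dpinv e s }.

Definition cframe := [:: 14; 15; 16; 17] ++ dframe.

Lemma cst_same s s' : (forall a, a \in cframe -> nv s' a = nv s a) ->
  (forall a, a < 6 -> rv s' a = rv s a) -> agree e s s' -> cst s -> cst s'.
Proof.
move=> hn hr ha [c1 c2 c3 c4 c5 c6]; split; rewrite ?hn //.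
- by apply: ddata_same c1 => // a h; apply: hn; rewrite mem_cat h orbT.
- exact: dpinv_agree ha c6.
Qed.

Lemma cst_setr s a i v : cst s -> 5 < a -> a != 21 -> a != 22 -> cst (setr s a i v).
Proof.
move=> hc h5 h1 h2; apply: (cst_same _ _ _ hc) => //; last exact: agree_setr.
by move=> b b6; rewrite rv_setr //; move: b6 h5; clear; lia.
Qed.

Lemma cst_setn s a i v : cst s -> a \notin cframe -> a != 28 -> a != 29 -> cst (setn s a i v).
Proof.
move=> hc ha h1 h2; apply: (cst_same _ _ _ hc) => //; last exact: agree_setn.
by move=> b hb; rewrite nv_setn //; apply: contraTneq hb => ->.
Qed.

Definition arrs s s' := [/\ nv s' 28 = nv s 28, nv s' 29 = nv s 29, rv s' 21 = rv s 21 & rv s' 22 = rv s 22].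

Lemma arrs_agree s s' : arrs s s' -> forall e', agree e' s s'.
Proof. by move=> [h1 h2 h3 h4] e'; split=> [p _|c _]; rewrite /same_at ?h1 ?h2 ?h3 ?h4. Qed.

Lemma arrs_good s s' c C : arrs s s' -> good s c C -> good s' c C.
Proof. by move=> h; exact: (good_agree (ltnSn c) (arrs_agree h c.+1)). Qed.

Definition selected q s := exists C' c x, [/\ nv s 25 0 = c /\ nv s 26 0 = x, c < e, good s c C',
   holds_tri s x (f x) & forall lst, via S l len q lst <-> exists2 lst', C' lst' & lst = rcons lst' x].

Lemma select_ok q s : cst s -> nv s 23 0 = q -> q < k + 2 -> nv s 24 0 = S %% 2 ^ (k - q) ->
  wp n inp select s (tm select) (fun s' => [/\ cst s', arrs s s', nv s' 23 0 = q /\ nv s' 22 0 = nv s 22 0,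
    nv s' 24 0 = S %% 2 ^ (k - q.+1) & nv s' 27 0 = enabled S len q /\ (enabled S len q -> selected q s')]).
Proof.
move=> hc h23 hq h24; apply: wp_seq; apply: wp_sx => //=.
have [[d1 d2 d3 d4 d5 d6 d7 d8 d9] c14 c15 c16 c17 cinv] := hc.
apply: wp_if => //= [|]; rewrite h23 d3; last first.
  rewrite -leqNgt => kq; have hen : enabled S len q = (0 < len) by rewrite /enabled ltnNge kq.
  have e24 : S %% 2 ^ (k - q) = S %% 2 ^ (k - q.+1).
    by rewrite (_ : k - q = k - q.+1) //; move: kq; clear; lia.
  apply: wp_if => //= [|]; rewrite c15; last first.
    rewrite -eqn0Ngt => /eqP len0; apply: wp_sx => //=; rewrite h24 hen len0.
    by split=> //; apply: cst_setr => //; apply: cst_setn.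
  move=> len0; apply: wp_seq; apply: wp_sx => //=.
  have m0 : 0 < m by apply: leq_trans hlen.
  apply: wp_if => //= [|]; rewrite h23 d3.
  + move=> kq'; apply: wp_sx => //=; rewrite c17 d4 c16 d5; last by move: hl len0; clear; lia.
    have [e1 e2] := cell_left S l len0 m0.
    rewrite h24 hen len0; split=> //; first by do 4![apply: cst_setn => //].
    split=> // _; exists (cls S l.+1 len.-1), (cell S len.-1 l.+1), (idx l); split=> //.
    * by apply: (@arrs_good s) => //; apply: cinv => //; move: hl hlen len0; clear; lia.
    * apply: d9; rewrite mem_cat; apply/orP; left.
      have : idx l \in pos ++ pos by rewrite mem_nth // size_cat -/m; move: hl len0; clear; lia.
      by rewrite mem_cat orbb.
    * move=> lst; split.
        by move=> [lst' [x [-> ]]]; rewrite ltnNge kq /= kq' => -[_ [-> hc']]; exists lst'.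
      by move=> [lst' hc' ->]; exists lst', (idx l); rewrite ltnNge kq /= kq'.
  + rewrite -leqNgt => qk; have eqk : q = k by apply/eqP; rewrite eqn_leq qk.
    apply: wp_sx => //=; rewrite c17 d4 c16 c15 d5; last by move: hl len0; clear; lia.
    have [e1 e2] := cell_right S l len0.
    rewrite h24 hen len0; split=> //; first by do 4![apply: cst_setn => //].
    split=> // _; exists (cls S l len.-1), (cell S len.-1 l), (idx (l + len - 1)); split=> //.
    * by apply: (@arrs_good s) => //; apply: cinv => //; move: hl hlen len0; clear; lia.
    * apply: d9; rewrite mem_cat; apply/orP; left.
      have : idx (l + len - 1) \in pos ++ pos by rewrite mem_nth // size_cat -/m; move: hl len0; clear; lia.
      by rewrite mem_cat orbb.
    * move=> lst; split.
        by move=> [lst' [x [-> ]]]; rewrite eqk ltnn => -[_ [-> hc']]; exists lst'.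
      by move=> [lst' hc' ->]; exists lst', (idx (l + len - 1)); rewrite eqk ltnn.
move=> qk; have hen : enabled S len q = bit S (k - q - 1) by rewrite /enabled qk.
have [r1 r2] := rem_step S qk.
have jk : k - q - 1 < k by move: qk; clear; lia.
apply: wp_seq; apply: wp_sx => //=; rewrite h23 d3.
apply: wp_if => //= [|]; rewrite h24 d7 ?(ltnW jk) // r1.
  move=> nb; apply: wp_sx => //=; rewrite h24 r2 hen (negPf nb); split=> //.
  by apply: cst_setr => //; do 2![apply: cst_setn => //].
rewrite negbK => hb; apply: wp_sx => //=.
rewrite h24 d7 ?(ltnW jk) // c17 d8 ?(ltnW jk) // d6 // r2 hen hb.
have [e1 e2] := cell_neg len l hb.
split=> //; first by do 6![apply: cst_setn => //].
split=> // _; exists (cls (S - 2 ^ (k - q - 1)) l len), (cell (S - 2 ^ (k - q - 1)) len l), (ng (k - q - 1)).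
split=> //.
* by apply: (@arrs_good s) => //; apply: cinv => //; apply: leq_ltn_trans (leq_subr _ _) hS.
* by apply: d9; rewrite mem_cat mem_nth ?orbT.
* move=> lst; split.
    by move=> [lst' [x [-> ]]]; rewrite qk => -[_ -> hc']; exists lst'.
  by move=> [lst' hc' ->]; exists lst', (ng (k - q - 1)); rewrite qk.
Qed.

Lemma cls_td lst lst' : cls S l len lst -> cls S l len lst' -> td (tprod f lst) = td (tprod f lst').
Proof.
move=> h h'; rewrite !td_tprod; apply: perm_big.
by rewrite (perm_trans (grow_perm h)) // perm_sym; exact: grow_perm h'.
Qed.

Definition cval (le : R -> R -> bool) p v (C : seq nat -> Prop) x s :=
  (exists2 lst, C lst & path s p lst /\ v = bval (rcons lst x)) /\
  forall lst, C lst -> le v (bval (rcons lst x)).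

Lemma bval_rcons lst x :
  bval (rcons lst x) = (ta (f x) * bval lst + tb (f x) * td (tprod f lst))%R.
Proof. by rewrite /bval tprod_rcons. Qed.

(** Appending x acts on values as an affine map of slope [ta (f x)]. A negative slope exchanges the
    two extrema, hence two relations [le0] and [le]. *)
Lemma cval_opt (le0 le : R -> R -> bool) C p c x s : opt le0 C p s ->
  (forall lst, C lst -> rv s 22 c = td (tprod f lst)) ->
  (forall a b z, le0 a b -> le (ta (f x) * a + z)%R (ta (f x) * b + z)%R) ->
  cval le p (ta (f x) * rv s 21 p + tb (f x) * rv s 22 c)%R C x s.
Proof.
move=> [[lst Cl [h1 h2]] hb] hd hle; split.
  by exists lst => //; split=> //; rewrite bval_rcons h2 (hd lst).
by move=> lst' Cl'; rewrite bval_rcons (hd lst') //; apply: hle; exact: hb.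
Qed.

Definition plus_cand (C C' : seq nat -> Prop) x lst :=
  C lst \/ exists2 lst', C' lst' & lst = rcons lst' x.

Lemma store_opt le (C C' : seq nat -> Prop) p q v x s s' : cval le q v C' x s ->
  (forall lst, C lst -> le v (bval lst)) -> q./2 < p./2 -> agree p./2 s s' ->
  [/\ nv s' 28 p = q, nv s' 29 p = x & rv s' 21 p = v] ->
  opt le (plus_cand C C' x) p s'.
Proof.
move=> [[lst Cl [h1 h2]] hb] hC qp ha [e1 e2 e3]; split.
  exists (rcons lst x); first by right; exists lst.
  split; last by rewrite e3.
  rewrite -e2; apply: path_rcons; rewrite e1 //.
  apply: path_same h1 _ _; first exact: agree_sub (ltnW qp) ha.
  by have [h _] := ha; exact: h.
by move=> lst' [/hC|[l' hl' ->]]; rewrite e3 //; exact: hb.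
Qed.

Lemma keep_opt le (C C' : seq nat -> Prop) p q v x s s' : transitive le -> cval le q v C' x s ->
  opt le C p s -> le (rv s 21 p) v -> agree p./2 s s' -> same_at p s s' ->
  opt le (plus_cand C C' x) p s'.
Proof.
move=> tr [_ hb] ho hv ha hs; have [[lst Cl hlst] hb'] := opt_same ho ha hs.
have [_ _ ep] := hs; split; first by exists lst => //; left.
move=> lst' [/hb'//|[l' hl' ->]]; rewrite ep; apply: tr hv _; exact: hb.
Qed.

Lemma agree_store s p q x v : e <= p./2 ->
  agree e s (setn (setn (setr s 21 p v) 28 p q) 29 p x).
Proof.
move=> ep; split=> // p' hp'; have ne : (p' == p) = false.
  by apply/eqP => h; move: hp'; rewrite h ltnNge ep.
by split=> /=; rewrite eqbE ne.
Qed.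

Section Candidate.
Variables (q rem h : nat) (C C' : seq nat -> Prop) (c x : nat).
Hypothesis (ce : c < e).

Record cand_st s : Prop := CandSt { cd_c : cst s; cd22 : nv s 22 0 = h; cd23 : nv s 23 0 = q;
  cd24 : nv s 24 0 = rem; cd25 : nv s 25 0 = c; cd26 : nv s 26 0 = x;
  cd_g : good s c C'; cd_x : holds_tri s x (f x) }.

(** As long as the flag h is 0, no candidate has been met and the contents of the entry are
    meaningless. *)
Definition partial le p s := h = 0 /\ (forall lst, ~ C lst) \/ h = 1 /\ opt le C p s.

Lemma cand_same s s' : (forall a, a \in cframe ++ [:: 22; 23; 24; 25; 26] -> nv s' a = nv s a) ->
  (forall a, a < 6 -> rv s' a = rv s a) -> agree e s s' -> cand_st s -> cand_st s'.
Proof.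
move=> hn hr ha [c1 c2 c3 c4 c5 c6 c7 c8]; split; rewrite ?hn //.
- by apply: cst_same c1 => // a ha'; apply: hn; rewrite mem_cat ha'.
- exact: good_agree ce ha c7.
- by move: c8; rewrite /holds_tri !hr.
Qed.

Lemma cand_setr s a i v : cand_st s -> 5 < a -> a != 21 -> a != 22 -> cand_st (setr s a i v).
Proof.
move=> hc h5 h1 h2; apply: (cand_same _ _ _ hc) => //; last exact: agree_setr.
by move=> b b6; rewrite rv_setr //; move: b6 h5; clear; lia.
Qed.

Lemma cand_setn s a i v : cand_st s -> a \notin cframe ++ [:: 22; 23; 24; 25; 26] ->
  a != 28 -> a != 29 -> cand_st (setn s a i v).
Proof.
move=> hc ha h1 h2; apply: (cand_same _ _ _ hc) => //; last exact: agree_setn.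
by move=> b hb; rewrite nv_setn //; apply: contraTneq hb => ->.
Qed.

Lemma cand_store s p q' x' v : e <= p./2 -> cand_st s ->
  cand_st (setn (setn (setr s 21 p v) 28 p q') 29 p x').
Proof.
move=> ep hc; apply: (cand_same _ _ _ hc) => //; last exact: agree_store.
  by move=> b hb; rewrite !nv_setn //; apply: contraTneq hb => ->.
by move=> b b6; rewrite -[rv _]/(rv (setr s 21 p v)) rv_setr //; move: b6; clear; lia.
Qed.

Record val_st p0 p1 s : Prop := ValSt { vs_c : cand_st s; vs9 : nv s 9 0 = p0; vs10 : nv s 10 0 = p1;
  vs11 : nv s 11 0 = e + e; vs12 : nv s 12 0 = e + e + 1;
  vs_p : p0./2 = c /\ p1./2 = c;
  vs_max : cval le_max p1 (rv s 24 0) C' x s }.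

Lemma apply_values_ok s : cand_st s ->
  wp n inp apply_values s (tm apply_values) (fun s' => arrs s s' /\
    exists p0 p1, val_st p0 p1 s' /\ cval le_min p0 (rv s' 23 0) C' x s').
Proof.
move=> hc; have [[cd c14 c15 c16 c17 cinv] c22 c23 c24 c25 c26 [g1 g2 g3] [t1 t2 t3]] := hc.
do 2![apply: wp_seq; apply: wp_sx => //=]; rewrite c17.
set s1 := setn _ 12 _ _.
have hc1 : cand_st s1 by do 2![apply: cand_setn => //].
apply: (@wp_seq2 _ _ _ _ _ _ _ (fun s2 => [/\ cand_st s2, arrs s s2, nv s2 11 0 = e + e, nv s2 12 0 = e + e + 1 &
    if (ta (f x) < 0)%R then nv s2 9 0 = c + c + 1 /\ nv s2 10 0 = c + c
    else nv s2 9 0 = c + c /\ nv s2 10 0 = c + c + 1])).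
  apply: wp_sx => //; first by rewrite /=; case: ifP.
  rewrite /= c26 t1 c25; case: ifP => ht /=; split=> //; by do 2![apply: cand_setn => //].
move=> s2 [hc2 [r1 r2 r3 r4] e11 e12 hp].
have [_ _ _ _ d25 d26 _ [u1 u2 u3]] := hc2.
apply: wp_seq; apply: wp_sx => //=; apply: wp_sx => //=.
rewrite d25 d26 u1 u2 r3 r4; set s3 := setr _ 24 _ _.
have hc3 : cand_st s3 by do 2![apply: cand_setr => //].
have a3 : arrs s s3 by [].
have ag3 := arrs_agree a3.
have cv le p v : cval le p v C' x s -> cval le p v C' x s3.
  move=> [[lst Cl [h1 h2]] hb]; split=> //; exists lst => //; split=> //.
  by apply: path_same h1 (ag3 _) _; have [h0 _] := ag3 p./2.+1; exact: h0.
split=> //; case: ltrP hp => ht [e9 e10].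
- exists (c + c + 1), (c + c); split; first split=> //.
  + by rewrite half_odd half_even.
  + rewrite /= e10; apply: cv; apply: cval_opt g1 g3 _ => a b z ab.
    by rewrite /le_max lerD2r; apply: ler_wnM2l => //; exact: ltW.
  + rewrite /= e9; apply: cv; apply: cval_opt g2 g3 _ => a b z ab.
    by rewrite /le_min lerD2r; apply: ler_wnM2l => //; exact: ltW.
- exists (c + c), (c + c + 1); split; first split=> //.
  + by rewrite half_odd half_even.
  + rewrite /= e10; apply: cv; apply: cval_opt g2 g3 _ => a b z ab.
    by rewrite /le_max lerD2r; exact: ler_wpM2l.
  + rewrite /= e9; apply: cv; apply: cval_opt g1 g3 _ => a b z ab.
    by rewrite /le_min lerD2r; exact: ler_wpM2l.
Qed.

Lemma apply_min_ok p0 p1 s : val_st p0 p1 s -> cval le_min p0 (rv s 23 0) C' x s ->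
  partial le_min (e + e) s ->
  wp n inp apply_min s (tm apply_min) (fun s' => [/\ val_st p0 p1 s', agree e s s',
    same_at (e + e + 1) s s' & opt le_min (plus_cand C C' x) (e + e) s']).
Proof.
move=> [hc v9 v10 v11 v12 [hp0 hp1] hmax] hmin hpart.
have [_ d22 _ _ _ d26 _ _] := hc.
have ee : e <= (e + e)./2 by rewrite half_even.
have post s' : agree e s s' -> val_st p0 p1 s' \/ cand_st s' /\ (forall a, a \in [:: 9; 10; 11; 12] -> nv s' a = nv s a) /\ rv s' 24 0 = rv s 24 0 -> val_st p0 p1 s'.
  move=> ha [//|[hc' [hn hr]]]; split; rewrite ?hn ?hr //.
  have [[lst Cl [h1 h2]] hb] := hmax; split=> //; exists lst => //; split=> //.
  apply: path_same h1 _ _; first by rewrite hp1; exact: agree_sub (ltnW ce) ha.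
  by have [h0 _] := ha; apply: h0; rewrite hp1.
set S1 := setn (setn (setr s 21 (e + e) (rv s 23 0)) 28 (e + e) p0) 29 (e + e) x.
have hS1 : (forall lst, C lst -> le_min (rv s 23 0) (bval lst)) ->
    [/\ val_st p0 p1 S1, agree e s S1, same_at (e + e + 1) s S1 & opt le_min (plus_cand C C' x) (e + e) S1].
  move=> hC; have ag : agree e s S1 by exact: agree_store.
  split=> //.
  - by apply: post => //; right; split; [exact: cand_store | split=> // a; rewrite !inE => /or4P[]/eqP->].
  - have ne : (e + e + 1 == e + e) = false by rewrite addn1 gtn_eqF.
    by split; rewrite /= eqbE ne.
  - apply: store_opt hmin hC _ _ _; rewrite ?half_even ?hp0 //.
    by split=> /=; rewrite eqbE eqxx.
have hS2 : opt le_min C (e + e) s -> le_min (rv s 21 (e + e)) (rv s 23 0) ->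
    let S2 := setr s 31 0 0%R in
    [/\ val_st p0 p1 S2, agree e s S2, same_at (e + e + 1) s S2 & opt le_min (plus_cand C C' x) (e + e) S2].
  move=> ho hv S2; have ag : agree e s S2 by exact: agree_setr.
  split=> //.
  - by apply: post => //; right; split; [exact: cand_setr | split].
  - by apply: (keep_opt _ hmin ho hv); rewrite ?half_even // => a b c'; exact: le_trans.
apply: wp_sx => //; first by rewrite /=; do 2?case: ifP.
rewrite /= d22 v11; case: hpart => [[-> hC]|[-> ho]] /=.
  by rewrite ?v11 v9 d26 -/S1; apply: hS1 => lst /hC.
case: ltrP => hlt /=; last exact: hS2.
rewrite ?v11 v9 d26 -/S1; apply: hS1 => lst Cl; have [_ hb] := ho.
by apply: le_trans (hb lst Cl); exact: ltW.
Qed.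

Lemma apply_max_ok p0 p1 s : val_st p0 p1 s -> partial le_max (e + e + 1) s ->
  wp n inp apply_max s (tm apply_max) (fun s' => [/\ cand_st s', agree e s s',
    same_at (e + e) s s' & opt le_max (plus_cand C C' x) (e + e + 1) s']).
Proof.
move=> [hc v9 v10 v11 v12 [hp0 hp1] hmax] hpart.
have [_ d22 _ _ _ d26 _ _] := hc.
have ee : e <= (e + e + 1)./2 by rewrite half_odd.
have ne : (e + e == e + e + 1) = false by rewrite addn1 ltn_eqF.
have tr : transitive le_max by move=> a b c' ab bc; exact: le_trans bc ab.
set S1 := setn (setn (setr s 21 (e + e + 1) (rv s 24 0)) 28 (e + e + 1) p1) 29 (e + e + 1) x.
have hS1 : (forall lst, C lst -> le_max (rv s 24 0) (bval lst)) ->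
    [/\ cand_st S1, agree e s S1, same_at (e + e) s S1 & opt le_max (plus_cand C C' x) (e + e + 1) S1].
  move=> hC; have ag : agree e s S1 by exact: agree_store.
  split=> //; first exact: cand_store.
  - by split; rewrite /= eqbE ne.
  - apply: store_opt hmax hC _ _ _; rewrite ?half_odd ?hp1 //.
    by split=> /=; rewrite eqbE eqxx.
have hS2 : opt le_max C (e + e + 1) s -> le_max (rv s 21 (e + e + 1)) (rv s 24 0) ->
    let S2 := setr s 31 0 0%R in
    [/\ cand_st S2, agree e s S2, same_at (e + e) s S2 & opt le_max (plus_cand C C' x) (e + e + 1) S2].
  move=> ho hv S2; have ag : agree e s S2 by exact: agree_setr.
  split=> //; first exact: cand_setr.
  by apply: (keep_opt tr hmax ho hv); rewrite ?half_odd.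
apply: wp_sx => //; first by rewrite /=; do 2?case: ifP.
rewrite /= d22 v12; case: hpart => [[-> hC]|[-> ho]] /=.
  by rewrite ?v12 v10 d26 -/S1; apply: hS1 => lst /hC.
case: ltrP => hlt /=; last exact: hS2.
rewrite ?v12 v10 d26 -/S1; apply: hS1 => lst Cl; have [_ hb] := ho.
by apply: le_trans (ltW hlt); exact: hb.
Qed.

Lemma apply_cand_ok s : cand_st s -> h = 0 /\ (forall lst, ~ C lst) \/ h = 1 /\ good s e C ->
  (forall lst, plus_cand C C' x lst -> cls S l len lst) ->
  wp n inp apply_cand s (tm apply_cand) (fun s' => [/\ cst s', nv s' 22 0 = 1, nv s' 23 0 = q,
    nv s' 24 0 = rem & good s' e (plus_cand C C' x)]).
Proof.
move=> hc hpart hcls.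
have hp s' : agree e s s' -> same_at (e + e) s s' -> partial le_min (e + e) s'.
  move=> ha hs; case: hpart => [h0|[h1 [g1 _ _]]]; [by left | right; split=> //].
  by apply: opt_same g1 _ hs; rewrite half_even.
have hp' s' : agree e s s' -> same_at (e + e + 1) s s' -> partial le_max (e + e + 1) s'.
  move=> ha hs; case: hpart => [h0|[h1 [_ g2 _]]]; [by left | right; split=> //].
  by apply: opt_same g2 _ hs; rewrite half_odd.
apply: (wp_seq2 (apply_values_ok hc)) => s1 [a1 [p0 [p1 [hv hmin]]]].
have ag1 := arrs_agree a1 e.
have sm1 p : same_at p s s1 by have [h1 _] := arrs_agree a1 (p./2.+1); exact: h1.
apply: (wp_seq2 (apply_min_ok hv hmin (hp _ ag1 (sm1 _)))) => s2 [hv2 ag2 sm2 o2].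
have ag12 : agree e s s2.
  split=> [p hp''|c' hc'].
    by have [k1 k2 k3] := ag2.1 p hp''; have [j1 j2 j3] := ag1.1 p hp''; split; rewrite ?k1 ?k2 ?k3.
  by rewrite ag2.2 // ag1.2.
have sm12 : same_at (e + e + 1) s s2.
  by have [k1 k2 k3] := sm2; have [j1 j2 j3] := sm1 (e + e + 1); split; rewrite ?k1 ?k2 ?k3.
apply: (wp_seq2 (apply_max_ok hv2 (hp' _ ag12 sm12))) => s3 [hc3 ag3 sm3 o3].
have [c3 c22 c23 c24 c25 c26 [g1 g2 g3] [t1 t2 t3]] := hc3.
have [_ _ _ _ c17 _] := c3.
apply: wp_sx => //=; rewrite c26 t3 c25 c17.
set s4 := setn _ 22 _ _.
have ag4 : agree e s3 s4.
  split=> [p _|c' lt]; first by split.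
  by rewrite /= eqbE (ltn_eqF lt).
have c4 : cst s4.
  apply: cst_setn => //; apply: (cst_same _ _ _ c3) => //.
  by move=> b b6; rewrite rv_setr //; move: b6; clear; lia.
split=> //; split.
- apply: (@opt_same _ _ _ s3) => //; last by rewrite half_even.
  apply: opt_same o2 _ sm3; by rewrite half_even.
- by apply: opt_same o3 _ _; rewrite ?half_odd.
- have [[lst Cl _] _] := g1.
  have hc0 : cls S l len (rcons lst x) by apply: hcls; right; exists lst.
  move=> lst' /hcls hl'; rewrite /= eqbE eqxx.
  by rewrite (g3 lst Cl) (cls_td hl' hc0) tprod_rcons.
Qed.

End Candidate.

Definition upto q lst := exists2 q', q' < q & via S l len q' lst.

Record scan q s : Prop := Scan { sc_c : cst s; sc23 : nv s 23 0 = q;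
  sc24 : nv s 24 0 = S %% 2 ^ (k - q);
  sc_h : nv s 22 0 = 0 /\ (forall q', q' < q -> ~~ enabled S len q') \/
         nv s 22 0 = 1 /\ good s e (upto q) }.

Lemma cand_body_ok q s : q < k + 2 -> scan q s ->
  wp n inp cand_body s (tm cand_body) (scan q.+1).
Proof.
move=> hq [hc h23 h24 hh].
apply: (wp_seq2 (select_ok hc h23 hq h24)) => s1 [c1 a1 [e23 e22] e24 [e27 hsel]].
apply: (@wp_seq2 _ _ _ _ _ _ _ (fun s2 => [/\ cst s2, nv s2 23 0 = q, nv s2 24 0 = S %% 2 ^ (k - q.+1) &
    nv s2 22 0 = 0 /\ (forall q', q' < q.+1 -> ~~ enabled S len q') \/
    nv s2 22 0 = 1 /\ good s2 e (upto q.+1)])).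
  apply: wp_if => //= [|]; rewrite e27.
  - case: (boolP (enabled S len q)) hsel => // hen /(_ isT) [C' [c [x [[h25 h26] ce g1 hx hv]]]] _.
    have hcand : cand_st q (S %% 2 ^ (k - q.+1)) (nv s 22 0) C' c x s1 by split.
    have hplus lst : plus_cand (upto q) C' x lst <-> upto q.+1 lst.
      split.
        move=> [[q' lq hq']|hl']; first by exists q' => //; exact: ltnW.
        by exists q => //; apply/hv.
      move=> [q']; rewrite ltnS leq_eqVlt => /predU1P[->|lq] hq'; last by left; exists q'.
      by right; apply/hv.
    apply: (@wp_weak _ _ _ _ _ _ _ _ (apply_cand_ok (C := upto q) ce hcand _ _) (leqnn _)).
    + case: hh => [[-> hn]|[-> hg]]; [left|right]; split=> //.
        by move=> lst [q' lq /via_enabled]; apply/negP; exact: hn.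
      exact: arrs_good a1 hg.
    + move=> lst /hplus[q' lq hq']; apply: via_cls hq'.
      by move: lq hq; clear; lia.
    + move=> s2 [d1 d2 d3 d4 d5]; split=> //; right; split=> //.
      exact: good_equiv hplus d5.
  - case: (boolP (enabled S len q)) => // hen _.
    apply: wp_sx => //=; split=> //; first exact: cst_setr.
    rewrite e22; case: hh => [[-> hn]|[-> hg]]; [left|right]; split=> //.
      by move=> q'; rewrite ltnS leq_eqVlt => /predU1P[->|/hn].
    have a2 : arrs s (setr s1 31 0 0%R) by have [k1 k2 k3 k4] := a1; split.
    apply: good_equiv (arrs_good a2 hg) => lst; split=> -[q' lq hq'].
      by exists q' => //; exact: ltnW.
    move: lq; rewrite ltnS leq_eqVlt => /predU1P[eq|lq]; last by exists q'.
    by move: (via_enabled hq'); rewrite eq (negPf hen).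
move=> s2 [c2 f23 f24 hh2]; apply: wp_sx => //=; rewrite f23; split=> //=.
- exact: cst_setn.
- by rewrite addn1.
- case: hh2 => [h0|[h1 g]]; [by left | right; split=> //].
  exact: (@arrs_good s2).
Qed.

Lemma cell_prog_ok s : cst s ->
  wp n inp cell_prog s ((tm cell_prog + tm cand_body) * (k + 3)) (fun s' => cst s' /\
    good s' e (cls S l len)).
Proof.
move=> hc; apply: wp_le.
- do 3![apply: wp_seq; apply: wp_sx => //=].
  apply: (@wp_seq2 _ _ _ _ _ _ _ (scan (k + 2))).
    apply: (@wp_for _ _ scan (k + 2) _ _ _ _ (tm cand_body)).
    + split=> //=; first by do 3![apply: cst_setn => //].
        by rewrite (cs14 hc) subn0 modn_small.
      by left.
    + move=> q s' hq hs; split; last exact: cand_body_ok.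
      by rewrite /= (sc23 hs) (dd_k (cs_d (sc_c hs))).
    + by move=> s' hs; rewrite /= (sc23 hs) (dd_k (cs_d (sc_c hs))) ltnn.
  move=> s' [hc' _ _ hh]; apply: wp_if => //= [|].
  - case: hh => [[-> //]|[_ g]] _; apply: wp_sx => //=; split; first exact: cst_setr.
    apply: good_equiv (_ : good _ e (upto (k + 2))); last first.
      by apply: (@arrs_good s').
    move=> lst; split; first by move=> [q' lq]; exact: via_cls.
    move=> /cls_via[[_ S0 len0]|//].
    have [[[lst' [q' lq /via_enabled hen] _] _] _ _] := g.
    by move: hen; rewrite /enabled S0 len0 /bit div0n; case: ifP.
  - case: hh => [[h0 hen]|[-> //]] _.
    (* No candidate is enabled only for the empty set and the empty arc, where [base_cell] writes
       the data of the empty product. *)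
    have [S0 len0] := enabled_base hS hen.
    have hb lst : cls S l len lst <-> lst = [::].
      split=> [/cls_via[[] //|[q' lq /via_enabled]]|->].
        by rewrite (negPf (hen q' lq)).
      by rewrite S0 len0; exact: grow_nil.
    apply: wp_sx => //=; rewrite (cs17 hc').
    have ne : (e + e == e + e + 1) = false by rewrite addn1 ltn_eqF.
    split.
      apply: (cst_same _ _ _ hc') => //.
        by move=> a a6; rewrite !rv_setr //; move: a6; clear; lia.
      split=> [p hp|c hcc].
        have n1 : (p == e + e) = false by apply/eqP => h; move: hp; rewrite h half_even ltnn.
        have n2 : (p == e + e + 1) = false by apply/eqP => h; move: hp; rewrite h half_odd ltnn.
        by split; rewrite //= !eqbE n1 n2.
      by rewrite /= eqbE (ltn_eqF hcc).
    split.
    + split; first by exists [::]; [exact/hb | split; [exact: path_nil | rewrite /= !eqbE ne eqxx]].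
      by move=> lst /hb->; rewrite /le_min /= !eqbE ne eqxx.
    + split; first by exists [::]; [exact/hb | split; [exact: path_nil | rewrite /= !eqbE eqxx]].
      by move=> lst /hb->; rewrite /le_max /= !eqbE eqxx.
    + by move=> lst /hb->; rewrite /= eqbE eqxx.
- have -> : tm cell_prog = tm (22 ::= Cst 0) + (tm (24 ::= V 14) + (tm (23 ::= Cst 0) +
    ((size (ccond (NLess (V 23) (Plus (V 5) (Cst 2)))).1 + 2 + tm cand_body) +
     tm (If (NLess (Cst 0) (V 22)) NOP base_cell)))) by [].
  rewrite -[tm (If _ _ _)]/(size (ccond (NLess (Cst 0) (V 22))).1 + 1 + (tm NOP + tm base_cell) + 1).
  move: (tm (22 ::= _)) (tm (24 ::= _)) (tm (23 ::= _)) (size (ccond (NLess (V 23) _)).1) (tm cand_body)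
    (size (ccond (NLess (Cst 0) _)).1) (tm NOP) (tm base_cell); clear; nia.
Qed.

End Cell.

(** * The loops over all cells *)

Lemma cell_inj S len l S' len' l' : len <= m -> len' <= m -> l < L2 -> l' < L2 ->
  cell S len l = cell S' len' l' -> [/\ S = S', len = len' & l = l'].
Proof.
move=> h1 h2 h3 h4 h.
have L0 : 0 < L2 by apply: leq_ltn_trans h3.
have el : l = l' by have := congr1 (modn^~ L2) h; rewrite /cell !modnMDl !modn_small.
have er : S * (m + 1) + len = S' * (m + 1) + len'.
  by have := congr1 (divn^~ L2) h; rewrite /cell !divnMDl // !divn_small // !addn0.
have elen : len = len'.
  by have := congr1 (modn^~ (m + 1)) er; rewrite !modnMDl !modn_small // addn1 ltnS.
split=> //; move/eqP: er; rewrite elen eqn_add2r eqn_pmul2r ?addn1 //.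
by move/eqP.
Qed.

Lemma dpinvS S len l s : len <= m -> l < L2 -> dpinv (cell S len l) s ->
  (l + len <= m + m -> good s (cell S len l) (cls S l len)) -> dpinv (cell S len l).+1 s.
Proof.
move=> hlen hl hinv hg S' len' l' h1 h2 h3; rewrite ltnS leq_eqVlt => /predU1P[eq|]; last exact: hinv.
have [||||eS el ell] := cell_inj _ _ _ _ eq => //; first by rewrite /L2; move: h3; clear; lia.
by move: h3; rewrite eS el ell; exact: hg.
Qed.

Record mst S len l s : Prop := MSt { ms_d : ddata s; ms14 : nv s 14 0 = S; ms15 : nv s 15 0 = len;
  ms16 : nv s 16 0 = l; ms17 : nv s 17 0 = cell S len l; ms_inv : dpinv (cell S len l) s }.

Lemma dpinv_arrs e s s' : arrs s s' -> dpinv e s -> dpinv e s'.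
Proof. by move=> h; apply: dpinv_agree; exact: arrs_agree. Qed.

Lemma ddata_setn s a i v : ddata s -> a \notin dframe -> ddata (setn s a i v).
Proof.
move=> hd ha; apply: ddata_same hd => // b hb; rewrite nv_setn //.
by apply: contraTneq hb => ->.
Qed.

Lemma cellS S len l : cell S len l.+1 = (cell S len l).+1.
Proof. by rewrite /cell [LHS]addnS. Qed.

Definition Kl := tm l_body + tm cand_body.

Lemma l_body_ok S len l s : S < 2 ^ k -> len <= m -> l < L2 -> mst S len l s ->
  wp n inp l_body s (Kl * (k + 3)) (mst S len l.+1).
Proof.
move=> hS hlen hl [d h14 h15 h16 h17 hinv]; apply: wp_le.
- apply: (@wp_seq2 _ _ _ _ _ _ _ (fun s' => [/\ ddata s', nv s' 14 0 = S, nv s' 15 0 = len,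
     nv s' 16 0 = l /\ nv s' 17 0 = cell S len l & dpinv (cell S len l).+1 s'])).
    apply: wp_if => //= [|]; rewrite h16 h15 (dd_L d) ?addn1 ?ltnS.
      move=> hv; have hc : cst S len l s by split.
      apply: wp_weak (cell_prog_ok hS hlen _ hc) (leqnn _) _; first by move: hv; rewrite /L2 addn1 ltnS.
      move=> s' [[c1 c2 c3 c4 c5 c6] g]; split=> //.
      by apply: dpinvS.
    rewrite -leqNgt => hv; apply: wp_sx => //=; split=> //.
      by apply: ddata_same d => // a a6; rewrite rv_setr //; move: a6; clear; lia.
    apply: dpinvS => //; first exact: (@dpinv_arrs _ s).
    by move: hv; rewrite /L2; clear; lia.
  move=> s' [d' g14 g15 [g16 g17] ginv].
  apply: wp_sx => //=; rewrite g16 g17; split=> //=.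
  - by do 2![apply: ddata_setn => //].
  - by rewrite addn1.
  - by rewrite addn1 cellS.
  - by rewrite cellS; exact: (@dpinv_arrs _ s').
- rewrite -[tm (Seq _ _)]/(tm (nincr 17) + tm (nincr 16)) /Kl.
  have -> : tm l_body = (size (ccond (NLess (Plus (V 16) (V 15)) (V 18))).1 + 1 + (tm cell_prog + tm NOP) + 1) +
    (tm (nincr 17) + tm (nincr 16)) by [].
  move: (size _) (tm cell_prog) (tm NOP) (tm (nincr 17)) (tm (nincr 16)) (tm cand_body); clear; nia.
Qed.

(** Rows follow each other without gaps, and so do the tables of successive sets; hence the cell
    number is only ever incremented. *)
Lemma cell_row S len : cell S len L2 = cell S len.+1 0.
Proof. by rewrite /cell [_ + len.+1]addnS mulSn addn0 addnC. Qed.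

Lemma cell_set S : cell S (m + 1) 0 = cell S.+1 0 0.
Proof. by rewrite /cell mulSn !addn0 addnC. Qed.

Definition Klen := Kl + tm len_body.

Lemma len_body_ok S len s : S < 2 ^ k -> len <= m ->
  ddata s -> nv s 14 0 = S -> nv s 15 0 = len -> nv s 17 0 = cell S len 0 -> dpinv (cell S len 0) s ->
  wp n inp len_body s (Klen * ((k + 3) * L2.+1)) (fun s' =>
    [/\ ddata s', nv s' 14 0 = S, nv s' 15 0 = len.+1, nv s' 17 0 = cell S len.+1 0 &
     dpinv (cell S len.+1 0) s']).
Proof.
move=> hS hlen d h14 h15 h17 hinv; apply: wp_le.
- apply: wp_seq; apply: wp_sx => //=.
  apply: (@wp_seq2 _ _ _ _ _ _ _ (mst S len L2)).
    apply: (@wp_for _ _ (mst S len) L2 _ _ _ _ (Kl * (k + 3))).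
    + by split=> //; [exact: ddata_setn | exact: (@dpinv_arrs _ s)].
    + move=> l s' hl hm; split; last exact: (l_body_ok hS hlen hl hm).
      by rewrite /= (ms16 hm) (dd_L (ms_d hm)).
    + by move=> s' hm; rewrite /= (ms16 hm) (dd_L (ms_d hm)) ltnn.
  move=> s' [d' g14 g15 g16 g17 ginv]; apply: wp_sx => //=; rewrite g15.
  by split=> //=; rewrite ?addn1 -?cell_row //; [exact: ddata_setn | exact: (@dpinv_arrs _ s')].
- have -> : Klen = Kl + (tm (16 ::= Cst 0) + ((size (ccond (NLess (V 16) (V 18))).1 + 2 + tm l_body) + tm (nincr 15))) by [].
  move: (tm (16 ::= _)) (tm (nincr 15)) (size _) (tm l_body) => a b c d'.
  move: Kl => K; move: (L2) => L; clear; nia.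
Qed.

Definition Kset := Klen + tm set_body.

Lemma set_body_ok S s : S < 2 ^ k ->
  ddata s -> nv s 14 0 = S -> nv s 17 0 = cell S 0 0 -> dpinv (cell S 0 0) s ->
  wp n inp set_body s (Kset * ((k + 3) * L2.+1 * (m + 2))) (fun s' =>
    [/\ ddata s', nv s' 14 0 = S.+1, nv s' 17 0 = cell S.+1 0 0 & dpinv (cell S.+1 0 0) s']).
Proof.
move=> hS d h14 h17 hinv; apply: wp_le.
- apply: wp_seq; apply: wp_sx => //=.
  pose I len s' := [/\ ddata s', nv s' 14 0 = S, nv s' 15 0 = len, nv s' 17 0 = cell S len 0 &
     dpinv (cell S len 0) s'].
  apply: (@wp_seq2 _ _ _ _ _ _ _ (I (m + 1))).
    apply: (@wp_for _ _ I (m + 1) _ _ _ _ (Klen * ((k + 3) * L2.+1))).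
    + by split=> //; [exact: ddata_setn | exact: (@dpinv_arrs _ s)].
    + move=> len s' hl [i1 i2 i3 i4 i5]; split; first by rewrite /= i3 (dd_m i1).
      by apply: len_body_ok => //; move: hl; rewrite addn1.
    + by move=> s' hI; have [i1 i2 i3 i4 i5] := hI; rewrite /= i3 (dd_m i1) ltnn.
  move=> s' [d' g14 g15 g17 ginv]; apply: wp_sx => //=; rewrite g14.
  by split=> //=; rewrite ?addn1 -?cell_set //; [exact: ddata_setn | exact: (@dpinv_arrs _ s')].
- have -> : Kset = Klen + (tm (15 ::= Cst 0) + ((size (ccond (NLess (V 15) (Plus (V 4) (Cst 1)))).1 + 2 + tm len_body) + tm (nincr 14))) by [].
  move: (tm (15 ::= _)) (tm (nincr 14)) (size _) (tm len_body) => a b c d'.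
  move: Klen => K; have : 0 < (k + 3) * L2.+1 by rewrite addn3.
  by move: (_ * L2.+1) => X; clear; nia.
Qed.

Definition Kmain := Kset + tm dp_main.

Lemma dp_main_ok s : ddata s ->
  wp n inp dp_main s (Kmain * ((k + 3) * L2.+1 * (m + 2) * (2 ^ k).+1)) (fun s' =>
    [/\ ddata s', nv s' 17 0 = cell (2 ^ k) 0 0 & dpinv (cell (2 ^ k) 0 0) s']).
Proof.
move=> d; apply: wp_le.
- do 2![apply: wp_seq; apply: wp_sx => //=].
  pose I S s' := [/\ ddata s', nv s' 14 0 = S, nv s' 17 0 = cell S 0 0 & dpinv (cell S 0 0) s'].
  apply: (@wp_for _ _ I (2 ^ k) _ _ _ _ (Kset * ((k + 3) * L2.+1 * (m + 2)))).
  + by split=> //; do 2![apply: ddata_setn => //].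
  + move=> S s' hS [i1 i2 i3 i4]; split; last exact: set_body_ok.
    by rewrite /= i2 (dd_k i1) (dd_p2 i1).
  + by move=> s' [i1 i2 i3 i4]; rewrite /= i2 (dd_k i1) (dd_p2 i1) // ltnn.
- have -> : Kmain = Kset + (tm (17 ::= Cst 0) + (tm (14 ::= Cst 0) + (size (ccond (NLess (V 14) (Get 20 (V 5)))).1 + 2 + tm set_body))) by [].
  move: (tm (17 ::= _)) (tm (14 ::= _)) (size _) (tm set_body) => a b c d'.
  move: Kset => K; have : 0 < (k + 3) * L2.+1 * (m + 2) by rewrite addn3 addn2.
  by move: (_ * (m + 2)) (2 ^ k) => X W; clear; nia.
Qed.

Definition Ksetup := tm dp_setup + tm double_body + tm stride_body + tm power_body.

Lemma dp_setup_ok s : nv s 0 0 = n -> nv s 4 0 = m -> nv s 5 0 = k -> holds_arr s 7 pos ->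
  holds_arr s 6 neg -> (forall x, x \in pos ++ neg -> holds_tri s x (f x)) ->
  wp n inp dp_setup s (Ksetup * (m + k + 3)) ddata.
Proof.
move=> h0 h4 h5 h7 h6 hx; apply: wp_le.
- pose fr s' := [/\ nv s' 0 0 = n, nv s' 4 0 = m, nv s' 5 0 = k, holds_arr s' 6 neg & rv s' = rv s].
  apply: wp_seq; apply: wp_sx => //=.
  apply: (@wp_seq2 _ _ _ _ _ _ _ (fun s' => fr s' /\ forall t, t < m + m -> nv s' 7 t = idx t)).
    pose I i s' := [/\ fr s', nv s' 2 0 = i & forall t, t < m + i -> nv s' 7 t = idx t].
    apply: (@wp_for _ _ I m _ _ _ _ (tm double_body)).
    + by split=> // t; rewrite addn0 => tm0; rewrite /idx nth_cat -/m tm0; exact: h7.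
    + move=> i s' im [[f0 f4 f5 f6 fr'] f2 f7]; split; first by rewrite /= f2 f4.
      have iv : nv s' 7 i = nth 0 pos i.
        by rewrite f7 ?ltn_addr // /idx nth_cat -/m im.
      apply: wp_sx => //=; rewrite f2 f4 iv; split=> //=; first by rewrite addn1.
      move=> t; rewrite addnS ltnS leq_eqVlt eqbE [i + m]addnC => /predU1P[->|lt].
        by rewrite eqxx /idx nth_cat -/m ltnNge leq_addr /= addKn.
      by rewrite (ltn_eqF lt) f7.
    + by move=> s' [hf f2 f7]; have [_ f4 _ _ _] := hf; rewrite /= f2 f4 ltnn.
  move=> s1 [[f0 f4 f5 f6 fr1] f7].
  do 3![apply: wp_seq; apply: wp_sx => //=]; rewrite f4 -/L2.
  pose fr2 s' := [/\ fr s', forall t, t < m + m -> nv s' 7 t = idx t & nv s' 18 0 = L2].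
  apply: (@wp_seq2 _ _ _ _ _ _ _ (fun s' => fr2 s' /\ nv s' 19 0 = ST)).
    pose I i s' := [/\ fr2 s', nv s' 2 0 = i & nv s' 19 0 = i * L2].
    apply: (@wp_for _ _ I (m + 1) _ _ _ _ (tm stride_body)).
    + by split=> //.
    + move=> i s' im [[[g0 g4 g5 g6 gr] g7 g18] g2 g19]; split; first by rewrite /= g2 g4.
      apply: wp_sx => //=; rewrite g19 g18 g2; split=> //=; first by rewrite addn1.
      by rewrite mulSn addnC.
    + by move=> s' [hf g2 g19]; have [[_ g4 _ _ _] _ _] := hf; rewrite /= g2 g4 ltnn.
  move=> s2 [[[g0 g4 g5 g6 gr] g7 g18] g19].
  do 3![apply: wp_seq; apply: wp_sx => //=]; rewrite g19.
  pose I i s' := [/\ fr2 s', nv s' 2 0 = i, forall j, j <= i -> nv s' 20 j = 2 ^ j &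
     forall j, j <= i -> nv s' 21 j = 2 ^ j * ST].
  apply: (@wp_for _ _ I k _ _ _ _ (tm power_body)).
  + split=> //= j; rewrite leqn0 => /eqP->; by rewrite ?expn0 ?mul1n.
  + move=> i s' ik [[[j0 j4 j5 j6 jr] j7 j18] j2 j20 j21]; split; first by rewrite /= j2 j5.
    apply: wp_sx => //=; rewrite j2 j20 // j21 // addn1; split=> //=.
    * move=> j; rewrite leq_eqVlt eqbE => /predU1P[->|lt]; first by rewrite eqxx expnS mul2n addnn.
      by rewrite (ltn_eqF lt) j20.
    * move=> j; rewrite leq_eqVlt eqbE => /predU1P[->|lt].
        by rewrite eqxx expnS -mulnA mul2n addnn.
      by rewrite (ltn_eqF lt) j21.
  + move=> s' [hf j2 j20 j21]; have [[j0 j4 j5 j6 jr] j7 j18] := hf.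
    rewrite /= j2 j5 ltnn; split=> //; split=> //.
    by move=> x /hx; rewrite /holds_tri jr.
- have -> : Ksetup = (tm (2 ::= Cst 0) + ((size (ccond (NLess (V 2) (V 4))).1 + 2 + tm double_body) +
    (tm (18 ::= Plus (Plus (V 4) (V 4)) (Cst 1)) + (tm (19 ::= Cst 0) + (tm (2 ::= Cst 0) +
     ((size (ccond (NLess (V 2) (Plus (V 4) (Cst 1)))).1 + 2 + tm stride_body) +
     (tm (20 ::= Cst 1) + (tm (21 ::= V 19) + (tm (2 ::= Cst 0) +
      (size (ccond (NLess (V 2) (V 5))).1 + 2 + tm power_body)))))))))) + tm double_body + tm stride_body + tm power_body by [].
  move: (tm (2 ::= _)) (tm (18 ::= _)) (tm (19 ::= _)) (tm (20 ::= _)) (tm (21 ::= _)).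
  move: (size (ccond (NLess (V 2) (V 4))).1) (size (ccond (NLess (V 2) (V 5))).1) (size _).
  move: (tm double_body) (tm stride_body) (tm power_body) (m) (k); clear; nia.
Qed.

Lemma path_arrs s s' p lst : nv s' 28 = nv s 28 -> nv s' 29 = nv s 29 -> path s p lst -> path s' p lst.
Proof.
move=> e1 e2; elim=> {p lst} [p|p lst hp _ IH]; first exact: path_nil.
by rewrite -e2; apply: path_rcons; rewrite e1.
Qed.

Lemma path_inv s p lst x : path s p (rcons lst x) -> x = nv s 29 p /\ path s (nv s 28 p) lst.
Proof.
move=> h; suff : forall l0, path s p l0 -> l0 = rcons lst x -> x = nv s 29 p /\ path s (nv s 28 p) lst.
  by move=> /(_ _ h erefl).
move=> l0; case=> {p l0 h} [p|p l0 _ h]; first by case: lst.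
by move=> /rcons_inj[<- <-].
Qed.

Definition Kfinal := tm dp_final + tm final_body + tm trace_body.

Lemma dp_final_ok s : m + k = n -> ddata s -> nv s 17 0 = cell (2 ^ k) 0 0 ->
  dpinv (cell (2 ^ k) 0 0) s ->
  wp n inp dp_final s (Kfinal * (m + n + 3)) (fun s' => nv s' 0 0 = n /\
    exists lst l0, [/\ forall t, t < n -> nv s' OUT (n + t) = nth 0 lst t, l0 <= m,
      cls (2 ^ k).-1 l0 m lst & forall l lst', l <= m -> cls (2 ^ k).-1 l m lst' ->
      (bval lst <= bval lst')%R]).
Proof.
move=> hn d h17 hinv; apply: wp_le.
- have p2 : (2 ^ k).-1.+1 = 2 ^ k by rewrite prednK // expn_gt0.
  set base := cell (2 ^ k).-1 m 0.
  have eb l : base + l = cell (2 ^ k).-1 m l by rewrite /base /cell addn0.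
  (* The counter stands just past the last cell. One row earlier begins the row of the full set and
     the full length, whose entries [l <= m] are the possible starting points of the arc. *)
  have e1 : cell (2 ^ k) 0 0 = base + L2.
    by rewrite -p2 -cell_set eb cell_row addn1.
  have hg l : l <= m -> good s (base + l) (cls (2 ^ k).-1 l m).
    move=> lm; rewrite eb; apply: hinv => //.
    - by rewrite p2.
    - by rewrite leq_add2r.
    - by rewrite e1 -eb ltn_add2l /L2 addn1 ltnS; apply: leq_trans lm _; exact: leq_addr.
  do 3![apply: wp_seq; apply: wp_sx => //=]; rewrite h17 (dd_L d) e1 addnK.
  pose fr s' := [/\ ddata s', nv s' 2 0 = base, arrs s s' & exists2 l0, l0 <= m & nv s' 25 0 = base + l0].
  apply: (@wp_seq2 _ _ _ _ _ _ _ (fun s' => fr s' /\ forall l, l <= m ->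
      (rv s 21 (nv s' 25 0 + nv s' 25 0) <= rv s 21 (base + l + (base + l)))%R)).
    pose I i s' := [/\ fr s', nv s' 16 0 = i & forall l, l < i ->
      (rv s 21 (nv s' 25 0 + nv s' 25 0) <= rv s 21 (base + l + (base + l)))%R].
    apply: (@wp_for _ _ I (m + 1) _ _ _ _ (tm final_body)).
    + split=> //; split=> //; first by do 3![apply: ddata_setn => //].
      by exists 0; rewrite ?addn0.
    + move=> i s' im [[f1 f2 f3 [l0 hl0 f25]] f16 fm]; split; first by rewrite /= f16 (dd_m f1).
      have [a1 a2 a3 a4] := f3.
      apply: wp_sx => //=; first by case: ifP.
      rewrite f2 f16 a3 f25; case: ltrP => hlt /=; split=> //=.
      * split=> //; first by do 3![apply: ddata_setn => //].
        by exists i => //; move: im; rewrite addn1.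
      * by rewrite f16 addn1.
      * move=> l; rewrite ltnS leq_eqVlt => /predU1P[->//|/fm]; rewrite f25.
        by apply: le_trans; exact: ltW.
      * split=> //; last by exists l0.
        apply: ddata_setn => //; apply: (@ddata_same (setn s' 9 0 (base + i))) => //; last exact: ddata_setn.
        by move=> a a6; rewrite rv_setr //; move: a6; clear; lia.
      * by rewrite f16 addn1.
      * by move=> l; rewrite f25 ltnS leq_eqVlt => /predU1P[->//|/fm]; rewrite f25.
    + move=> s' [hf f16 fm]; have [f1 _ _ _] := hf; rewrite /= f16 (dd_m f1) ltnn; split=> //.
      by split=> // l lm; apply: fm; rewrite addn1.
  move=> s1 [[f1 f2 f3 [l0 hl0 f25]] fm].
  have [[[lst Cl [hpath hval]] hb] _ _] := hg l0 hl0.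
  have hsz : size lst = n.
    have := grow_perm Cl => /perm_size->; rewrite size_cat !size_map size_iota -hn.
    congr (_ + _); rewrite (@eq_in_filter _ _ predT) ?filter_predT ?size_iota // => j.
    by rewrite mem_iota add0n => jk; rewrite bit_full.
  do 2![apply: wp_seq; apply: wp_sx => //=]; rewrite f25 (dd_n f1).
  pose J i s' := [/\ nv s' 0 0 = n, nv s' 10 0 = n - i, path s' (nv s' 26 0) (take (n - i) lst) &
    forall t, n - i <= t < n -> nv s' OUT (n + t) = nth 0 lst t].
  apply: (@wp_for _ _ J n _ _ _ _ (tm trace_body)).
  + split=> /=; rewrite ?subn0 ?(dd_n f1) //.
    - rewrite -hsz take_size; have [a1 a2 _ _] := f3.
      by apply: (path_arrs _ _ hpath); rewrite /= ?a1 ?a2.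
    - by move=> t /andP[h1 h2]; move: (leq_trans h2 h1); rewrite ltnn.
  + move=> i s' iltn [j0 j10 j26 jo]; split; first by rewrite /= j10 subn_gt0.
    have e2 : n - i - 1 = n - i.+1 by clear; lia.
    have e3 : n - i = (n - i.+1).+1 by rewrite subnSK.
    have lt : n - i.+1 < size lst by rewrite hsz; move: iltn; clear; lia.
    move: j26; rewrite e3 (take_nth 0) // => /path_inv[hx hp].
    apply: wp_sx => //=; rewrite j10 j0 e2 -hx; split=> //=.
    - exact: (path_arrs _ _ hp).
    - move=> t /andP[t1 t2]; rewrite eqbE eqn_add2l; case: eqP => [->//|/eqP ne] /=.
      by apply: jo; rewrite t2 andbT e3 ltn_neqAle eq_sym ne.
  + move=> s' [j0 j10 _ jo]; rewrite /= j10 subnn; split=> //; split=> //.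
    exists lst, l0; split=> //; first by move=> t tn; apply: jo; rewrite subnn.
    move=> l lst' lm Cl'; have [[_ hb'] _ _] := hg l lm.
    by rewrite -hval -f25; apply: le_trans (fm l lm) (hb' lst' Cl').
- have -> : Kfinal = (tm (2 ::= Minus (V 17) (V 18)) + (tm (25 ::= V 2) + (tm (16 ::= Cst 0) +
    ((size (ccond (NLess (V 16) (Plus (V 4) (Cst 1)))).1 + 2 + tm final_body) +
     (tm (26 ::= Plus (V 25) (V 25)) + (tm (10 ::= V 0) + (size (ccond (NLess (Cst 0) (V 10))).1 + 2 + tm trace_body))))))) +
     tm final_body + tm trace_body by [].
  move: (tm (2 ::= _)) (tm (25 ::= _)) (tm (16 ::= _)) (tm (26 ::= _)) (tm (10 ::= _)).
  move: (size (ccond (NLess (V 16) _)).1) (size (ccond (NLess (Cst 0) _)).1).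
  move: (tm final_body) (tm trace_body) (m); clear; nia.
Qed.

End DP.

Local Open Scope ring_scope.

(** * Correctness of the triangular form *)

Section CommonEigenvector.
Variables (n : nat) (inp : nat -> R) (e : R * R) (lam : nat -> R).
Hypothesis e_neq0 : (e.1 != 0) || (e.2 != 0).
Let a0 i := m_ inp i 0.
Let a1 i := m_ inp i 1.
Let a2 i := m_ inp i 2.
Let a3 i := m_ inp i 3.
Hypothesis eigen1 : forall i, (i < n)%N -> a0 i * e.1 + a1 i * e.2 = lam i * e.1.
Hypothesis eigen2 : forall i, (i < n)%N -> a2 i * e.1 + a3 i * e.2 = lam i * e.2.

Definition commuting i j :=
  [/\ comm21 inp i j = 0, comm11 inp i j = 0 & comm12 inp i j = 0].

Lemma sqr_gt0 (x : R) : (0 < x * x) = (x != 0).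
Proof. by rewrite -expr2 exprn_even_gt0. Qed.

Lemma nonscalarP i : reflect (exists2 z, z != 0 & z \in [:: a0 i - a3 i; a1 i; a2 i]) (nonscalar inp i).
Proof.
rewrite /nonscalar -/(a0 i) -/(a1 i) -/(a2 i) -/(a3 i).
set x := _ - _; have := sqr_ge0 x; have := sqr_ge0 (a1 i); have := sqr_ge0 (a2 i).
rewrite !expr2 => h2 h1 hx; apply: (iffP idP).
- move=> h; case: (eqVneq x 0) => [x0|]; last by exists x; rewrite ?mem_head.
  case: (eqVneq (a1 i) 0) => [y0|]; last by exists (a1 i); rewrite ?inE ?eqxx ?orbT.
  case: (eqVneq (a2 i) 0) => [z0|]; last by exists (a2 i); rewrite ?inE ?eqxx ?orbT.
  by move: h; rewrite x0 y0 z0 !mul0r !addr0 ltxx.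
- move=> [z z0]; rewrite !inE => /or3P[] /eqP ez; move: z0; rewrite ez -sqr_gt0; lra.
Qed.

(** The two rows of the commutator applied to the common eigenvector; its lower right entry is the
    opposite of [comm11]. Both identities are combinations of the eigenvector equations. *)
Lemma commuting_e p i : (p < n)%N -> (i < n)%N ->
  comm11 inp p i * e.1 + comm12 inp p i * e.2 = 0 /\
  comm21 inp p i * e.1 = comm11 inp p i * e.2.
Proof.
move=> pn iN; have := eigen1 pn; have := eigen2 pn; have := eigen1 iN; have := eigen2 iN.
rewrite /comm11 /comm12 /comm21 -/(a0 p) -/(a1 p) -/(a2 p) -/(a3 p) -/(a0 i) -/(a1 i) -/(a2 i) -/(a3 i).
move=> i2 i1 p2 p1; split.
- transitivity (a0 p * (a0 i * e.1 + a1 i * e.2 - lam i * e.1) + a1 p * (a2 i * e.1 + a3 i * e.2 - lam i * e.2)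
   - a0 i * (a0 p * e.1 + a1 p * e.2 - lam p * e.1) - a1 i * (a2 p * e.1 + a3 p * e.2 - lam p * e.2)
   + lam i * (a0 p * e.1 + a1 p * e.2 - lam p * e.1) - lam p * (a0 i * e.1 + a1 i * e.2 - lam i * e.1)); first by ring.
  by rewrite i1 i2 p1 p2; ring.
- apply/eqP; rewrite -subr_eq0; apply/eqP.
  transitivity (a2 p * (a0 i * e.1 + a1 i * e.2 - lam i * e.1) + a3 p * (a2 i * e.1 + a3 i * e.2 - lam i * e.2)
   - a2 i * (a0 p * e.1 + a1 p * e.2 - lam p * e.1) - a3 i * (a2 p * e.1 + a3 p * e.2 - lam p * e.2)
   + lam i * (a2 p * e.1 + a3 p * e.2 - lam p * e.2) - lam p * (a2 i * e.1 + a3 i * e.2 - lam i * e.2)); first by ring.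
  by rewrite i1 i2 p1 p2; ring.
Qed.

Definition parallel (v : R * R) := v.1 * e.2 = v.2 * e.1.

Lemma eigen_iter_inv i : (i <= n)%N -> let z := eigen_iter inp i in
  parallel z.2 /\ (z.2 != (0, 0) \/
    [/\ z.2 = (0, 0), forall j, (j < i)%N -> commuting z.1 j &
        nonscalar inp z.1 \/ forall j, (j < i)%N -> ~~ nonscalar inp j]).
Proof.
elim: i => [|i IH] iN; first by split; [rewrite /parallel /= !mul0r | right; split=> //; right].
have [par IHv] := IH (ltnW iN); rewrite eigen_iterS; have := eigen_piv_le inp i.
move: (eigen_iter inp i) par IHv => [p v] /= par IHv pi.
set q := if _ then p else i; have qi : (q <= i)%N by rewrite /q; case: ifP.
have [c1 c2] := commuting_e (leq_ltn_trans qi iN) iN.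
rewrite !sqr_gt0; case: (eqVneq (comm21 inp q i) 0) c1 c2 => [z21|nz21] c1 c2 /=; last first.
  by split; [rewrite /parallel /= -c2 | left; rewrite xpair_eqE (negPf nz21) andbF].
case: (eqVneq (comm12 inp q i) 0) c1 c2 => [z12|nz12] c1 c2 /=; last first.
  have z2 : e.2 = 0.
    case: (eqVneq e.2 0) => // ne2; move: c2; rewrite z21 mul0r => /esym/eqP.
    rewrite mulf_eq0 (negPf ne2) orbF => /eqP z11; move: c1; rewrite z11 mul0r add0r => /eqP.
    by rewrite mulf_eq0 (negPf nz12) (negPf ne2).
  by split; [rewrite /parallel /= z2 mulr0 mul0r | left; rewrite xpair_eqE (negPf nz12)].
split=> //; case: IHv => [|[v0 hc hs]]; [by left | right; split=> //].
- have z11 : comm11 inp q i = 0.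
    move: c1 c2; rewrite z12 z21 !mul0r addr0 => /eqP h1 /esym/eqP h2.
    by move: e_neq0 h1 h2; rewrite !mulf_eq0; case: (comm11 inp q i =P 0) => //= _ /orP[] /negPf->.
  move=> j; rewrite ltnS leq_eqVlt => /predU1P[->//|ji].
  (* A change of pivot at i means that all earlier matrices are scalar, and these commute with the
     new pivot. *)
  rewrite /q; case: ifP => hq; first exact: hc.
  case: hs => [|hs]; first by rewrite hq.
  have h z : z \in [:: a0 j - a3 j; a1 j; a2 j] -> z = 0.
    by move=> hz; apply/eqP; apply: contraNT (hs j ji) => nz; apply/nonscalarP; exists z.
  have h1 : a0 j = a3 j by apply/eqP; rewrite -subr_eq0; apply/eqP; apply: h; rewrite mem_head.
  have h2 : a1 j = 0 by apply: h; rewrite !inE eqxx ?orbT.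
  have h3 : a2 j = 0 by apply: h; rewrite !inE eqxx ?orbT.
  by rewrite /commuting /comm21 /comm11 /comm12 -/(a0 j) -/(a1 j) -/(a2 j) -/(a3 j) h1 h2 h3; split; ring.
- rewrite /q; case: ifP => hq; first by left.
  case: (boolP (nonscalar inp i)) => ni; [by left | right].
  move=> j; rewrite ltnS leq_eqVlt => /predU1P[->//|]; case: hs => [|hs]; [by rewrite hq | exact: hs].
Qed.

(** Two matrices commute when their vectors [(a0 - a3, a1, a2)] are parallel, and being parallel is
    transitive through the nonzero vector of p. *)
Lemma commuting_trans p i j : nonscalar inp p -> commuting p i -> commuting p j -> commuting i j.
Proof.
move=> /nonscalarP[z z0]; rewrite /commuting /comm21 /comm11 /comm12.
rewrite -/(a0 p) -/(a1 p) -/(a2 p) -/(a3 p) -/(a0 j) -/(a1 j) -/(a2 j) -/(a3 j) -/(a0 i) -/(a1 i) -/(a2 i) -/(a3 i).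
move=> hz [i21 i11 i12] [j21 j11 j12].
have i21' : a2 p * (a0 i - a3 i) = a2 i * (a0 p - a3 p) by move: i21; lra.
have i12' : a1 p * (a0 i - a3 i) = a1 i * (a0 p - a3 p) by move: i12; lra.
have i11' : a1 p * a2 i = a1 i * a2 p by move: i11; lra.
have j21' : a2 p * (a0 j - a3 j) = a2 j * (a0 p - a3 p) by move: j21; lra.
have j12' : a1 p * (a0 j - a3 j) = a1 j * (a0 p - a3 p) by move: j12; lra.
have j11' : a1 p * a2 j = a1 j * a2 p by move: j11; lra.
suff [h1 h2 h3] : [/\ a2 i * (a0 j - a3 j) = a2 j * (a0 i - a3 i), a1 i * a2 j = a1 j * a2 i &
    a1 i * (a0 j - a3 j) = a1 j * (a0 i - a3 i)].
  by split; lra.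
move: (a0 p - a3 p) (a0 i - a3 i) (a0 j - a3 j) i21' i12' i11' j21' j12' j11' hz => xp xi xj.
move: (a1 p) (a1 i) (a1 j) (a2 p) (a2 i) (a2 j) => yp yi yj zp zi zj h1 h2 h3 h4 h5 h6.
rewrite !inE => /or3P[] /eqP ez; move: z0; rewrite ez => /mulfI inj; split; apply: inj.
- transitivity (xj * (zi * xp)); [ring | rewrite -h1]; transitivity (xi * (zp * xj)); [ring | rewrite h4; ring].
- transitivity (zj * (yi * xp)); [ring | rewrite -h2]; transitivity (xi * (yp * zj)); first by ring.
  rewrite h6; transitivity (yj * (zp * xi)); [ring | rewrite h1; ring].
- transitivity (xj * (yi * xp)); [ring | rewrite -h2]; transitivity (xi * (yp * xj)); [ring | rewrite h5; ring].
- transitivity (xj * (yp * zi)); [ring | rewrite h3]; transitivity (yi * (zp * xj)); first by ring.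
  rewrite h4; transitivity (zj * (yi * xp)); [ring | rewrite -h2; ring].
- transitivity (yi * (yp * zj)); [ring | rewrite h6]; transitivity (yj * (yi * zp)); [ring | rewrite -h3; ring].
- transitivity (yi * (yp * xj)); [ring | rewrite h5]; transitivity (yj * (yi * xp)); [ring | rewrite -h2; ring].
- transitivity (zi * (zp * xj)); [ring | rewrite h4]; transitivity (zj * (zi * xp)); [ring | rewrite -h1; ring].
- transitivity (zj * (yi * zp)); [ring | rewrite -h3]; transitivity (zi * (yp * zj)); [ring | rewrite h6; ring].
- transitivity (yi * (zp * xj)); [ring | rewrite h4]; transitivity (zj * (yi * xp)); [ring | rewrite -h2].
  transitivity (xi * (yp * zj)); [ring | rewrite h6; ring].
Qed.

(** A nonzero v is parallel to the given eigenvector, so it inherits the eigenvalues. *)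
Lemma eigen_vecP : let v := eigen_vec n inp in
  (v != (0, 0) /\ forall i, (i < n)%N -> a0 i * v.1 + a1 i * v.2 = lam i * v.1 /\
    a2 i * v.1 + a3 i * v.2 = lam i * v.2) \/
  (v = (0, 0) /\ forall i j, (i < n)%N -> (j < n)%N -> commuting i j).
Proof.
have := eigen_iter_inv (leqnn n); rewrite /eigen_vec; move: (eigen_iter inp n) => [p v] /=.
rewrite /parallel => -[par [v0|[v0 hc hs]]]; [left | right]; split=> //.
- move=> i iN; have := eigen1 iN; have := eigen2 iN => e2 e1.
  have f1 : v.1 * (a0 i * e.1 + a1 i * e.2 - lam i * e.1) = 0 by rewrite e1; ring.
  have f2 : v.2 * (a0 i * e.1 + a1 i * e.2 - lam i * e.1) = 0 by rewrite e1; ring.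
  have f3 : v.1 * (a2 i * e.1 + a3 i * e.2 - lam i * e.2) = 0 by rewrite e2; ring.
  have f4 : v.2 * (a2 i * e.1 + a3 i * e.2 - lam i * e.2) = 0 by rewrite e2; ring.
  case/orP: e_neq0 => /mulIf inj; split; apply: inj; apply/eqP; rewrite -subr_eq0; apply/eqP.
  + transitivity (v.1 * (a0 i * e.1 + a1 i * e.2 - lam i * e.1) + a1 i * (v.2 * e.1 - v.1 * e.2)); first by ring.
    by rewrite f1 par; ring.
  + transitivity (v.1 * (a2 i * e.1 + a3 i * e.2 - lam i * e.2) + (a3 i - lam i) * (v.2 * e.1 - v.1 * e.2)); first by ring.
    by rewrite f3 par; ring.
  + transitivity (v.2 * (a0 i * e.1 + a1 i * e.2 - lam i * e.1) + (a0 i - lam i) * (v.1 * e.2 - v.2 * e.1)); first by ring.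
    by rewrite f2 par; ring.
  + transitivity (v.2 * (a2 i * e.1 + a3 i * e.2 - lam i * e.2) + a2 i * (v.1 * e.2 - v.2 * e.1)); first by ring.
    by rewrite f4 par; ring.
- move=> i j iN jN; case: hs => [hs|hs]; first by apply: commuting_trans hs (hc i iN) (hc j jN).
  have h k z : (k < n)%N -> z \in [:: a0 k - a3 k; a1 k; a2 k] -> z = 0.
    by move=> kn hz; apply/eqP; apply: contraNT (hs k kn) => nz; apply/nonscalarP; exists z.
  have h1 : a0 j = a3 j by apply/eqP; rewrite -subr_eq0; apply/eqP; apply: (h j); rewrite ?mem_head.
  have h2 : a1 j = 0 by apply: (h j); rewrite ?inE ?eqxx ?orbT.
  have h3 : a2 j = 0 by apply: (h j); rewrite ?inE ?eqxx ?orbT.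
  by rewrite /commuting /comm21 /comm11 /comm12 -/(a0 j) -/(a1 j) -/(a2 j) -/(a3 j) h1 h2 h3; split; ring.
Qed.
End CommonEigenvector.

(** * Matrix products along lists of indices *)

Definition mprod (A : nat -> 'M[R]_2) (s : seq nat) : 'M[R]_2 :=
  foldl (fun M x => A x *m M) 1%:M s.

Lemma mprod_rcons A s x : mprod A (rcons s x) = A x *m mprod A s.
Proof. by rewrite /mprod foldl_rcons. Qed.

Lemma mprod_cat A s1 s2 : mprod A (s1 ++ s2) = mprod A s2 *m mprod A s1.
Proof.
elim/last_ind: s2 => [|s2 x IH]; first by rewrite cats0 /mprod /= mul1mx.
by rewrite -rcons_cat !mprod_rcons IH mulmxA.
Qed.

Lemma mprod_cons A x s : mprod A (x :: s) = mprod A s *m A x.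
Proof. by rewrite -cat1s mprod_cat /mprod /= mulmx1. Qed.

Lemma mprod_perm A s s' : {in s &, forall x y, A x *m A y = A y *m A x} -> perm_eq s s' ->
  mprod A s = mprod A s'.
Proof.
elim: s s' => [|x s IH] s' comm; first by rewrite perm_sym => /perm_nilP->.
move=> hp; have xs : x \in s' by rewrite -(perm_mem hp) mem_head.
case/path.splitPr: xs hp => s1 s2; rewrite perm_sym perm_catC cat_cons perm_cons perm_catC perm_sym => hp.
rewrite mprod_cons (IH _ _ hp); last first.
  by move=> y z ys zs; apply: comm; rewrite inE ?ys ?zs orbT.
rewrite !mprod_cat mprod_cons -!mulmxA; congr (_ *m _).
have : {in s1, forall y, A x *m A y = A y *m A x}.
  by move=> y ys; apply: comm; rewrite inE ?eqxx // (perm_mem hp) mem_cat ys orbT.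
elim/last_ind: s1 {hp} => [|s1 y IH1] h; first by rewrite /mprod /= mulmx1 mul1mx.
rewrite mprod_rcons -mulmxA IH1 => [|z zs]; last by apply: h; rewrite mem_rcons inE zs orbT.
by rewrite !mulmxA h // mem_rcons mem_head.
Qed.

Lemma enum_rev_ord n : [seq rev_ord i | i <- enum 'I_n] = rev (enum 'I_n).
Proof.
case: n => [|n]; first by rewrite (size0nil (size_enum_ord 0)).
have sz := size_enum_ord n.+1; apply: (@eq_from_nth _ ord0); first by rewrite size_map size_rev.
move=> i; rewrite size_map sz => lt; apply: val_inj.
rewrite nth_rev ?sz // (nth_map ord0) ?sz //= !nth_enum_ord //; lia.
Qed.

Lemma perm_productE n (Ms : 'I_n -> 'M[R]_2) (A : nat -> 'M[R]_2) (s : 'S_n) :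
  (forall i : 'I_n, A i = Ms i) -> perm_product Ms s = mprod A [seq val (s i) | i <- enum 'I_n].
Proof.
move=> h; rewrite /perm_product /index_enum -enumT.
rewrite -(big_map (@rev_ord n) xpredT (fun i => Ms (s i))) enum_rev_ord.
elim: (enum 'I_n) => [|x l IH]; first by rewrite big_nil.
have cat_mul s1 i : \big[mulmx/1%:M]_(j <- rcons s1 i) Ms (s j) =
    (\big[mulmx/1%:M]_(j <- s1) Ms (s j)) *m Ms (s i).
  elim: s1 => [|j s1 IH1] /=; first by rewrite big_cons !big_nil mul1mx mulmx1.
  by rewrite !big_cons IH1 mulmxA.
by rewrite rev_cons cat_mul IH /= mprod_cons h.
Qed.

(** * The objective in triangular coordinates *)

Section Objective.
Variables (n : nat) (Ms : 'I_n -> 'M[R]_2) (w y : 'cV[R]_2).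
Hypothesis htri : simult_triangularizable Ms.
Let inp := rmem (input_state Ms w y).

Definition mat i : 'M[R]_2 := \matrix_(r, c) inp (4 * i + (2 * r + c)).

Lemma inpE i (h : (i < n)%N) e : (e < 4)%N -> inp (4 * i + e) = entry4 (Ms (Ordinal h)) e.
Proof.
move=> he; rewrite /inp /=; have -> : ((4 * i + e) %/ 4 = i)%N by lia.
have -> : ((4 * i + e) %% 4 = e)%N by lia.
by case: insubP => [j _ ej|]; [congr (entry4 (Ms _) _); apply: val_inj | rewrite h].
Qed.

Lemma mat_inp (i : 'I_n) : mat i = Ms i.
Proof.
apply/matrixP => r c; rewrite mxE (inpE (ltn_ord i)); last first.
  by have := ltn_ord r; have := ltn_ord c; lia.
have -> : Ordinal (ltn_ord i) = i by apply: val_inj.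
rewrite /entry4; congr (Ms i _ _); apply: val_inj; rewrite /= inordK;
  have := ltn_ord r; have := ltn_ord c; lia.
Qed.

Lemma inp_last e : (e < 4)%N -> inp (4 * n + e) = [:: w 0 0; w 1 0; y 0 0; y 1 0]`_e.
Proof.
move=> he; rewrite /inp /=; have -> : ((4 * n + e) %/ 4 = n)%N by lia.
case: insubP => [j|_]; first by rewrite ltnn.
case: e he => [|[|[|[|]]]] // _ /=; rewrite ?addn0 ?addn1 ?addn2 ?addn3 ?eqxx //.
- by rewrite ifF //; lia.
- by rewrite !ifF //; lia.
- by rewrite !ifF //; lia.
Qed.

(** The first column of the triangularizing matrix. *)
Lemma common_eigenvector : exists (e : R * R) (lam : nat -> R),
  [/\ (e.1 != 0) || (e.2 != 0),
   forall i, (i < n)%N -> m_ inp i 0 * e.1 + m_ inp i 1 * e.2 = lam i * e.1 &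
   forall i, (i < n)%N -> m_ inp i 2 * e.1 + m_ inp i 3 * e.2 = lam i * e.2].
Proof.
have [P [uP tP]] := htri; set e := col 0 P.
have eE : e = P *m delta_mx 0 0 by rewrite /e colE.
have he i : Ms i *m e = (invmx P *m Ms i *m P) 0 0 *: e.
  have -> : Ms i *m e = P *m col 0 (invmx P *m Ms i *m P).
    by rewrite eE colE !mulmxA mulmxV // mul1mx.
  move: (tP i (lift ord0 ord0) 0 isT); set T := _ *m P => T10.
  move: T T10 => T T10; apply/matrixP => r c.
  rewrite mxE !big_ord_recl big_ord0 addr0 !mxE T10 mulr0 addr0 mulrC.
  by congr (T _ _ * P _ _); apply: val_inj.
exists (e 0 0, e 1 0), (fun i => if insub i is Some j then (invmx P *m Ms j *m P) 0 0 else 0); split=> /=.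
- apply/negP => /negP; rewrite negb_or !negbK => /andP[/eqP z0 /eqP z1].
  have : e = 0.
    by apply/matrixP => r c; rewrite [c]ord1 [RHS]mxE; case: r => [[|[|]] //] h;
      [rewrite -[RHS]z0 | rewrite -[RHS]z1]; congr (e _ _); apply: val_inj.
  move=> /(congr1 (mulmx (invmx P))); rewrite mulmx0 eE mulKmx // => /matrixP/(_ 0 0).
  by rewrite !mxE => /eqP; rewrite oner_eq0.
- move=> i h; rewrite insubT /=; have := he (Ordinal h).
  move=> /matrixP/(_ 0 0); rewrite !mxE !big_ord_recl big_ord0 !mxE addr0 /= => <-.
  rewrite /m_ !(inpE h) // /entry4 /=; congr (_ * _ + _ * _);
    by [congr (Ms _ _ _); apply: val_inj; rewrite /= inordK | congr (P _ _); apply: val_inj].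
- move=> i h; rewrite insubT /=; have := he (Ordinal h).
  move=> /matrixP/(_ 1 0); rewrite !mxE !big_ord_recl big_ord0 !mxE addr0 /= => <-.
  rewrite /m_ !(inpE h) // /entry4 /=; congr (_ * _ + _ * _);
    by [congr (Ms _ _ _); apply: val_inj; rewrite /= inordK | congr (P _ _); apply: val_inj].
Qed.

Definition obj l := (w^T *m mprod mat l *m y) 0 0.
Let v := eigen_vec n inp.
Let sg := v.1 * v.1 + v.2 * v.2.
Let traw := tri_raw inp v.

(* Coordinates of the products in the orthogonal basis formed by the common
   eigenvector v and its rotation u by a quarter turn. *)
Lemma mprod_coord lam l : (forall i, (i < n)%N -> m_ inp i 0 * v.1 + m_ inp i 1 * v.2 = lam i * v.1 /\
    m_ inp i 2 * v.1 + m_ inp i 3 * v.2 = lam i * v.2) -> all (fun i => i < n)%N l ->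
  let M := mprod mat l in let T := tprod traw l in let s := sg ^+ size l in
  [/\ s * (M 0 0 * v.1 + M 0 1 * v.2) = ta T * v.1, s * (M 1 0 * v.1 + M 1 1 * v.2) = ta T * v.2,
      s * (M 0 1 * v.1 - M 0 0 * v.2) = tb T * v.1 - td T * v.2 &
      s * (M 1 1 * v.1 - M 1 0 * v.2) = tb T * v.2 + td T * v.1].
Proof.
move=> hl; elim/last_ind: l => [_|l x IH].
  by rewrite /mprod /tprod /= !mxE /= expr0; split; ring.
rewrite all_rcons size_rcons => /andP[xn /IH[h1 h2 h3 h4]].
have [l1 l2] := hl x xn.
rewrite mprod_rcons tprod_rcons exprS /=.
have e00 r c : (mat x *m mprod mat l) r c = mat x r 0 * mprod mat l 0 c + mat x r 1 * mprod mat l 1 c.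
  by rewrite mxE !big_ord_recl big_ord0 addr0 (_ : lift ord0 ord0 = 1) //; apply: val_inj.
have m00 : mat x 0 0 = m_ inp x 0 by rewrite mxE.
have m01 : mat x 0 1 = m_ inp x 1 by rewrite mxE.
have m10 : mat x 1 0 = m_ inp x 2 by rewrite mxE.
have m11 : mat x 1 1 = m_ inp x 3 by rewrite mxE.
rewrite !e00 m00 m01 m10 m11 {e00 m00 m01 m10 m11}.
move: (mprod mat l) h1 h2 h3 h4 => M; rewrite /traw /tri_raw /= -/traw /sg.
move: (M 0 0) (M 0 1) (M 1 0) (M 1 1) => M00 M01 M10 M11 {M}.
move: (tprod traw l) => [A B D] /=; move: l1 l2; rewrite -/sg.
move: (m_ inp x 0) (m_ inp x 1) (m_ inp x 2) (m_ inp x 3) (lam x) (sg ^+ size l) => a b c d L s.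
have -> : sg = v.1 * v.1 + v.2 * v.2 by [].
move: v.1 v.2 => p q l1 l2 h1 h2 h3 h4.
split.
- transitivity ((p * p + q * q) * (a * (s * (M00 * p + M01 * q)) + b * (s * (M10 * p + M11 * q)))); first by ring.
  by rewrite h1 h2; transitivity (A * (p * p + q * q) * (a * p + b * q)); [ring | rewrite l1 l2; ring].
- transitivity ((p * p + q * q) * (c * (s * (M00 * p + M01 * q)) + d * (s * (M10 * p + M11 * q)))); first by ring.
  by rewrite h1 h2; transitivity (A * (p * p + q * q) * (c * p + d * q)); [ring | rewrite l1 l2; ring].
- transitivity ((p * p + q * q) * (a * (s * (M01 * p - M00 * q)) + b * (s * (M11 * p - M10 * q)))); first by ring.
  rewrite h3 h4; transitivity ((p * p + q * q) * (B * (a * p + b * q) + D * (b * p - a * q))); first by ring.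
  by rewrite l1 l2; ring.
- transitivity ((p * p + q * q) * (c * (s * (M01 * p - M00 * q)) + d * (s * (M11 * p - M10 * q)))); first by ring.
  rewrite h3 h4; transitivity ((p * p + q * q) * (B * (c * p + d * q) + D * (d * p - c * q))); first by ring.
  by rewrite l1 l2; ring.
Qed.

(** Only the first summand depends on the order, since the diagonal entries of T are products of
    numbers. *)
Lemma obj_coord lam l : (forall i, (i < n)%N -> m_ inp i 0 * v.1 + m_ inp i 1 * v.2 = lam i * v.1 /\
    m_ inp i 2 * v.1 + m_ inp i 3 * v.2 = lam i * v.2) -> all (fun i => i < n)%N l ->
  let T := tprod traw l in sg * sg ^+ size l * obj l = coef0 n inp v * tb T +
    ((y 0 0 * v.1 + y 1 0 * v.2) * ta T * (w 0 0 * v.1 + w 1 0 * v.2) +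
     (y 1 0 * v.1 - y 0 0 * v.2) * td T * (w 1 0 * v.1 - w 0 0 * v.2)).
Proof.
move=> hl al; have [/= h1 h2 h3 h4] := mprod_coord hl al.
have -> : obj l = w 0 0 * (mprod mat l 0 0 * y 0 0 + mprod mat l 0 1 * y 1 0) +
    w 1 0 * (mprod mat l 1 0 * y 0 0 + mprod mat l 1 1 * y 1 0).
  rewrite /obj -mulmxA mxE !big_ord_recl big_ord0 addr0 !mxE !big_ord_recl !big_ord0 !addr0.
  by rewrite (_ : lift ord0 ord0 = 1); last exact: val_inj.
rewrite /coef0 /m_ !inp_last //=; move: h1 h2 h3 h4.
move: (mprod mat l) (tprod traw l) => M [A B D] /=.
move: (M 0 0) (M 0 1) (M 1 0) (M 1 1) => a b c d {M}.
move: (sg ^+ size l) (w 0 0) (w 1 0) (y 0 0) (y 1 0) => s w0 w1 y0 y1.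
have -> : sg = v.1 * v.1 + v.2 * v.2 by [].
move: v.1 v.2 => p q h1 h2 h3 h4.
transitivity (w0 * ((y0 * p + y1 * q) * (s * (a * p + b * q)) + (y1 * p - y0 * q) * (s * (b * p - a * q))) +
  w1 * ((y0 * p + y1 * q) * (s * (c * p + d * q)) + (y1 * p - y0 * q) * (s * (d * p - c * q)))); first by ring.
by rewrite h1 h2 h3 h4; ring.
Qed.

Let c := coef_iter n inp v n.
Definition sgn i : R := if flipped inp v i then -1 else 1.

Lemma tprod_pos l : let p := \prod_(x <- l) sgn x in
  tprod (tri_pos inp v) l = Tri (p * ta (tprod traw l)) (p * tb (tprod traw l)) (p * td (tprod traw l)).
Proof.
elim/last_ind: l => [|l x IH]; first by rewrite /= big_nil !mul1r.
rewrite !tprod_rcons IH -cats1 big_cat big_cons big_nil /= mulr1 /tri_pos /sgn -/traw.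
move: (\prod_(_ <- _) _) (tprod traw l) => p M; case: (flipped _ _ _); rewrite /topp /tmul /=; congr Tri; ring.
Qed.

Lemma coef_iterE i : coef_iter n inp v i = coef0 n inp v * \prod_(x <- iota 0 i) sgn x.
Proof.
elim: i => [|i IH]; first by rewrite big_nil mulr1.
rewrite coef_iterS /coef_step IH -addn1 iotaD big_cat big_cons big_nil /= mulr1 /sgn.
by case: (flipped _ _ _); ring.
Qed.

Lemma tprod_fin l : tprod (tri_fin c (tri_pos inp v)) l =
  let T := tprod (tri_pos inp v) l in Tri (ta T) (if c < 0 then - tb T else tb T) (td T).
Proof.
elim/last_ind: l => [|l x IH]; first by rewrite /= oppr0; case: ifP.
by rewrite !tprod_rcons IH /tri_fin /tmul /=; case: ifP => _ /=; congr Tri; ring.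
Qed.

(** Flipping changes the coefficient and the product by the same sign, whose square is 1. The sign
    of [c] itself is absorbed by [tri_fin], so that minimizing the entry is always the right
    goal. *)
Lemma coef_tb l : perm_eq l (iota 0 n) -> coef0 n inp v * tb (tprod traw l) =
  `|c| * tb (tprod (tri_fin c (tri_pos inp v)) l).
Proof.
move=> hl; rewrite tprod_fin tprod_pos /= (perm_big _ hl) /=.
have -> : coef0 n inp v * tb (tprod traw l) = c * (\prod_(x <- iota 0 n) sgn x * tb (tprod traw l)).
  rewrite /c coef_iterE -mulrA; congr (_ * _); rewrite mulrA -[LHS]mul1r; congr (_ * _).
  rewrite -expr2 -prodrXl big1 // => i _.
  by rewrite /sgn; case: ifP => _; rewrite ?expr1n ?sqrrN ?expr1n.
by case: ltrP => h; rewrite ?mulrNN ?(ltr0_norm h) ?(ger0_norm h) ?mulrNN.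
Qed.

Lemma sg_gt0 : v != (0, 0) -> 0 < sg.
Proof.
rewrite /sg; case: v => p q /= ; rewrite xpair_eqE negb_and => h.
have := sqr_ge0 p; have := sqr_ge0 q; rewrite !expr2 => hq hp.
by case/orP: h; rewrite -sqr_gt0 => h; lra.
Qed.

Lemma commuting_mat i j : commuting inp i j -> mat i *m mat j = mat j *m mat i.
Proof.
move=> [h21 h11 h12]; apply/matrixP => r s.
rewrite !mxE !big_ord_recl !big_ord0 !addr0 !mxE /=.
move: h21 h11 h12; rewrite /comm21 /comm11 /comm12 /m_.
by case: r => [[|[|]] //] /= _; case: s => [[|[|]] //] /= _; rewrite ?addn0 ?addn1; lra.
Qed.

Theorem obj_le l l' : perm_eq l (iota 0 n) -> perm_eq l' (iota 0 n) ->
  tb (tprod (tri_fin c (tri_pos inp v)) l) <= tb (tprod (tri_fin c (tri_pos inp v)) l') ->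
  obj l <= obj l'.
Proof.
move=> hl hl' hle; have [e [lam [e0 e1 e2]]] := common_eigenvector.
have lt s : perm_eq s (iota 0 n) -> all (fun i => i < n)%N s.
  by move=> hs; apply/allP => x; rewrite (perm_mem hs) mem_iota.
have [[v0 hv]|[v0 hc]] := eigen_vecP e0 e1 e2; last first.
  rewrite /obj (@mprod_perm mat l l') //; last by rewrite (perm_trans hl) // perm_sym.
  move=> i j il jl; apply: commuting_mat; apply: hc; exact: (allP (lt l hl)).
have s0 := sg_gt0 v0.
have h := obj_coord hv (lt l hl); have h' := obj_coord hv (lt l' hl').
rewrite /= coef_tb // in h; rewrite /= coef_tb // in h'.
have p0 : 0 < sg * sg ^+ n by rewrite mulr_gt0 ?exprn_gt0.
rewrite (perm_size hl) size_iota in h; rewrite (perm_size hl') size_iota in h'.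
rewrite -(ler_pM2l p0) h h' !ta_tprod !td_tprod !(perm_big _ hl) !(perm_big _ hl') /=.
by rewrite lerD2r ler_wpM2l.
Qed.

Let f := tri_fin c (tri_pos inp v).

Lemma tri_fin_ta i : ta (f i) = ta (tri_pos inp v i).
Proof. by rewrite /f /tri_fin; case: ifP. Qed.

Lemma tri_fin_td i : td (f i) = td (tri_pos inp v i).
Proof. by rewrite /f /tri_fin; case: ifP. Qed.

Lemma isneg_sign i : isneg c (tri_pos inp v) i -> 0 < td (f i).
Proof.
rewrite /isneg /f tri_fin_ta tri_fin_td /tri_pos /flipped.
move: (tri_raw inp v i) => [A B D] /=; case: (ltrP D 0) => hD /=; first by rewrite !sub0r oppr_gt0.
by case: (ltrP 0 D) => hD' //=; case: (ltrP A 0) => //= hA; rewrite ?sub0r ?oppr_lt0 => hA'; lra.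
Qed.

(** A flip changes both diagonal entries, so their product is still the determinant times the square
    of [sg]. *)
Lemma isneg_det (i : 'I_n) : isneg c (tri_pos inp v) i -> \det (Ms i) < 0.
Proof.
move=> hi; have hd := isneg_sign hi; move: hi; rewrite /isneg -/f => ha.
have [e [lam [e0 e1 e2]]] := common_eigenvector.
have et : ta (traw i) * td (traw i) = ta (f i) * td (f i).
  by rewrite /f /tri_fin /tri_pos -/traw; case: ifP; case: ifP => _ _ //=; ring.
have : ta (traw i) * td (traw i) < 0 by rewrite et nmulr_rlt0.
have [[v0 hv]|[v0 _]] := eigen_vecP e0 e1 e2; last first.
  by rewrite /traw /tri_raw /= -/inp -/v (_ : v = (0, 0)) //= !mul0r !addr0 !mul0r ltxx.
have [l1 l2] := hv i (ltn_ord i); rewrite -/v in l1 l2.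
have s0 := sg_gt0 v0.
have -> : \det (Ms i) = m_ inp i 0 * m_ inp i 3 - m_ inp i 1 * m_ inp i 2.
  rewrite -mat_inp (expand_det_row _ 0) !big_ord_recl big_ord0 addr0 /cofactor !det_mx11 !mxE /= /m_.
  by rewrite /bump /= expr0 expr1; ring.
have -> : ta (traw i) * td (traw i) = sg ^+ 2 * (m_ inp i 0 * m_ inp i 3 - m_ inp i 1 * m_ inp i 2).
  rewrite /traw /tri_raw /= l1 l2 /sg.
  transitivity ((v.1 * v.1 + v.2 * v.2) * (v.1 * (m_ inp i 3 * (lam i * v.1) - m_ inp i 1 * (lam i * v.2)) -
     v.2 * (m_ inp i 2 * (lam i * v.1) - m_ inp i 0 * (lam i * v.2)))); first by ring.
  by rewrite -l1 -l2; ring.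
by rewrite pmulr_rlt0 // exprn_gt0.
Qed.

Lemma pos_ge0 i : ~~ isneg c (tri_pos inp v) i -> 0 <= ta (f i) /\ 0 <= td (f i).
Proof.
rewrite /isneg -/f -leNgt => h; split=> //; rewrite tri_fin_td /tri_pos /flipped.
move: (tri_raw inp v i) => [A B D] /=; case: (ltrP D 0) => hD /=; first by rewrite sub0r oppr_ge0 ltW.
by case: (ltrP 0 D) => hD' /=; [exact: ltW | case: (ltrP A 0) => _ /=; rewrite ?sub0r ?oppr_ge0].
Qed.

(** Only an inequality: if all matrices commute, v is zero and no index counts as negative. *)
Lemma size_negs : (size (negs c (tri_pos inp v) n) <= num_neg_det Ms)%N.
Proof.
rewrite /negs size_filter -(val_enum_ord n) count_map -size_filter /num_neg_det cardE.
apply: uniq_leq_size => [|i]; first by rewrite filter_uniq ?enum_uniq.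
by rewrite mem_filter => /andP[/isneg_det h _]; rewrite mem_enum inE.
Qed.

Lemma solves_of_list P T l : perm_eq l (iota 0 n) ->
  (exists s', run P T (input_state Ms w y) = Some s' /\ forall i, (i < n)%N -> nmem s' i.+1 = nth 0%N l i) ->
  (forall l', perm_eq l' (iota 0 n) -> tb (tprod f l) <= tb (tprod f l')) ->
  solves_within P T Ms w y.
Proof.
move=> hl [s' [hr hs]] hopt; exists s'; split=> //.
have sz : size l = n by rewrite (perm_size hl) size_iota.
have lt (i : 'I_n) : (nth 0%N l i < n)%N.
  have : nth 0%N l i \in l by rewrite mem_nth // sz.
  by rewrite (perm_mem hl) mem_iota.
have inj : injective (fun i => Ordinal (lt i)).
  move=> i j [/eqP]; rewrite nth_uniq ?sz ?(perm_uniq hl) ?iota_uniq //.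
  by move=> /eqP/val_inj.
exists (perm inj); split=> [i|t]; first by rewrite permE hs.
have el : [seq val (perm inj i) | i <- enum 'I_n] = l.
  rewrite -{2}(mkseq_nth 0%N l) sz /mkseq -(val_enum_ord n) -map_comp.
  by apply: eq_map => i; rewrite /= permE.
have ht : perm_eq [seq val (t i) | i <- enum 'I_n] (iota 0 n).
  apply: uniq_perm; rewrite ?iota_uniq //.
    by rewrite map_inj_uniq ?enum_uniq // => i j /val_inj/perm_inj.
  move=> x; rewrite mem_iota /= add0n; apply/mapP/idP => [[i _ ->]|h]; first exact: ltn_ord.
  by exists (t^-1%g (Ordinal h)); rewrite ?mem_enum // permKV.
rewrite /objective !(perm_productE _ mat_inp) el; apply: obj_le => //; exact: hopt.
Qed.
End Objective.

Local Open Scope nat_scope.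

(** * The two algorithms *)

Lemma run_le P t T s s' : run P t s = Some s' -> t <= T -> run P T s = Some s'.
Proof.
elim: t T s => [|t IH] [|T] s //=; case: (step P s) => // s1; exact: IH.
Qed.

Definition core_prog := eigen_prog ;; tri_prog ;; key_prog ;; sort_prog.
Definition rot_solver := core_prog ;; rot_prog.
Definition dp_solver := core_prog ;; dp_prog.

Lemma wf_rot_solver : wf rot_solver. Proof. by []. Qed.
Lemma wf_dp_solver : wf dp_solver. Proof. by []. Qed.

Definition Kcore := tm eigen_prog + tm eigen_body + tm tri_prog + tm tri_body +
  tm key_prog + tm key_body + tm sort_prog + (tm sort_prog + tm pass_prog + tm merge_body + tm copy_body).
Definition Krot := tm suffix_prog + tm suffix_body + (tm best_prog + tm rot_body) +
  (tm write_prog + tm write_body).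

Lemma rot_prog_ok n inp f l s : rdata n f l s ->
  wp n inp rot_prog s (Krot * (size l).+1) (fun s' => nv s' 0 0 = n /\ exists b,
    (forall t, t < size l -> nv s' OUT (n + t) = nth 0 (rot b l) t) /\
    forall i, i <= size l -> (rot_val f l b <= rot_val f l i)%R).
Proof.
move=> hr; apply: wp_le.
- apply: wp_seq2; first exact: (suffix_prog_ok inp hr).
  move=> s2 [hr2 suf2]; apply: wp_seq2; first exact: (best_prog_ok inp hr2 suf2).
  move=> s3 [hr3 b3 min3]; set b := nv s3 14 0 in b3 min3.
  apply: wp_weak; [exact: (write_prog_ok inp hr3 (erefl b) b3) | exact: leqnn |].
  move=> s4 [n4 out4]; split=> //; exists b; split=> // i il.
  case: b3 => [s0|bn]; first by rewrite /rot_val (size0nil s0).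
  move: il; rewrite leq_eqVlt => /predU1P[->|]; last exact: min3.
  by rewrite {2}/rot_val rot_size -{2}(rot0 l); apply: min3; exact: leq_ltn_trans bn.
- by rewrite /Krot !mulnDl addnA.
Qed.

Lemma rot_window (l : seq nat) i : i <= size l ->
  [seq nth 0 (l ++ l) t | t <- iota i (size l)] = rot i l.
Proof.
move=> il; apply: (@eq_from_nth _ 0); first by rewrite size_map size_iota size_rot.
move=> j; rewrite size_map size_iota => jl; rewrite (nth_map 0) ?size_iota // nth_iota //.
rewrite /rot !nth_cat size_drop nth_drop.
have -> : (j < size l - i) = (i + j < size l) by move: il; clear; lia.
case: ltnP => h //; rewrite nth_take; last by move: jl h il; clear; lia.
by congr nth; move: h il; clear; lia.
Qed.

Section Solver.
Variables (n : nat) (Ms : 'I_n -> 'M[R]_2) (w y : 'cV[R]_2).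
Hypothesis htri : simult_triangularizable Ms.
Let inp := rmem (input_state Ms w y).
Let v := eigen_vec n inp.
Let c := coef_iter n inp v n.
Let f := tri_fin c (tri_pos inp v).
Let pos := poss c (tri_pos inp v) n.
Let neg := negs c (tri_pos inp v) n.

Record sorted_data pos' s : Prop := SortedData { sd_perm : perm_eq pos' pos;
  sd_sorted : sorted (fun i j => (pseudo_angle (f i) <= pseudo_angle (f j))%R) pos';
  sd_n : nv s 0 0 = n; sd_m : nv s 4 0 = size pos'; sd_k : nv s 5 0 = size neg;
  sd_neg : holds_arr s 6 neg; sd_pos : holds_arr s 7 pos';
  sd_tri : forall i, i < n -> holds_tri s i (f i) }.

Lemma size_pos_le : size pos <= n.
Proof. by rewrite /pos /poss size_filter (leq_trans (count_size _ _)) ?size_iota. Qed.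

Lemma core_prog_ok : wp n inp core_prog (init_st n)
  (Kcore * ((up_log 2 n + 4) * n.+1)) (fun s => exists pos', sorted_data pos' s).
Proof.
apply: wp_le.
- apply: wp_seq2; first exact: eigen_prog_ok.
  move=> s1 [n1 x1 y1]; apply: wp_seq2; first exact: tri_prog_ok n1 x1 y1.
  move=> s2 [n2 c2 t2]; apply: wp_seq2; first exact: key_prog_ok n2 c2 t2.
  move=> s3 [n3 m3 k3 neg3 pos3 tri3]; apply: wp_weak.
  + apply: (@sort_prog_ok n inp (fun i => pseudo_angle (f i)) s3 pos) => //.
    by move=> x; rewrite mem_filter mem_iota => /and3P[_ _ /tri3[]].
  + exact: leqnn.
  + move=> s4 [pos' [hp hs h7 [e0 e4 e5 e6 er]]]; exists pos'; split=> //; rewrite ?e0 ?e4 ?e5 //.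
    * by rewrite m3 (perm_size hp).
    * by move=> t /neg3 <-; rewrite e6.
    * by move=> i /tri3[]; rewrite /holds_tri !er.
- have hm := size_pos_le; have hu : up_log 2 (size pos) <= up_log 2 n by apply: leq_up_log.
  have h1 : (up_log 2 (size pos)).+1 * (size pos).+1 <= (up_log 2 n).+1 * n.+1 by apply: leq_mul.
  rewrite /Kcore; move: h1; rewrite mulnCA.
  move: (_ * (size pos).+1) (up_log 2 n) => P u h1.
  move: (tm eigen_prog) (tm eigen_body) (tm tri_prog) (tm tri_body) (tm key_prog) (tm key_body).
  move: (tm sort_prog) (_ + tm copy_body) => a b a1 a2 a3 a4 a5 a6.
  have := leq_mul (leqnn b) h1; move: h1; clear; nia.
Qed.

Lemma perm_all_indices l : perm_eq l (pos ++ neg) -> perm_eq l (iota 0 n).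
Proof.
move=> h; apply: perm_trans h _; rewrite /pos /neg /poss /negs perm_catC.
by rewrite (perm_filterC (isneg c (tri_pos inp v))).
Qed.

Lemma pos_lt pos' s i : sorted_data pos' s -> i \in pos' -> i < n.
Proof. by move=> [hp _ _ _ _ _ _ _]; rewrite (perm_mem hp) mem_filter mem_iota => /andP[]. Qed.

Lemma structure pos' s : sorted_data pos' s ->
  exists t l, [/\ perm_eq t (pos ++ neg), optimal f t, l <= size pos',
    grow (nth 0 (pos' ++ pos')) (nth 0 neg) (size neg) (2 ^ size neg).-1 l (size pos') t &
    neg = [::] -> t = rot l pos'].
Proof.
move=> [hp hs _ _ _ _ _ _].
have hpn : perm_eq (pos' ++ neg) (pos ++ neg) by rewrite perm_cat2r.
have [||||t [l [h1 h2 h3 h4 h5]]] := @optimal_structure _ _ f 0 pos' neg.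
- rewrite (perm_uniq hpn) /pos /neg /poss /negs uniq_catC.
  by rewrite (perm_uniq (permEl (perm_filterC (isneg c (tri_pos inp v)) _))) iota_uniq.
- by move=> i; rewrite (perm_mem hp) mem_filter => /andP[/pos_ge0].
- by move=> i; rewrite mem_filter => /andP[h _]; split=> //; exact: isneg_sign.
- exact: hs.
- by exists t, l; split=> //; exact: perm_trans h1 hpn.
Qed.

Lemma rot_solver_ok : neg = [::] -> wp n inp rot_solver (init_st n)
  ((Kcore + Krot) * ((up_log 2 n + 4) * n.+1)) (fun s => nv s 0 0 = n /\ exists l,
    [/\ perm_eq l (iota 0 n), forall i, i < n -> nv s OUT (n + i) = nth 0 l i &
        forall l', perm_eq l' (iota 0 n) -> (tb (tprod f l) <= tb (tprod f l'))%R]).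
Proof.
move=> neg0; apply: wp_le.
- apply: (wp_seq2 (t2 := Krot * n.+1) core_prog_ok).
  move=> s1 [pos' hd]; have [hp hs n1 m1 k1 h6 h7 h3] := hd.
  have hr : rdata n f pos' s1 by split=> // x /(pos_lt hd)/h3.
  have hpi : perm_eq pos' (iota 0 n).
    by apply: perm_all_indices; rewrite neg0 cats0.
  have sz : size pos' = n by rewrite (perm_size hpi) size_iota.
  have := rot_prog_ok inp hr; rewrite sz => h; apply: wp_weak h (leqnn _) _.
  move=> s2 [n2 [b [out2 min2]]]; split=> //; exists (rot b pos'); split=> //.
  + by rewrite perm_rot.
  + move=> l' hl'; have [t [l [ht opt ll _ /(_ neg0) et]]] := structure hd.
    have le1 : (tb (tprod f t) <= tb (tprod f l'))%R.
      by apply: opt; rewrite (perm_trans hl') // perm_sym; exact: perm_all_indices.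
    by apply: le_trans le1; rewrite et; apply: min2; rewrite -sz.
- move: Kcore Krot (up_log 2 n); clear; nia.
Qed.

Let m := size pos.
Let k := size neg.

Definition Kdp := Ksetup + Kmain + Kfinal.

Lemma dp_solver_ok : wp n inp dp_solver (init_st n)
  ((Kcore + Kdp) * ((up_log 2 n + 4) * n.+1 + ((k + 3) * (m + m + 1).+1 * (m + 2) * (2 ^ k).+1 + (2 * n + 3))))
  (fun s => nv s 0 0 = n /\ exists l,
    [/\ perm_eq l (iota 0 n), forall i, i < n -> nv s OUT (n + i) = nth 0 l i &
        forall l', perm_eq l' (iota 0 n) -> (tb (tprod f l) <= tb (tprod f l'))%R]).
Proof.
have mk : m + k = n.
  by rewrite /m /k -size_cat (perm_size (perm_all_indices (perm_refl _))) size_iota.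
apply: wp_le.
- apply: (wp_seq2 (t2 := Ksetup * (m + k + 3) + (Kmain * ((k + 3) * (m + m + 1).+1 * (m + 2) * (2 ^ k).+1) +
    Kfinal * (m + n + 3))) core_prog_ok).
  move=> s1 [pos' hd]; have [hp hs n1 m1 k1 h6 h7 h3] := hd.
  have em : m = size pos' by rewrite (perm_size hp).
  have lt x : x \in pos' ++ neg -> x < n.
    by rewrite mem_cat => /orP[/(pos_lt hd)//|]; rewrite mem_filter mem_iota => /andP[].
  have hpi : perm_eq (pos' ++ neg) (iota 0 n).
    by apply: perm_all_indices; rewrite perm_cat2r.
  rewrite em; apply: wp_seq2.
    by apply: (dp_setup_ok (f := f) inp n1 m1 k1 h7 h6) => x /lt/h3.
  move=> s2 d2; apply: wp_seq2; first exact: dp_main_ok d2.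
  move=> s3 [d3 c3 i3]; apply: wp_weak; first by apply: (dp_final_ok inp _ d3 c3 i3); rewrite -em.
    exact: leqnn.
  move=> s4 [n4 [lst [l0 [out4 ll0 hc hmin]]]]; split=> //; exists lst; split=> //.
  + apply: perm_trans hpi; rewrite (permPl (grow_perm hc)) rot_window //.
    rewrite (@eq_in_filter _ _ predT) ?filter_predT => [|j]; last first.
      by rewrite mem_iota /= add0n => jk; rewrite bit_full.
    by rewrite perm_cat // ?perm_rot // (_ : map _ _ = neg) //; exact: mkseq_nth.
  + move=> l' hl'; have [t [l [ht opt ll hg _]]] := structure hd.
    have := hmin l t ll hg => /le_trans; apply; apply: opt.
    by rewrite (perm_trans hl') // perm_sym; exact: perm_all_indices.
- rewrite /Kdp; have h1 : m + k + 3 <= 2 * n + 3 by rewrite mk; clear; lia.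
  have h2 : m + n + 3 <= 2 * n + 3 by move: mk; clear; lia.
  move: h1 h2; move: (_ * n.+1) (_ * (2 ^ k).+1) (m + k + 3) (m + n + 3) (2 * n + 3) => X Y a b d h1 h2.
  have := leq_mul (leqnn Ksetup) h1; have := leq_mul (leqnn Kfinal) h2.
  move: Ksetup Kmain Kfinal Kcore => k1 k2 k3 k4; clear; nia.
Qed.

Lemma rot_solver_solves : (forall i, (0 <= \det (Ms i))%R) ->
  solves_within (whole rot_solver) ((8 * (Kcore + Krot) + 106) * (n * (trunc_log 2 n).+1 + 1)) Ms w y.
Proof.
move=> hdet; have neg0 : neg = [::].
  apply/eqP; rewrite -size_eq0 -leqn0; apply: leq_trans (size_negs _ _ htri) _.
  rewrite leqn0 cards_eq0; apply/eqP/setP => i; rewrite !inE; apply/negbTE.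
  by rewrite -leNgt.
have [t [s [ht hev [hn [l [hl hout hmin]]]]]] := rot_solver_ok neg0.
have [s' [hr hs']] := whole_correct wf_rot_solver hev hn.
apply: (@solves_of_list _ _ _ _ htri _ _ l) => //; exists s'; split; last first.
  by move=> i lt; rewrite hs' // hout.
apply: run_le hr _; move: ht.
have hu : up_log 2 n <= (trunc_log 2 n).+1.
  by apply: up_log_min => //; apply: ltnW; exact: trunc_log_ltn.
move: hu (Kcore + Krot) => hu K ht.
(* The left side does not vanish for n = 0, which is what the summand 1 of the bound pays for. *)
have h1 : (up_log 2 n + 4) * n.+1 <= 8 * (n * (trunc_log 2 n).+1 + 1).
  have ht' : trunc_log 2 n <= n * trunc_log 2 n.
    by case: (posnP n) => [->|n0]; rewrite ?trunc_log0 // leq_pmull.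
  by move: hu ht'; rewrite !mulnDr mulnS muln1; move: (up_log _ _) (trunc_log _ _); clear; nia.
have h2 : 6 * n + 100 <= 106 * (n * (trunc_log 2 n).+1 + 1).
  by move: (trunc_log _ _); clear; nia.
have := leq_mul (leqnn K) h1; move: ht h2.
by move: (n * _ + 1) (_ * n.+1); clear; nia.
Qed.

Lemma dp_solver_solves : 0 < num_neg_det Ms ->
  solves_within (whole dp_solver)
    ((111 * (Kcore + Kdp) + 106) * num_neg_det Ms * 2 ^ num_neg_det Ms * n ^ 6) Ms w y.
Proof.
move=> q0; have [t [s [ht hev [hn [l [hl hout hmin]]]]]] := dp_solver_ok.
have [s' [hr hs']] := whole_correct wf_dp_solver hev hn.
apply: (@solves_of_list _ _ _ _ htri _ _ l) => //; exists s'; split; last first.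
  by move=> i lt; rewrite hs' // hout.
apply: run_le hr _; move: ht (size_negs w y htri) size_pos_le.
have n0 : 0 < n by apply: leq_trans q0 _; rewrite -{2}[n]card_ord; exact: max_card.
rewrite -/inp -/v -/c -/neg -/k -/m; move: (num_neg_det Ms) q0 => q q0 ht kq mn.
have hu : up_log 2 n <= n by apply: up_log_min => //; apply: ltnW; exact: ltn_expl.
have n26 : n ^ 2 <= n ^ 6 by rewrite leq_pexp2l.
have p2 : 2 ^ k <= 2 ^ q by rewrite leq_exp2l.
have p0 : 0 < 2 ^ k by rewrite expn_gt0.
have h1 : (up_log 2 n + 4) * n.+1 <= 10 * n ^ 2.
  by move: hu n0; rewrite expnS expn1; move: (up_log _ _); clear; nia.
(* The factor 96 is 4 * 4 * 3 * 2. The dynamic program takes quadratic time in n besides the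
   exponential factor; the sixth power only enters with [h6]. *)
have h2 : (k + 3) * (m + m + 1).+1 * (m + 2) * (2 ^ k).+1 <= 96 * (q * 2 ^ q * n ^ 2).
  have e1 : k + 3 <= 4 * q by move: kq q0; clear; lia.
  have e2 : (m + m + 1).+1 <= 4 * n by move: mn n0; clear; lia.
  have e3 : m + 2 <= 3 * n by move: mn n0; clear; lia.
  have e4 : (2 ^ k).+1 <= 2 * 2 ^ q by move: p2 p0; clear; lia.
  apply: leq_trans (leq_mul (leq_mul (leq_mul e1 e2) e3) e4) _.
  by rewrite expnS expn1; move: (2 ^ q); clear; nia.
have h3 : 2 * n + 3 <= 5 * n ^ 2 by move: n0; rewrite expnS expn1; clear; nia.
have h4 : 6 * n + 100 <= 106 * n ^ 2 by move: n0; rewrite expnS expn1; clear; nia.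
have Q0 : 0 < q * 2 ^ q by rewrite muln_gt0 q0 expn_gt0.
have h5 : n ^ 2 <= q * 2 ^ q * n ^ 2 by rewrite leq_pmull.
have h6 : q * 2 ^ q * n ^ 2 <= q * 2 ^ q * n ^ 6 by rewrite leq_mul2l n26 orbT.
rewrite -!mulnA (mulnA q); move: h1 h2 h3 h4 h5 h6 ht.
move: (q * 2 ^ q * n ^ 6) (q * 2 ^ q * n ^ 2) (n ^ 2) ((up_log 2 n + 4) * n.+1)
  ((k + 3) * (m + m + 1).+1 * (m + 2) * (2 ^ k).+1) => Y X Z A B h1 h2 h3 h4 h5 h6 ht.
(* Here 111 is 10 + 96 + 5, from [h1], [h2] and [h3]. *)
have h7 : A + (B + (2 * n + 3)) <= 111 * Y by move: h1 h2 h3 h5 h6; clear; lia.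
have := leq_mul (leqnn (Kcore + Kdp)) h7; move: ht h4 h5 h6; move: (Kcore + Kdp); clear; nia.
Qed.
End Solver.

Local Open Scope ring_scope.
Theorem theorem1p3 :
  (* (i) nonnegative determinants: O(n log n) time *)
  (exists (P : program) (C : nat),
     forall (n : nat) (Ms : 'I_n -> 'M[R]_2) (w y : 'cV[R]_2),
       simult_triangularizable Ms ->
       (forall i, 0 <= \det (Ms i)) ->
       solves_within P (C * (n * (trunc_log 2 n).+1 + 1)) Ms w y)
  /\
  (* (ii) k >= 1 matrices with negative determinant: O(k 2^k n^6) time *)
  (exists (P : program) (C : nat),
     forall (n : nat) (Ms : 'I_n -> 'M[R]_2) (w y : 'cV[R]_2),
       simult_triangularizable Ms ->
       (0 < num_neg_det Ms)%N ->
       solves_within P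
         (C * num_neg_det Ms * 2 ^ num_neg_det Ms * n ^ 6) Ms w y).
Proof.
split.
- exists (whole rot_solver), (8 * (Kcore + Krot) + 106)%N => n Ms w y.
  exact: rot_solver_solves.
- exists (whole dp_solver), (111 * (Kcore + Kdp) + 106)%N => n Ms w y.
  exact: dp_solver_solves.
Qed.
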